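(* Let $\alpha>0$ and $\sigma>0$. For $u\in H^2_{0,\mathrm{rad}}(B)$ set $F(u)=\int_B |x|^\alpha e^{\sigma u^2}\,dx$. Then $$T^{0,\mathrm{rad}}_\alpha:=\sup\left\{F(u): u\in H^2_{0,\mathrm{rad}}(B),\ \|\Delta u\|_2=1\right\}<+\infty \quad\Longleftrightarrow\quad \sigma\le 32\pi^2\left(1+\frac{\alpha}{4}\right).$$
   Context: $B\subset\mathbb R^4$ is the open unit ball centered at the origin. $H^2_0(B)$ is the usual Sobolev space with Dirichlet boundary conditions (closure of $C_c^\infty(B)$ in $H^2(B)$, real-valued functions), and $H^2_{0,\mathrm{rad}}(B)$ is its subspace of radially symmetric functions. $\|\cdot\|_2$ is the norm of $L^2(B)$. *)

(* Defs.v *)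
From HB Require Import structures.
From mathcomp Require Import all_boot all_order all_algebra.
From mathcomp Require Import all_classical all_reals all_analysis.

Set Implicit Arguments.
Unset Strict Implicit.
Unset Printing Implicit Defensive.

Import Order.TTheory GRing.Theory Num.Theory.
Import numFieldNormedType.Exports.

Local Open Scope classical_set_scope.
Local Open Scope ring_scope.

Section Sobolev.
Context {R : realType}.

(* R^4 is an iterated product, which carries both the product sigma-algebra and
   the product topology; the library's norm on it is the max norm, hence the
   separate Euclidean norm [enorm]. *)
Local Notation R4 := (R * R * R * R)%type.

Local Notation leb := (@lebesgue_measure R).

Local Notation leb4 := (leb \x leb \x leb \x leb)%E.

Definition enorm (x : R4) : R :=
  Num.sqrt (x.1.1.1 ^+ 2 + x.1.1.2 ^+ 2 + x.1.2 ^+ 2 + x.2 ^+ 2).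

Definition B : set R4 := [set x | enorm x < 1].

Definition basis4 (i : 'I_4) : R4 :=
  ((i == 0 :> nat)%:R, (i == 1 :> nat)%:R, (i == 2 :> nat)%:R,
   (i == 3 :> nat)%:R).

(* A partial derivative of order k is indexed by a sequence of k directions,
   differentiated from right to left; [::] stands for the function itself. *)
Definition partials (s : seq 'I_4) (f : R4 -> R) : R4 -> R :=
  foldr (fun i g x => 'D_(basis4 i) g x) f s.

Definition test_function (phi : R4 -> R) : Prop :=
  (forall s x, differentiable (partials s phi) x) /\
  (exists K : set R4,
     [/\ compact K, K `<=` B & forall x, ~ K x -> phi x = 0]).

Definition L2norm (f : R4 -> R) : \bar R := 'N[leb4]_2%:E[(EFin \o f) \_ B]%E.

Definition L2 (f : R4 -> R) : Prop :=
  measurable_fun B f /\ (L2norm f < +oo)%E.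

Definition is_weak_partial (s : seq 'I_4) (u v : R4 -> R) : Prop :=
  forall phi, test_function phi ->
    (\int[leb4]_(x in B) (u x * partials s phi x)%:E
     = ((-1) ^+ size s)%:E * \int[leb4]_(x in B) (v x * phi x)%:E)%E.

(* u is in H^2(B) and, up to null sets, Du s is its weak partial derivative
   along s, for s of size at most 2; the values of Du on longer sequences are
   irrelevant. *)
Definition H2 (u : R4 -> R) (Du : seq 'I_4 -> R4 -> R) : Prop :=
  Du [::] = u /\
  forall s, (size s <= 2)%N -> L2 (Du s) /\ is_weak_partial s u (Du s).

(* The H^2(B) norm of a function with weak partial derivatives Dv.  The sum is
   over ordered tuples of directions, so that the mixed second derivatives are
   counted twice; this only changes the norm to an equivalent one. *)
Definition H2norm (Dv : seq 'I_4 -> R4 -> R) : \bar R :=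
  ((\sum_(k < 3) \sum_(s : k.-tuple 'I_4) L2norm (Dv s) ^+ 2) `^ 2^-1)%E.

(* u is in H^2_0(B), the H^2(B)-closure of the test functions, with weak
   partial derivatives Du. *)
Definition H20 (u : R4 -> R) (Du : seq 'I_4 -> R4 -> R) : Prop :=
  H2 u Du /\
  forall e : R, 0 < e -> exists2 phi, test_function phi &
    (H2norm (fun s => (Du s \- partials s phi)%R) < e%:E)%E.

(* Elements of H^2_0(B) are classes modulo null sets, hence "almost every". *)
Definition radial (u : R4 -> R) : Prop :=
  exists g : R -> R, {ae leb4, forall x, B x -> u x = g (enorm x)}.

Definition H20rad (u : R4 -> R) (Du : seq 'I_4 -> R4 -> R) : Prop :=
  H20 u Du /\ radial u.

Definition laplacian (Du : seq 'I_4 -> R4 -> R) : R4 -> R :=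
  fun x => \sum_(i < 4) Du [:: i; i] x.

Definition F (alpha sigma : R) (u : R4 -> R) : \bar R :=
  (\int[leb4]_(x in B) (enorm x `^ alpha * expR (sigma * u x ^+ 2))%:E)%E.

Definition T0rad (alpha sigma : R) : \bar R :=
  ereal_sup [set F alpha sigma u | u in
    [set u | exists2 Du, H20rad u Du & L2norm (laplacian Du) = 1%E]].

End Sobolev.

(* Main.v *)
(* Upper bound.  Testing against the radial functions h(|x|^2) recovers a radial
   u in H^2_0(B) from its Laplacian f: almost everywhere u(x) = g(|x|) with
   g(r) = - (4 pi^2)^-1 \int_B f(x) max(r^2, |x|^2)^-1 dx, and \int_B f = 0.
   If |f|_2 = 1 and G(t) = sqrt(8 pi^2) g(e^-t), then Cauchy-Schwarz gives
   (p G(s) + q G(t))^2 <= p^2 s + 2 p q s + q^2 t for 0 < s <= t: G satisfies the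
   inequalities of a path with \int G'^2 <= 1 starting at 0.  On each compact
   interval these bound t - G(t)^2 from below by min(t, |t - a|) / 8 for some a,
   and in the variable t = - ln r the integral defining F is at most
   2 pi^2 \int e^(-4 (t - G(t)^2)) dt, hence bounded independently of u.

   Lower bound.  With L = - ln e, the smoothly truncated logarithms
   S(- ln (|x|^2 + e) / 2 - 1), S(y) = y e^(-1/y), are at least L / 2 - 3 on
   |x|^2 <= e, and the squared norm of their Laplacian is at most
   4 pi^2 (L + 2).  Normalized, they give F an exponential lower bound whose
   rate is positive when sigma exceeds the threshold. *)

(* The threshold comes from [r = exp (- t)]: the weight [r^(3 + alpha) dr] becomes
   [exp (- (4 + alpha) t) dt], and [sigma g^2 = sigma / (8 pi^2) * G^2]. The obstacle is regularity.
   Both [u] and its Laplacian are classes modulo null sets, no radial derivative of [u] is at hand,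
   and the Laplacian is never shown to be radial. So everything goes through pairings of the
   Laplacian with explicit radial kernels, and the energy bound on [G] is used at two points at a
   time, as positivity of a 2 by 2 matrix; no derivative of [G] occurs. The variable [|x|^2] makes
   radial kernels differentiable at the origin, but the maximum in the kernel of [g] is only
   Lipschitz: it is approached by C^2 functions, whose Laplacians concentrate on a sphere, and the
   value of [u] is recovered at Lebesgue points of its profile. *)
Require Import Defs.
From HB Require Import structures.
From mathcomp Require Import all_boot all_order all_algebra.
From mathcomp Require Import all_classical all_reals all_analysis.
From mathcomp Require Import measurable_realfun.
From mathcomp Require Import ring lra.

Set Implicit Arguments.
Unset Strict Implicit.
Unset Printing Implicit Defensive.
Import Order.TTheory GRing.Theory Num.Theory.
Import numFieldNormedType.Exports.

Local Open Scope classical_set_scope.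
Local Open Scope ring_scope.

(* The library has no usable instance of sigma-finiteness for [m1 \x m2], since
   that constant is already a key of the subprobability instance. *)
Section sigma_finite_product.
Context d1 d2 (T1 : measurableType d1) (T2 : measurableType d2) (R : realType).
Variable m1 : {sigma_finite_measure set T1 -> \bar R}.
Variable m2 : {sigma_finite_measure set T2 -> \bar R}.

Definition sf_product : set (T1 * T2) -> \bar R := (m1 \x m2)%E.

HB.instance Definition _ := Measure.on sf_product.

Let sf_product_sigma_finite : sigma_finite setT sf_product.
Proof.
have /sigma_finiteP[F [TF ndF Foo]] := sigma_finiteT m1.
have /sigma_finiteP[G [TG ndG Goo]] := sigma_finiteT m2.
exists (fun n => F n `*` G n).
  rewrite -setXTT TF TG predeqE => -[x y]; split.
    move=> [/= [n _ Fnx] [k _ Gky]]; exists (maxn n k) => //; split.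
    - by move: x Fnx; exact/subsetPset/ndF/leq_maxl.
    - by move: y Gky; exact/subsetPset/ndG/leq_maxr.
  by move=> [n _ []/= ? ?]; split; exists n.
move=> k; have [? ?] := Foo k; have [? ?] := Goo k.
split; first exact: measurableX.
by rewrite /sf_product product_measure1E// lte_mul_pinfty// ge0_fin_numE.
Qed.

HB.instance Definition _ :=
  Measure_isSigmaFinite.Build _ _ _ sf_product sf_product_sigma_finite.

End sigma_finite_product.

(** * Polar coordinates in R^4 *)

Section Polar.
Context {R : realType}.
Local Notation leb := (@lebesgue_measure R).
Local Notation leb3 := (leb \x leb \x leb)%E.
Local Notation leb4 := (leb \x leb \x leb \x leb)%E.
Local Notation R3 := (R * R * R)%type.
Local Notation R4 := (R * R * R * R)%type.

(** The image of [a] times Lebesgue measure under multiplication by [a] agrees with Lebesgue measure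
    on half-open intervals, hence on all measurable sets. *)
Lemma ge0_integral_scale (f : R -> \bar R) (a : R) :
  measurable_fun [set: R] f -> (forall x, 0 <= f x)%E -> 0 < a ->
  (\int[leb]_x f x = a%:E * \int[leb]_x f (a * x)%R)%E.
Proof.
move=> mf f0 a0.
pose m := (fun x => a * x) : measurableTypeR R -> measurableTypeR R.
have mmul : measurable_fun setT m by exact: measurable_funM.
have anng : (0 <= a)%R by exact: ltW.
have E (A : set R) : measurable A ->
    leb A = pushforward (mscale (NngNum anng) leb) m A.
  move=> mA; apply: lebesgue_measure_unique => //= _ [[x y]] _ <- /=.
  rewrite /mscale /pushforward/=.
  have -> : m @^-1` `]x, y] = `]x / a, y / a]%classic.
    apply/seteqP; split => z /=; rewrite /m !in_itv/= ltr_pdivrMr// ler_pdivlMr//;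
      by rewrite mulrC.
  rewrite !lebesgue_measure_itv/= !lte_fin ltr_pM2r ?invr_gt0//.
  case: ifPn => _; rewrite ?mule0// -!EFinB -EFinM -mulrBl mulrCA divff ?mulr1//.
  exact: lt0r_neq0.
rewrite (eq_measure_integral (pushforward (mscale (NngNum anng) leb) m)) => //.
  rewrite ge0_integral_pushforward//=.
  rewrite ge0_integral_mscale//=.
    by rewrite preimage_setT.
  exact: measurableT_comp.
by move=> A mA _; apply: E.
Qed.

(** The two assumptions and the conclusion have the same shape, so that the lemma can be iterated,
    with [m1] itself a product. *)
Lemma ge0_integral_scale_prod d1 d2 (T1 : measurableType d1)
    (T2 : measurableType d2) (m1 : {sigma_finite_measure set T1 -> \bar R})
    (m2 : {sigma_finite_measure set T2 -> \bar R}) (g1 : T1 -> T1)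
    (g2 : T2 -> T2) (c1 c2 : R) : 0 <= c1 -> 0 <= c2 ->
  measurable_fun setT g1 -> measurable_fun setT g2 ->
  (forall f : T1 -> \bar R, measurable_fun setT f -> (forall x, 0 <= f x)%E ->
    (\int[m1]_x f x = c1%:E * \int[m1]_x f (g1 x))%E) ->
  (forall f : T2 -> \bar R, measurable_fun setT f -> (forall x, 0 <= f x)%E ->
    (\int[m2]_x f x = c2%:E * \int[m2]_x f (g2 x))%E) ->
  forall f : T1 * T2 -> \bar R, measurable_fun setT f ->
    (forall x, 0 <= f x)%E ->
    (\int[m1 \x m2]_x f x
     = (c1 * c2)%:E * \int[m1 \x m2]_x f (g1 x.1, g2 x.2))%E.
Proof.
move=> c10 c20 mg1 mg2 H1 H2 f mf f0.
have m12 : measurable_fun setT (fun x : T1 * T2 => (x.1, g2 x.2)).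
  by apply/measurable_fun_pair => //=; exact: measurableT_comp.
have m12' : measurable_fun setT (fun x : T1 * T2 => (g1 x.1, g2 x.2)).
  by apply/measurable_fun_pair => //=; exact: measurableT_comp.
have mf2 : measurable_fun setT (fun x => f (x.1, g2 x.2)).
  exact: measurableT_comp mf m12.
have mf12 : measurable_fun setT (fun x => f (g1 x.1, g2 x.2)).
  exact: measurableT_comp mf m12'.
have mF := measurable_fun_fubini_tonelli_F (m2 := m2) _ mf2 (fun=> f0 _).
rewrite fubini_tonelli1//.
transitivity (\int[m1]_x (c2%:E * \int[m2]_y f (x, g2 y)))%E.
  apply: eq_integral => x _; rewrite [LHS]H2//.
  exact: measurableT_comp.
rewrite ge0_integralZl//=; last by move=> x _; exact: integral_ge0.
rewrite H1//; last by move=> x; exact: integral_ge0.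
by rewrite (fubini_tonelli1 (fun x => f (g1 x.1, g2 x.2)))// muleA -EFinM (mulrC c2).
Qed.

(** Polar coordinates without a measure on the sphere: the direction is given by its slopes [z] over
    the last axis. At fixed [s] the map is a dilation of R^3, and at fixed [z] the norm is
    proportional to [|s|]. *)
Definition ray (z : R3) (s : R) : R4 :=
  (`|s| * z.1.1, `|s| * z.1.2, `|s| * z.2, s).

Lemma measurable_ray : measurable_fun setT (fun x : R3 * R => ray x.1 x.2).
Proof.
apply/measurable_fun_pair => /=; last exact: measurable_snd.
apply/measurable_fun_pair => /=.
  apply/measurable_fun_pair => /=.
    apply: measurable_funM; first exact: measurableT_comp.
    by do 2 apply: measurableT_comp => //.
  apply: measurable_funM; first exact: measurableT_comp.
  by do 2 apply: measurableT_comp => //.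
apply: measurable_funM; first exact: measurableT_comp.
exact: measurableT_comp.
Qed.


(** Tonelli twice: substitute in the inner integral at fixed [s], then exchange the order of
    integration. *)
Lemma ge0_integral_fiberwise d (T : measurableType d)
    (m : {sigma_finite_measure set T -> \bar R}) (g : R -> T -> T) (c : R -> R) :
  measurable_fun setT (fun x : T * R => g x.2 x.1) ->
  measurable_fun [set: R] c -> (forall s, 0 <= c s) ->
  (forall s, s != 0 -> forall f : T -> \bar R,
    measurable_fun setT f -> (forall x, 0 <= f x)%E ->
    (\int[m]_x f x = (c s)%:E * \int[m]_x f (g s x))%E) ->
  forall f : T * R -> \bar R, measurable_fun setT f -> (forall x, 0 <= f x)%E ->
  (\int[m \x leb]_x f x
   = \int[m]_z \int[leb]_s ((c s)%:E * f (g s z, s)))%E.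
Proof.
move=> mg mc c0 H f mf f0.
have mgs : measurable_fun setT (fun x : T * R => (g x.2 x.1, x.2)).
  by apply/measurable_fun_pair => //=.
pose h (x : T * measurableTypeR R) := ((c x.2)%:E * f (g x.2 x.1, x.2))%E.
have mh : measurable_fun setT h.
  apply: emeasurable_funM.
    apply/measurable_EFinP; exact: measurableT_comp.
  exact: measurableT_comp mf mgs.
have h0 x : (0 <= h x)%E by rewrite mule_ge0// lee_fin.
rewrite fubini_tonelli2//.
transitivity (\int[leb]_s \int[m]_z h (z, s))%E; last first.
  by symmetry; exact: fubini_tonelli.
apply: ge0_ae_eq_integral => //.
- exact: measurable_fun_fubini_tonelli_G.
- exact: (measurable_fun_fubini_tonelli_G h).
- by move=> x _; exact: integral_ge0.
- by move=> x _; exact: integral_ge0.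
(* The substitution degenerates at [s = 0] only, which is a null set. *)
exists [set 0]; split => //; first exact: lebesgue_measure_set1.
move=> s /= /not_implyP[_] ns; apply: contrapT => /eqP s0; apply: ns.
rewrite /fubini_G [LHS](H s)//; last exact: measurableT_comp.
rewrite /h /= ge0_integralZl//=; last by rewrite lee_fin.
apply: (measurableT_comp mf).
exact: (measurableT_comp mgs (pair2_measurable s)).
Qed.

Lemma ge0_integral_polar (f : R4 -> \bar R) :
  measurable_fun setT f -> (forall x, 0 <= f x)%E ->
  (\int[leb4]_x f x
   = \int[leb3]_z \int[leb]_s ((`|s| ^+ 3)%:E * f (ray z s)))%E.
Proof.
move=> mf f0.
pose g (s : R) (z : R3) := (`|s| * z.1.1, `|s| * z.1.2, `|s| * z.2).
apply: (@ge0_integral_fiberwise _ _ (sf_product (sf_product leb leb) leb) g (fun s => `|s| ^+ 3)) => //.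
- by have /measurable_fun_pairP[] := measurable_ray.
- by apply: measurable_funX; exact: normr_measurable.
clear f mf f0.
move=> s s0 f mf f0.
have sgt0 : 0 < `|s| by rewrite normr_gt0.
have msc : measurable_fun setT (fun x : R => `|s| * x) by exact: measurable_funM.
have H : forall f : R -> \bar R, measurable_fun setT f -> (forall x, 0 <= f x)%E ->
  (\int[leb]_x f x = `|s|%:E * \int[leb]_x f (`|s| * x)%R)%E.
  by move=> h mh h0; exact: ge0_integral_scale.
have msc2 : measurable_fun setT (fun x : R * R => (`|s| * x.1, `|s| * x.2)).
  by apply/measurable_fun_pair => //=; exact: measurableT_comp.
have H2 := @ge0_integral_scale_prod _ _ _ _ leb leb _ _ _ _ (ltW sgt0) (ltW sgt0) msc msc H H.
have s2 := mulr_ge0 (ltW sgt0) (ltW sgt0).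
rewrite exprSr expr2.
have E := @ge0_integral_scale_prod _ _ _ _ (sf_product leb leb) leb _ _ _ _
  s2 (ltW sgt0) msc2 msc H2 H f mf f0.
by move: E; rewrite /g.
Qed.
End Polar.

(** * Integrals of radial functions *)

Section Radial.
Context {R : realType}.
Local Notation leb := (@lebesgue_measure R).
Local Notation leb3 := (leb \x leb \x leb)%E.
Local Notation leb4 := (leb \x leb \x leb \x leb)%E.
Local Notation R3 := (R * R * R)%type.
Local Notation R4 := (R * R * R * R)%type.

Lemma ge0_integral_even (f : R -> \bar R) :
  measurable_fun [set: R] f -> (forall x, 0 <= f x)%E ->
  (\int[leb]_x f `|x|%R = 2%:E * \int[leb]_(x in `[0%R, +oo[) f x)%E.
Proof.
move=> mf f0.
have mn : measurable_fun [set: R] (fun x => f `|x|).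
  by apply: measurableT_comp => //; exact: normr_measurable.
rewrite -(setUv `[0, +oo[%classic) ge0_integral_setU//=; last 2 first.
- exact: measurable_funS mn.
- exact/disj_setPCl.
rewrite setCitvr (_ : 2 = 1 + 1)// EFinD ge0_muleDl// !mul1e; congr (_ + _)%E.
  by apply: eq_integral => x /[!inE]/=; rewrite in_itv/= andbT => /ger0_norm ->.
rewrite ge0_integration_by_substitution0//.
rewrite -integral_itv_bndo_bndc//=.
  apply: eq_integral => x /[!inE]/=; rewrite in_itv/= => /ltr0_norm -> //.
  exact: measurableT_comp.
by rewrite setCitvr.
Qed.


Lemma measurable_invr : measurable_fun [set: R] (@GRing.inv R).
Proof.
rewrite -(setUv [set 0 : R]); apply/measurable_funU => //.
  exact: measurableC.
split; first exact: measurable_fun_set1.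
apply: open_continuous_measurable_fun.
  rewrite (_ : ~` [set 0] = [set x : R | x != 0]); first exact: open_neq.
  by apply/seteqP; split => x /= /eqP.
by move=> x /[!inE]/= /eqP x0; exact: inv_continuous.
Qed.

Lemma measurable_enorm : measurable_fun setT (@enorm R).
Proof.
have m1 : measurable_fun setT (fun x : R4 => x.1.1.1).
  by do 2 apply: measurableT_comp => //.
have m2 : measurable_fun setT (fun x : R4 => x.1.1.2).
  by do 2 apply: measurableT_comp => //.
have m3 : measurable_fun setT (fun x : R4 => x.1.2).
  by apply: measurableT_comp => //.
have m4 : measurable_fun setT (fun x : R4 => x.2) by exact: measurable_snd.
apply: (measurableT_comp (continuous_measurable_fun (@sqrt_continuous R))).
by do 3 (apply: measurable_funD; last exact: measurable_funX);
  exact: measurable_funX.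
Qed.

Lemma enorm_ray (z : R3) (s : R) : enorm (ray z s) =
  Num.sqrt (z.1.1 ^+ 2 + z.1.2 ^+ 2 + z.2 ^+ 2 + 1) * `|s|.
Proof.
rewrite /enorm /= !exprMn.
rewrite -[in RHS](sqrtr_sqr s) -sqrtrM; last by rewrite !addr_ge0// sqr_ge0.
by congr Num.sqrt; rewrite real_normK ?num_real//; ring.
Qed.

Lemma integral0y_pow3_gauss :
  (\int[leb]_(r in `[0%R, +oo[) (r ^+ 3 * gauss_fun r)%:E = (2^-1)%:E)%E.
Proof.
pose F (r : R) := - (r ^+ 2 + 1) * gauss_fun r / 2.
have dF (x : R) : is_derive x 1 F (x ^+ 3 * gauss_fun x).
  rewrite /F /gauss_fun; apply: is_derive_eq.
  by rewrite /GRing.scale /=; field.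
rewrite (@ge0_continuous_FTC2y _ _ F 0 0).
- by rewrite /F /gauss_fun expr0n/= oppr0 expR0 -EFinB; congr EFin; field.
- by move=> x x0; rewrite mulr_ge0 ?exprn_ge0// gauss_fun_ge0.
- apply: continuous_subspaceT => x.
  apply: cvgM; first exact: exprn_continuous.
  exact: continuous_gauss_fun.
- apply/cvgrPdist_le => /= e e0; near=> r.
  have r1 : 1 <= r by near: r; exact: nbhs_pinfty_ge.
  have re : 2 <= e * r.
    rewrite -ler_pdivrMl// mulrC; near: r; exact: nbhs_pinfty_ge.
  have r0 : 0 < r by exact: lt_le_trans r1.
  rewrite /F /gauss_fun sub0r mulNr mulNr opprK expRN ger0_norm; last first.
    by rewrite !mulr_ge0 ?invr_ge0 ?expR_ge0// addr_ge0 ?sqr_ge0.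
  (* The lower bound [1 + r^4 / 2] of [exp (r^2)] makes [F r] of order [r^-2]. *)
  have H := expR_ge1Dxn 1 (sqr_ge0 r).
  rewrite ler_pdivrMr// ler_pdivrMr ?expR_gt0//.
  apply: le_trans (_ : e * 2 * (1 + (r ^+ 2) ^+ 2 / 2`!%:R) <= _); last first.
    by rewrite ler_pM2l// mulr_gt0.
  rewrite (_ : 2`!%:R = 2)//.
  have -> : e * 2 * (1 + (r ^+ 2) ^+ 2 / 2) = 2 * e + (e * r) * r ^+ 3 by field.
  have : 2 * r ^+ 3 <= (e * r) * r ^+ 3 by rewrite ler_pM2r// exprn_gt0.
  nra.
- by move=> x _; have [] := dF x.
- apply: cvg_at_right_filter.
  have /derivable1_diffP/differentiable_continuous : derivable F 0 1 by have [] := dF 0.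
  exact.
- by move=> x _; rewrite derive1E; have [_] := dF x.
Unshelve. all: by end_near. Qed.

(** On the ray of slope [z] the norm is [c * |s|], and rescaling [s] by [c] extracts the factor
    [c^-4]: the variables separate. The integral over [z] is left unevaluated. *)
Lemma ge0_integral_radial_const (f : R -> \bar R) :
  measurable_fun [set: R] f -> (forall x, 0 <= f x)%E ->
  (\int[leb4]_x f (enorm x) =
   (\int[leb3]_z ((Num.sqrt (z.1.1 ^+ 2 + z.1.2 ^+ 2 + z.2 ^+ 2 + 1) ^- 4)%:E))
   * \int[leb]_s ((`|s| ^+ 3)%:E * f `|s|%R))%E.
Proof.
move=> mf f0.
have mg : measurable_fun setT (fun x => f (enorm x)).
  exact: measurableT_comp mf measurable_enorm.
rewrite ge0_integral_polar//.
have mh : measurable_fun [set: R] (fun s => (`|s| ^+ 3)%:E * f `|s|%R)%E.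
  apply: emeasurable_funM.
    by apply/measurable_EFinP; apply: measurable_funX; exact: normr_measurable.
  by apply: measurableT_comp => //; exact: normr_measurable.
have h0 (s : R) : (0 <= (`|s| ^+ 3)%:E * f `|s|%R)%E.
  by rewrite mule_ge0// lee_fin exprn_ge0.
rewrite -ge0_integralZr//=; last 2 first.
- apply/measurable_EFinP.
  apply: (measurableT_comp measurable_invr); apply: measurable_funX.
  apply: (measurableT_comp (continuous_measurable_fun (@sqrt_continuous R))).
  have m1 : measurable_fun setT (fun x : R3 => x.1.1).
    by apply: measurableT_comp => //.
  have m2 : measurable_fun setT (fun x : R3 => x.1.2).
    by apply: measurableT_comp => //.
  apply: measurable_funD => //.
  by do 2 (apply: measurable_funD; last exact: measurable_funX);
  exact: measurable_funX.
- by apply: integral_ge0.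
apply: eq_integral => z _.
set c := Num.sqrt _.
have c0 : 0 < c.
  by rewrite sqrtr_gt0 ltr_wpDl// !addr_ge0// sqr_ge0.
rewrite (ge0_integral_scale mh h0 c0).
under eq_integral do rewrite enorm_ray -/c.
rewrite muleA -EFinM.
pose k (s : R) := ((c ^+ 3)%:E * ((`|s| ^+ 3)%:E * f (c * `|s|)%R))%E.
have -> : (\int[leb]_s ((`|c * s| ^+ 3)%:E * f `|c * s|%R) = \int[leb]_s k s)%E.
  by apply: eq_integral => s _; rewrite /k normrM (gtr0_norm c0) muleA -EFinM exprMn.
rewrite /k ge0_integralZl//=; last 3 first.
- apply: emeasurable_funM.
    by apply/measurable_EFinP; apply: measurable_funX; exact: normr_measurable.
  have mc : measurable_fun [set: R] (fun x : R => c * `|x|).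
    by apply: measurable_funM => //; exact: normr_measurable.
  exact: measurableT_comp mf mc.
- by move=> s _; rewrite mule_ge0// lee_fin exprn_ge0.
- by rewrite lee_fin exprn_ge0// ltW.
rewrite muleA -EFinM [X in (X%:E * _)%E](_ : _ = 1) ?mul1e//.
by field; rewrite gt_eqF.
Qed.

Lemma ge0_integral_prod_mul d1 d2 (T1 : measurableType d1)
    (T2 : measurableType d2) (m1 : {sigma_finite_measure set T1 -> \bar R})
    (m2 : {sigma_finite_measure set T2 -> \bar R}) (f1 : T1 -> R) (f2 : T2 -> R)
    (c1 c2 : R) :
  measurable_fun setT f1 -> measurable_fun setT f2 ->
  (forall x, 0 <= f1 x) -> (forall x, 0 <= f2 x) ->
  (\int[m1]_x (f1 x)%:E = c1%:E)%E -> (\int[m2]_x (f2 x)%:E = c2%:E)%E ->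
  (\int[m1 \x m2]_x (f1 x.1 * f2 x.2)%:E = (c1 * c2)%:E)%E.
Proof.
move=> mf1 mf2 f10 f20 I1 I2.
have m12 : measurable_fun setT (fun x : T1 * T2 => (f1 x.1 * f2 x.2)%:E).
  apply/measurable_EFinP; apply: measurable_funM.
    by apply: measurableT_comp => //.
  by apply: measurableT_comp => //.
rewrite (fubini_tonelli1 (fun x => (f1 x.1 * f2 x.2)%:E))//; last first.
  by move=> x; rewrite lee_fin mulr_ge0.
rewrite /fubini_F/=.
transitivity (\int[m1]_x ((f1 x)%:E * c2%:E))%E.
  apply: eq_integral => x _; under eq_integral do rewrite EFinM.
  rewrite ge0_integralZl ?I2//.
  - exact/measurable_EFinP.
  - by move=> y _; rewrite lee_fin.
  - by rewrite lee_fin.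
rewrite ge0_integralZr ?I1//.
- exact/measurable_EFinP.
- by move=> y _; rewrite lee_fin.
- by rewrite -I2 integral_ge0// => y _; rewrite lee_fin.
Qed.

Lemma integral_gauss4 :
  (\int[leb4]_x (gauss_fun (enorm x))%:E = (pi ^+ 2)%:E)%E.
Proof.
have g0 := @gauss_fun_ge0 R; have mg := @measurable_gauss_fun R.
have I1 := @integralT_gauss R.
have I2 := @ge0_integral_prod_mul _ _ _ _ leb leb _ _ _ _ mg mg g0 g0 I1 I1.
have m2 : measurable_fun setT
    (fun x : measurableTypeR R * measurableTypeR R => gauss_fun x.1 * gauss_fun x.2).
  by apply: measurable_funM; apply: measurableT_comp.
have I3 := @ge0_integral_prod_mul _ _ _ _ (sf_product leb leb) leb _ _ _ _
  m2 mg (fun x => mulr_ge0 (g0 _) (g0 _)) g0 I2 I1.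
have m3 : measurable_fun setT
    (fun x : measurableTypeR R * measurableTypeR R * measurableTypeR R =>
     gauss_fun x.1.1 * gauss_fun x.1.2 * gauss_fun x.2).
  apply: measurable_funM.
    exact: (measurableT_comp m2 measurable_fst).
  exact: (measurableT_comp mg measurable_snd).
have I4 := @ge0_integral_prod_mul _ _ _ _ (sf_product (sf_product leb leb) leb) leb _ _ _ _
  m3 mg (fun x => mulr_ge0 (mulr_ge0 (g0 _) (g0 _)) (g0 _)) g0 I3 I1.
transitivity (\int[leb4]_x (gauss_fun x.1.1.1 * gauss_fun x.1.1.2 * gauss_fun x.1.2
  * gauss_fun x.2)%:E)%E.
  apply: eq_integral => x _; congr EFin.
  rewrite /gauss_fun -!expRD sqr_sqrtr; last by rewrite !addr_ge0// sqr_ge0.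
  by congr expR; ring.
apply: (eq_trans I4); congr EFin.
by rewrite -mulrA -!expr2 sqr_sqrtr// pi_ge0.
Qed.

(** The unknown constant [C] is found by integrating the Gaussian in two ways: it gives [pi^2] as a
    product of four one-dimensional integrals, and [C * (2 * 2^-1)] in polar coordinates. *)
Lemma ge0_integral_radial (f : R -> \bar R) :
  measurable_fun [set: R] f -> (forall x, 0 <= f x)%E ->
  (\int[leb4]_x f (enorm x) =
   (2 * pi ^+ 2)%:E * \int[leb]_(r in `[0%R, +oo[) ((r ^+ 3)%:E * f r))%E.
Proof.
set C := (\int[leb3]_z ((Num.sqrt (z.1.1 ^+ 2 + z.1.2 ^+ 2 + z.2 ^+ 2 + 1) ^- 4)%:E))%E.
have H (g : R -> \bar R) : measurable_fun [set: R] g -> (forall x, 0 <= g x)%E ->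
    (\int[leb4]_x g (enorm x) = C * (2%:E *
      \int[leb]_(r in `[0%R, +oo[) ((r ^+ 3)%:E * g r)))%E.
  move=> mg g0; rewrite ge0_integral_radial_const// -/C; congr (_ * _)%E.
  pose h (r : R) := (`|r ^+ 3|%:E * g r)%E.
  have -> : (\int[leb]_(r in `[0%R, +oo[) ((r ^+ 3)%:E * g r) =
      \int[leb]_(r in `[0%R, +oo[) h r)%E.
    apply: eq_integral => r.
    by rewrite inE/= in_itv/= andbT => r0; rewrite /h ger0_norm// exprn_ge0.
  rewrite -(ge0_integral_even (f := h)).
  - by apply: eq_integral => s _; rewrite /h normrX normr_id.
  - apply: emeasurable_funM => //; apply/measurable_EFinP.
    apply: measurableT_comp; first exact: normr_measurable.
    exact: measurable_funX.
  - by move=> x; rewrite mule_ge0.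
have EC : C = (pi ^+ 2)%:E.
  rewrite -integral_gauss4 (H (EFin \o gauss_fun))/=.
  - under eq_integral do rewrite -EFinM.
    by rewrite integral0y_pow3_gauss -EFinM divff// mule1.
  - by apply/measurable_EFinP; exact: measurable_gauss_fun.
  - by move=> x; rewrite lee_fin gauss_fun_ge0.
by move=> mf f0; rewrite H// EC muleA -EFinM mulrC.
Qed.

End Radial.

Lemma ge0_integral_eq0_ae d (T : measurableType d) (R : realType)
    (m : {measure set T -> \bar R}) (f : T -> \bar R) :
  measurable_fun setT f -> (forall x, 0 <= f x)%E -> (\int[m]_x f x = 0)%E ->
  {ae m, forall x, f x = 0%E}.
Proof.
move=> mf f0 If.
have : ae_eq m setT f (cst 0%E).
  apply/ae_eq_integral_abs => //.
  by rewrite -If; apply: eq_integral => x _; rewrite gee0_abs.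
by apply: filterS => x; exact.
Qed.

(** * Null sets along rays and measurable radial profiles *)

Section Profile.
Context {R : realType}.
Local Notation leb := (@lebesgue_measure R).
Local Notation leb3 := (leb \x leb \x leb)%E.
Local Notation leb4 := (leb \x leb \x leb \x leb)%E.
Local Notation R3 := (R * R * R)%type.
Local Notation R4 := (R * R * R * R)%type.

#[export] Instance ae_leb4_filter : Filter (almost_everywhere leb4).
Proof.
exact: (ae_filter_ringOfSetsType (sf_product (sf_product (sf_product leb leb) leb) leb)).
Qed.

(** Ensures that the complement of a null set of slopes is not empty. *)
Lemma leb3T_gt0 : (0 < leb3 setT)%E.
Proof.
pose I : set (measurableTypeR R) := `]0%R, 1%R[%classic.
have l0 : (0 < leb I)%E.
  by rewrite /I lebesgue_measure_itv/= lte_fin ltr01 oppr0 adde0 lte_fin ltr01.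
have mI : measurable I by exact: measurable_itv.
apply: lt_le_trans (_ : (leb3 (I `*` I `*` I) <= _)%E).
  have mII : measurable (I `*` I) by exact: measurableX.
  have -> : leb3 (I `*` I `*` I) = (leb I * leb I * leb I)%E.
    etransitivity.
      exact: (@product_measure1E _ _ _ _ _ (sf_product leb leb) leb _ _ mII mI).
    by congr (_ * _)%E; exact: product_measure1E.
  by rewrite !mule_gt0.
apply: le_measure; rewrite ?inE//.
exact: (measurableX (measurableX mI mI) mI).
Qed.

Lemma measurable_B : measurable (@B R).
Proof.
rewrite (_ : B = enorm @^-1` `]-oo, 1[%classic); last first.
  by apply/seteqP; split => x; rewrite /B/= in_itv.
rewrite -[X in measurable X]setTI.
exact: measurable_enorm.
Qed.

(** In polar coordinates almost every ray meets [Z] in a null set of parameters. A single such ray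
    is enough to read off a radial profile. *)
Lemma ae_polar (Z : set R4) : measurable Z -> leb4 Z = 0%E ->
  exists z : R3, {ae leb, forall s, s != 0 -> ~ Z (ray z s)}.
Proof.
move=> mZ Z0.
have mf : measurable_fun setT (fun x : R4 => (\1_Z x : R)%:E).
  by apply/measurable_EFinP; exact: measurable_indic.
have H := ge0_integral_polar mf (fun x => ltac:(by rewrite lee_fin)).
move: H; rewrite integral_indic// setIT [X in X = _]Z0 => /esym H.
have mg : measurable_fun setT (fun x : R3 * R =>
    (`|x.2| ^+ 3)%:E * (\1_Z (ray x.1 x.2) : R)%:E)%E.
  apply: emeasurable_funM.
    apply/measurable_EFinP; apply: measurable_funX.
    by apply: measurableT_comp => //; exact: normr_measurable.
  exact: (measurableT_comp mf measurable_ray).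
have g0 (x : R3 * R) : (0 <= (`|x.2| ^+ 3)%:E * (\1_Z (ray x.1 x.2) : R)%:E)%E.
  by rewrite mule_ge0// lee_fin ?exprn_ge0.
have mG := @measurable_fun_fubini_tonelli_F _ _ _ _ _ leb _ mg g0.
have G0 (z : R3) : (0 <= fubini_F leb
    (fun x => (`|x.2| ^+ 3)%:E * (\1_Z (ray x.1 x.2) : R)%:E) z)%E.
  by apply: integral_ge0 => s _; exact: g0 (z, s).
have [N [mN N0 subN]] :=
  @ge0_integral_eq0_ae _ _ _ (sf_product (sf_product leb leb) leb) _ mG G0 H.
have [z Nz] : exists z, ~ N z.
  apply: contrapT => /forallNP NT.
  have : leb3 setT = 0%E.
    rewrite -N0; congr leb3; apply/seteqP; split => // z _.
    by apply: contrapT; exact: NT.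
  by move=> E; have := leb3T_gt0; rewrite E ltxx.
exists z.
have Iz : (\int[leb]_s ((`|s| ^+ 3)%:E * (\1_Z (ray z s) : R)%:E) = 0)%E.
  by apply: contrapT => E; apply: Nz; apply: subN.
have := @ge0_integral_eq0_ae _ _ _ leb _
  (measurableT_comp mg (pair1_measurable z)) (fun s => g0 (z, s)) Iz.
apply: filterS => s /= Es s0 Zs.
move: Es; rewrite indicE mem_set// mule1 => -[] /eqP.
by rewrite expf_eq0/= normr_eq0 (negPf s0).
Qed.


Lemma ae_radial (N : set R) : measurable N -> leb N = 0%E ->
  {ae leb4, forall x, ~ N (enorm x)}.
Proof.
move=> mN N0.
have mf : measurable_fun [set: R] (fun x : R => (\1_N x : R)%:E).
  by apply/measurable_EFinP; exact: measurable_indic.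
have f0 (x : R) : (0 <= (\1_N x : R)%:E)%E by rewrite lee_fin.
have H := ge0_integral_radial mf f0.
have I0 : (\int[leb]_(r in `[0%R, +oo[) ((r ^+ 3)%:E * (\1_N r)%:E) = 0)%E.
  transitivity (\int[leb]_(r in `[0%R, +oo[) cst 0%E r)%E; last first.
    by rewrite integral0.
  apply: ae_eq_integral => //.
    apply: measurable_funTS; apply: emeasurable_funM => //.
    by apply/measurable_EFinP; exact: measurable_funX.
  exists N; split => // r /= /not_implyP[_]; apply: contra_notP => Nr.
  by rewrite indicE memNset// mule0.
have mg : measurable_fun setT (fun x : R4 => (\1_N (enorm x) : R)%:E).
  exact: (measurableT_comp mf measurable_enorm).
move: H; rewrite I0 mule0 => H.
have := @ge0_integral_eq0_ae _ _ _
  (sf_product (sf_product (sf_product leb leb) leb) leb) _ mg (fun x => f0 _) H.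
apply: filterS => x /= Nx nx.
by move: Nx; rewrite indicE mem_set// => -[] /eqP; rewrite oner_eq0.
Qed.

Lemma ge0_null_scale (N : set R) (c : R) : 0 < c -> measurable N ->
  leb [set s | N (c * s)] = 0%E -> leb N = 0%E.
Proof.
move=> c0 mN N0.
have mf : measurable_fun [set: R] (fun x : R => (\1_N x : R)%:E).
  by apply/measurable_EFinP; exact: measurable_indic.
have f0 (x : R) : (0 <= (\1_N x : R)%:E)%E by rewrite lee_fin.
have := ge0_integral_scale mf f0 c0.
rewrite integral_indic// setIT => ->.
have mS : measurable [set s | N (c * s)].
  rewrite -[X in measurable X]setTI.
  have mc : measurable_fun [set: R] (fun x : R => c * x) by exact: measurable_funM.
  exact: mc.
have -> : (\int[leb]_x (\1_N (c * x)%R : R)%:E = 0)%E; last by rewrite mule0.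
by rewrite -N0 -[in RHS](setIT [set s | N (c * s)]) -integral_indic.
Qed.

(** The function given by [radial] may fail to be measurable. The restriction of [u] to a ray that
    almost avoids the exceptional set is measurable, and it agrees with that function at almost
    every radius. *)
Lemma radial_profile (u : R4 -> R) : measurable_fun (@B R) u -> radial u ->
  exists g : R -> R, measurable_fun [set: R] g /\
    {ae leb4, forall x, B x -> u x = g (enorm x)}.
Proof.
move=> mu [g [Z [mZ Z0 subZ]]].
have [z [N [mN N0 subN]]] := ae_polar mZ Z0.
pose v := u \_ B.
have mv : measurable_fun setT v.
  by apply/(measurable_restrictT _ _).1 => //; exact: measurable_B.
pose c := Num.sqrt (z.1.1 ^+ 2 + z.1.2 ^+ 2 + z.2 ^+ 2 + 1).
have c0 : 0 < c by rewrite sqrtr_gt0 ltr_wpDl// !addr_ge0// sqr_ge0.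
(* [ray z s] has norm [c * |s|], so the parameter [r / c] is the one of norm [r]. *)
exists (fun r => v (ray z (r / c))); split.
  have mc : measurable_fun [set: R] (fun x : R => x / c) by exact: measurable_funM.
  exact: (measurableT_comp mv (measurableT_comp (measurableT_comp measurable_ray
    (pair1_measurable z)) mc)).
pose N' := [set r : R | N (r / c)].
have mN' : measurable N'.
  rewrite -[X in measurable X]setTI.
  have mc : measurable_fun [set: R] (fun x : R => x / c) by exact: measurable_funM.
  exact: mc.
have N'0 : leb N' = 0%E.
  apply: (ge0_null_scale c0) => //.
  rewrite [X in leb X](_ : _ = N)//.
  by apply/seteqP; split => s; rewrite /N'/= mulrC mulKf ?gt_eqF.
have ae0 := ae_radial mN' N'0.
have ae1 := ae_radial (measurable_set1 0) (lebesgue_measure_set1 (0 : R)).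
have aeZ : {ae leb4, forall x, ~ Z x}.
  by exists Z; split => // x /= /contrapT.
near=> x => Bx.
have x0 : 0 < enorm x.
  rewrite lt_neqAle sqrtr_ge0 andbT eq_sym; apply/eqP => e0.
  by have : ~ [set 0] (enorm x) by near: x.
have -> : u x = g (enorm x).
  have nZ : ~ Z x by near: x.
  by apply: contrapT => E; apply: nZ; apply: subZ => /=; move/(_ Bx).
have nN : ~ N' (enorm x) by near: x.
have er : enorm (ray z (enorm x / c)) = enorm x.
  by rewrite enorm_ray -/c ger0_norm ?divr_ge0 ?ltW// mulrC divfK// gt_eqF.
have nZ : ~ Z (ray z (enorm x / c)).
  move=> Zr; apply: nN; apply: subN => /=; move/(_ _ Zr); apply.
  by rewrite gt_eqF// divr_gt0.
have Br : B (ray z (enorm x / c)) by rewrite /B/= er.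
rewrite /v patchE mem_set//; apply/esym; rewrite -[in RHS]er.
by apply: contrapT => E; apply: nZ; apply: subZ => /=; move/(_ Br).
Unshelve. all: by end_near. Qed.

End Profile.

(** * Integration by parts for test functions *)

Section Caratheodory.
Context {R : realType} d (T : measurableType d).
Local Notation leb := (@lebesgue_measure R).

Lemma cvg_floor_approx (y : R) :
  (Num.floor (n.+1%:R * y))%:~R / n.+1%:R @[n --> \oo] --> y.
Proof.
apply/cvgrPdist_le => /= e e0; near=> n.
have n0 : 0 < (n.+1%:R : R) by [].
have /andP[h1 h2] := floor_itv (n.+1%:R * y).
have -> : y - (Num.floor (n.+1%:R * y))%:~R / n.+1%:R =
   (n.+1%:R * y - (Num.floor (n.+1%:R * y))%:~R) / n.+1%:R by field; rewrite nat1r.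
rewrite ger0_norm; last by rewrite divr_ge0// subr_ge0.
apply: (@le_trans _ _ (n.+1%:R^-1)).
  rewrite ler_pdivrMr// mulVf ?gt_eqF// lerBlDl ltW//.
  by move: h2; rewrite intrD1.
by apply: ltW; near: n; exact: near_infty_natSinv_lt (PosNum e0).
Unshelve. all: by end_near. Qed.

(** Rounding [y] down to multiples of [1 / n.+1] gives functions that are measurable because they
    are piecewise constant in [y], and that converge to [f] by continuity. Adding one variable at a
    time, continuous functions on R^4 are measurable for the product sigma-algebra. *)
Lemma measurable_fun_caratheodory (f : T * R -> R) :
  (forall y, measurable_fun setT (fun x => f (x, y))) ->
  (forall x, continuous (fun y => f (x, y))) -> measurable_fun setT f.
Proof.
move=> mf cf.
pose h n (p : T * R) := f (p.1, (Num.floor (n.+1%:R * p.2))%:~R / n.+1%:R).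
apply: (@measurable_fun_cvg _ _ _ _ h) => [n _ Y mY|[x y] _].
  rewrite setTI.
  have -> : h n @^-1` Y = \bigcup_(k : int)
     (((fun x => f (x, k%:~R / n.+1%:R)) @^-1` Y) `*`
      ((fun y : R => n.+1%:R * y) @^-1` `[k%:~R, (k + 1)%:~R[%classic)).
    apply/seteqP; split => [[x y] /= hY|[x y] [k _ []]] /=.
      by exists (Num.floor (n.+1%:R * y)) => //; split => //=; rewrite in_itv/= floor_itv.
    by rewrite in_itv/= => Yk kk; rewrite /h/= (@floor_def _ _ k).
  apply: countable_bigcupT_measurable => // k; apply: measurableX.
    by rewrite -[X in measurable X]setTI; exact: mf.
  rewrite -[X in measurable X]setTI.
  have mc : measurable_fun [set: R] (fun y : R => n.+1%:R * y).
    exact: measurable_funM.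
  exact: mc.
rewrite /h/=.
apply: (@cvg_comp _ _ _ (fun n => (Num.floor (n.+1%:R * y))%:~R / n.+1%:R)
  (fun y => f (x, y)) \oo (nbhs y)); first exact: cvg_floor_approx.
exact: cf.
Qed.

End Caratheodory.

Lemma continuous_pair1 (U V : topologicalType) (y : V) :
  continuous (fun x : U => (x, y)).
Proof. by move=> x; apply: cvg_pair; [exact: cvg_id|exact: cvg_cst]. Qed.

Lemma continuous_pair2 (U V : topologicalType) (x : U) :
  continuous (fun y : V => (x, y)).
Proof. by move=> y; apply: cvg_pair; [exact: cvg_cst|exact: cvg_id]. Qed.

Lemma continuous_slice1 (U V W : topologicalType) (f : U * V -> W) (y : V) :
  continuous f -> continuous (fun x => f (x, y)).
Proof.
move=> cf x; apply: (@cvg_comp _ _ _ (fun x => (x, y)) f _ (nbhs (x, y))).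
  exact: continuous_pair1.
exact: cf.
Qed.

Lemma continuous_slice2 (U V W : topologicalType) (f : U * V -> W) (x : U) :
  continuous f -> continuous (fun y => f (x, y)).
Proof.
move=> cf y; apply: (@cvg_comp _ _ _ (fun y => (x, y)) f _ (nbhs (x, y))).
  exact: continuous_pair2.
exact: cf.
Qed.

Section Continuous4.
Context {R : realType}.
Local Notation R4 := (R * R * R * R)%type.

Lemma continuous_measurable_fun2 (f : R * R -> R) :
  continuous f -> measurable_fun setT f.
Proof.
move=> cf; apply: measurable_fun_caratheodory => [y|x].
  by apply: continuous_measurable_fun; exact: continuous_slice1.
exact: continuous_slice2.
Qed.

Lemma continuous_measurable_fun3 (f : R * R * R -> R) :
  continuous f -> measurable_fun setT f.
Proof.
move=> cf; apply: measurable_fun_caratheodory => [y|x].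
  by apply: continuous_measurable_fun2; exact: continuous_slice1.
exact: continuous_slice2.
Qed.

Lemma continuous_measurable_fun4 (f : R4 -> R) :
  continuous f -> measurable_fun setT f.
Proof.
move=> cf; apply: measurable_fun_caratheodory => [y|x].
  by apply: continuous_measurable_fun3; exact: continuous_slice1.
exact: continuous_slice2.
Qed.

End Continuous4.

Section BoundedSupport.
Context {R : realType}.

Definition bnd_supp (T : Type) (A : set T) (f : T -> R) :=
  (exists M, forall x, `|f x| <= M) /\ (forall x, ~ A x -> f x = 0).

Lemma bnd_supp_integrable d (T : measurableType d)
    (m : {measure set T -> \bar R}) (A : set T) (f : T -> R) :
  measurable A -> (m A < +oo)%E -> measurable_fun setT f -> bnd_supp A f ->
  m.-integrable setT (EFin \o f).
Proof.
move=> mA Afin mf [[M fM] f0].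
rewrite (_ : EFin \o f = (EFin \o f) \_ A); last first.
  apply/funext => x; rewrite patchE; case: ifPn => // /negP xA /=.
  by rewrite f0// => Ax; apply: xA; rewrite inE.
apply/(integrable_mkcond _ _).1 => //.
apply: measurable_bounded_integrable => //; first exact: measurable_funTS.
exists M; split; first exact: num_real.
by move=> x Mx y _ /=; rewrite (le_trans (fM y))// ltW.
Qed.

Lemma bnd_supp_slice1 (T1 T2 : Type) (A1 : set T1) (A2 : set T2)
    (f : T1 * T2 -> R) (y : T2) :
  bnd_supp (A1 `*` A2) f -> bnd_supp A1 (fun x => f (x, y)).
Proof.
move=> [[M fM] f0]; split; first by exists M => x; exact: fM.
by move=> x A1x; apply: f0 => -[].
Qed.

Section product.
Context d1 d2 (T1 : measurableType d1) (T2 : measurableType d2)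
  (m1 : {sigma_finite_measure set T1 -> \bar R})
  (m2 : {sigma_finite_measure set T2 -> \bar R}).
Variables (A1 : set T1) (A2 : set T2) (f : T1 * T2 -> R).
Hypotheses (mA1 : measurable A1) (mA2 : measurable A2).
Hypotheses (fA1 : (m1 A1 < +oo)%E) (fA2 : (m2 A2 < +oo)%E).
Hypotheses (mf : measurable_fun setT f) (bf : bnd_supp (A1 `*` A2) f).

Let If : (m1 \x m2)%E.-integrable setT (EFin \o f).
Proof.
have H : (sf_product m1 m2 (A1 `*` A2) < +oo)%E.
  by rewrite /sf_product product_measure1E// lte_mul_pinfty// ge0_fin_numE.
have mA : measurable (A1 `*` A2) by exact: measurableX.
exact: (@bnd_supp_integrable _ _ (sf_product m1 m2) (A1 `*` A2) f mA H).
Qed.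

Lemma integral_slice2_eq0 : (forall x, \int[m2]_y (f (x, y))%:E = 0)%E ->
  (\int[m1 \x m2]_x (f x)%:E = 0)%E.
Proof.
move=> f0; rewrite -(integral12_prod_meas1 If) /fubini_F/=.
by under eq_integral do rewrite f0; rewrite integral0.
Qed.

Lemma integral_slice1_eq0 : (forall y, \int[m1]_x (f (x, y))%:E = 0)%E ->
  (\int[m1 \x m2]_x (f x)%:E = 0)%E.
Proof.
move=> f0; rewrite -(integral21_prod_meas1 If) /fubini_G/=.
by under eq_integral do rewrite f0; rewrite integral0.
Qed.

End product.
End BoundedSupport.

Section IBP.
Context {R : realType}.
Local Notation leb := (@lebesgue_measure R).
Local Notation leb4 := (leb \x leb \x leb \x leb)%E.
Local Notation R3 := (R * R * R)%type.
Local Notation R4 := (R * R * R * R)%type.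

Lemma integral_derive_eq0 (F f : R -> R) :
  (forall y : R, is_derive y 1 F (f y)) -> continuous f ->
  (forall y, ~ `[-1, 1]%classic y -> F y = 0 /\ f y = 0) ->
  (\int[leb]_y (f y)%:E = 0)%E.
Proof.
move=> dF cf F0.
have F2 y : 1 < `|y| -> F y = 0 /\ f y = 0.
  move=> y1; apply: F0; rewrite /= in_itv/= => y1'.
  by move: y1; rewrite ltNge ler_norml y1'.
(* A larger interval, because nothing is assumed about [F] at the end points of [[-1, 1]]. *)
transitivity (\int[leb]_(y in `[(- 2)%R, 2%R]) (f y)%:E)%E.
  rewrite [RHS]integral_mkcond; apply: eq_integral => y _.
  rewrite patchE; case: ifPn => // /negP yA.
  have [|_ ->//] := F2 y.
  rewrite ltNge; apply: contra_notN yA => y1; rewrite inE/= in_itv/=.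
  by move: y1; rewrite ler_norml => /andP[y1 y2]; apply/andP; split; lra.
have cF : continuous F.
  move=> y; apply: differentiable_continuous; apply/derivable1_diffP.
  by have [] := dF y.
rewrite (@continuous_FTC2 _ f F).
- have [|-> _] := F2 2; first by rewrite ger0_norm// ltr1n.
  have [|-> _] := F2 (-2); first by rewrite normrN ger0_norm// ltr1n.
  by rewrite sube0.
- lra.
- exact: continuous_subspaceT.
- split.
  + by move=> y _; have [] := dF y.
  + apply: cvg_at_right_filter; exact: cF.
  + apply: cvg_at_left_filter; exact: cF.
- by move=> y _; rewrite derive1E; have [_] := dF y.
Qed.

Lemma is_derive_path (V : normedModType R) (f : V -> R) (g : R -> V) (v : V)
    (y : R) : (forall h, g (h + y) = h *: v + g y) ->
  derivable f (g y) v -> is_derive y (1 : R) (f \o g) ('D_v f (g y)).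
Proof.
move=> gv df.
have E : (fun h : R => h^-1 *: ((f \o g \o shift y) (h *: 1) - (f \o g) y)) =
         (fun h : R => h^-1 *: ((f \o shift (g y)) (h *: v) - f (g y))).
  by apply/funext => h /=; rewrite /shift/= [h *: 1]mulr1 gv.
split; first by rewrite /derivable E.
by rewrite /derive E.
Qed.
End IBP.

Section IBP4.
Context {R : realType}.
Local Notation leb := (@lebesgue_measure R).
Local Notation leb4 := (leb \x leb \x leb \x leb)%E.
Local Notation R3 := (R * R * R)%type.
Local Notation R4 := (R * R * R * R)%type.

Let J : set R := `[-1, 1]%classic.

Lemma B_box (x : R4) : B x -> (J `*` J `*` J `*` J) x.
Proof.
rewrite /B/= /enorm => Bx.
have H (a : R) : a ^+ 2 <= x.1.1.1 ^+ 2 + x.1.1.2 ^+ 2 + x.1.2 ^+ 2 + x.2 ^+ 2 ->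
    J a.
  move=> ale; rewrite /J/= in_itv/= -ler_norml -sqrtr_sqr.
  by rewrite (le_trans _ (ltW Bx))// ler_sqrt// (le_trans _ ale)// sqr_ge0.
have := sqr_ge0 x.1.1.1; have := sqr_ge0 x.1.1.2.
have := sqr_ge0 x.1.2; have := sqr_ge0 x.2.
by move=> h4 h3 h2 h1; split => /=; [split=> /=; [split=> /=|]|]; apply: H; lra.
Qed.

Lemma derive_eq0_off (f : R4 -> R) (K : set R4) (v : R4) :
  compact K -> (forall x, ~ K x -> f x = 0) -> forall x, ~ K x -> 'D_v f x = 0.
Proof.
move=> cK f0 x Kx.
have oK : open (~` K).
  by apply: closed_openC; apply: compact_closed => //; exact: norm_hausdorff.
have H : is_derive x v f 0.
  apply: (@near_eq_is_derive _ _ _ (cst 0)) => //.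
  near=> y; rewrite f0//; near: y.
  exact: open_nbhs_nbhs.
by have [] := H.
Unshelve. all: by end_near. Qed.

Lemma compact_bnd_supp (f : R4 -> R) (K : set R4) : compact K -> K `<=` @B R ->
  continuous f -> (forall x, ~ K x -> f x = 0) ->
  bnd_supp (J `*` J `*` J `*` J) f.
Proof.
move=> cK KB cf f0; split; last first.
  by move=> x Jx; apply: f0 => Kx; apply: Jx; apply: B_box; exact: KB.
have cfK : compact (f @` K).
  by apply: continuous_compact => //; exact: continuous_subspaceT.
have [M [_ MK]] := compact_bounded cfK.
exists (`|M| + 1) => x; have [Kx|Kx] := pselect (K x); last first.
  by rewrite f0// normr0 addr_ge0.
apply: (MK (`|M| + 1)); last by exists x.
by rewrite (le_lt_trans (ler_norm M))// ltrDl.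
Qed.

(** On each line parallel to axis [i] this is the fundamental theorem of calculus. Fubini freezes
    the other coordinates, peeled off from the last one, until only coordinate [i] is left. *)
Lemma integral_partial_eq0 (i : 'I_4) (f : R4 -> R) (K : set R4) :
  compact K -> K `<=` @B R -> (forall x, ~ K x -> f x = 0) ->
  (forall x, derivable f x (basis4 i)) -> continuous ('D_(basis4 i) f) ->
  (\int[leb4]_x ('D_(basis4 i) f x)%:E = 0)%E.
Proof.
move=> cK KB f0 df cf.
set v := basis4 i; pose g := 'D_v f.
have bg : bnd_supp (J `*` J `*` J `*` J) g.
  by apply: (compact_bnd_supp cK) => //; exact: derive_eq0_off.
have bf : forall x, ~ (J `*` J `*` J `*` J) x -> f x = 0.
  by move=> x Jx; apply: f0 => Kx; apply: Jx; apply: B_box; exact: KB.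
have mJ : measurable (J : set (measurableTypeR R)) by exact: measurable_itv.
have fJ : (leb J < +oo)%E by rewrite lebesgue_measure_itv/= lte_fin; case: ifP; rewrite ?ltry.
pose l2 := sf_product leb leb.
pose l3 := sf_product l2 leb.
have mJ2 : measurable (J `*` J) by exact: measurableX.
have mJ3 : measurable (J `*` J `*` J) by exact: measurableX.
have fJ2 : (l2 (J `*` J) < +oo)%E.
  by rewrite /l2 /sf_product product_measure1E// lte_mul_pinfty// ge0_fin_numE.
have fJ3 : (l3 (J `*` J `*` J) < +oo)%E.
  have -> : l3 (J `*` J `*` J) = (l2 (J `*` J) * leb J)%E by exact: product_measure1E.
  by rewrite lte_mul_pinfty// ge0_fin_numE.
have mg : measurable_fun setT g by exact: continuous_measurable_fun4.
have mg3 d : measurable_fun setT (fun x => g (x, d)).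
  by apply: continuous_measurable_fun3; exact: continuous_slice1.
have mg2 d c : measurable_fun setT (fun x => g (x, c, d)).
  apply: continuous_measurable_fun2.
  apply: (@continuous_slice1 _ _ _ (fun x => g (x, d)) c).
  exact: continuous_slice1.
have c3 d : continuous (fun x : R3 => g (x, d)) by exact: continuous_slice1.
have c2 d c : continuous (fun x : R * R => g (x, c, d)).
  by apply: (@continuous_slice1 _ _ _ (fun x : R3 => g (x, d)) c); exact: c3.
have c1 d c b : continuous (fun x : R => g (x, b, c, d)).
  by apply: (@continuous_slice1 _ _ _ (fun x : R * R => g (x, c, d)) b); exact: c2.
have c1' d c a : continuous (fun x : R => g (a, x, c, d)).
  by apply: (@continuous_slice2 _ _ _ (fun x : R * R => g (x, c, d)) a); exact: c2.
have c1'' d a : continuous (fun x : R => g (a, x, d)).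
  by apply: (@continuous_slice2 _ _ _ (fun x : R3 => g (x, d)) a); exact: c3.
have c1''' a : continuous (fun x : R => g (a, x)) by exact: continuous_slice2.
have H1 (p : R -> R4) : (forall h y, p (h + y) = h *: v + p y) ->
    continuous (g \o p) -> (forall y, ~ J y -> ~ (J `*` J `*` J `*` J) (p y)) ->
    (\int[leb]_y (g (p y))%:E = 0)%E.
  move=> pv cg pJ; apply: (@integral_derive_eq0 _ (f \o p) (g \o p)) => //.
    by move=> y; apply: is_derive_path.
  move=> y /pJ py; split; first exact: bf.
  by have [_] := bg; apply.
have b3 d := bnd_supp_slice1 d bg.
have b2 d c := bnd_supp_slice1 c (b3 d).
have {}E4 : (\int[l3 \x leb]_x (g x)%:E = 0)%E; last by exact: E4.
case: i @v g df cf bg mg mg3 mg2 H1 b3 b2 c3 c2 c1 c1' c1'' c1''' => [[|[|[|[|//]]]] Hi] v g df cf bg mg mg3 mg2 H1 b3 b2 c3 c2 c1 c1' c1'' c1'''.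
- apply: (@integral_slice1_eq0 _ _ _ _ _ l3 leb _ _ _ mJ3 mJ fJ3 fJ mg bg) => d.
  apply: (@integral_slice1_eq0 _ _ _ _ _ l2 leb _ _ _ mJ2 mJ fJ2 fJ (mg3 d) (b3 d)) => c.
  apply: (@integral_slice1_eq0 _ _ _ _ _ leb leb _ _ _ mJ mJ fJ fJ (mg2 d c) (b2 d c)) => b.
  apply: (H1 (fun y => (y, b, c, d))).
  + move=> h y; rewrite [RHS](_ : _ = (h * 1 + y, h * 0 + b, h * 0 + c, h * 0 + d))//.
    by rewrite !mulr0 !add0r mulr1.
  + exact: c1.
  + by move=> y Jy [[[]]].
- apply: (@integral_slice1_eq0 _ _ _ _ _ l3 leb _ _ _ mJ3 mJ fJ3 fJ mg bg) => d.
  apply: (@integral_slice1_eq0 _ _ _ _ _ l2 leb _ _ _ mJ2 mJ fJ2 fJ (mg3 d) (b3 d)) => c.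
  apply: (@integral_slice2_eq0 _ _ _ _ _ leb leb _ _ _ mJ mJ fJ fJ (mg2 d c) (b2 d c)) => a.
  apply: (H1 (fun y => (a, y, c, d))).
  + move=> h y; rewrite [RHS](_ : _ = (h * 0 + a, h * 1 + y, h * 0 + c, h * 0 + d))//.
    by rewrite !mulr0 !add0r mulr1.
  + exact: c1'.
  + by move=> y Jy [[[]]].
- apply: (@integral_slice1_eq0 _ _ _ _ _ l3 leb _ _ _ mJ3 mJ fJ3 fJ mg bg) => d.
  apply: (@integral_slice2_eq0 _ _ _ _ _ l2 leb _ _ _ mJ2 mJ fJ2 fJ (mg3 d) (b3 d)) => -[a b].
  apply: (H1 (fun y => (a, b, y, d))).
  + move=> h y; rewrite [RHS](_ : _ = (h * 0 + a, h * 0 + b, h * 1 + y, h * 0 + d))//.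
    by rewrite !mulr0 !add0r mulr1.
  + exact: c1''.
  + by move=> y Jy [[]].
- apply: (@integral_slice2_eq0 _ _ _ _ _ l3 leb _ _ _ mJ3 mJ fJ3 fJ mg bg) => -[[a b] c].
  apply: (H1 (fun y => (a, b, c, y))).
  + move=> h y; rewrite [RHS](_ : _ = (h * 0 + a, h * 0 + b, h * 0 + c, h * 1 + y))//.
    by rewrite !mulr0 !add0r mulr1.
  + exact: c1'''.
  + by move=> y Jy [].
Qed.

End IBP4.

(** * Moser's one-dimensional argument *)

Section Moser.
Context {R : realType}.

Lemma psd_form_det (a b c : R) :
  (forall p q, 0 <= a * p ^+ 2 + 2 * b * p * q + c * q ^+ 2) -> b ^+ 2 <= a * c.
Proof.
move=> H.
have c0 : 0 <= c by have := H 0 1; rewrite expr0n/= expr1n !mulr0 mul0r !add0r mulr1.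
have a0 : 0 <= a by have := H 1 0; rewrite expr0n/= expr1n !mulr0 !addr0 mulr1.
have [c_eq0|cn0] := eqVneq c 0.
  (* In the degenerate case the form takes the value [- (a + 2) * b^2] at this point. *)
  have := H b (- (a + 1)); rewrite c_eq0 mul0r addr0 mulr0 => h.
  have : (a + 2) * b ^+ 2 <= 0 by nra.
  by rewrite pmulr_rle0// ltr_wpDl.
have cgt0 : 0 < c by rewrite lt_neqAle eq_sym cn0.
have := H c (- b) => h.
have : 0 <= c * (a * c - b ^+ 2) by nra.
by rewrite pmulr_rge0// subr_ge0.
Qed.

(** Here [x] and [y] are values of a path at times [a] and [t], and [D], [l] are the deficits. Since
    the relative deficit is smallest at [a], [D <= l], hence [x * y = a + e] with [e <= l].
    Expanding [(x * y)^2 = (a - D) * (t - l)] then bounds [a * (t - a)] by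
    [2 * a * e + a * l + D * t], the term [D * l] absorbing [e^2]. *)
Lemma moser_right (a t x y D l : R) : 0 < a -> a <= t -> 0 <= D -> 0 <= l ->
  x ^+ 2 = a - D -> y ^+ 2 = t - l -> D * t <= l * a ->
  (a - x * y) ^+ 2 <= D * l -> t - a <= 4 * l.
Proof.
move=> a0 at_ D0 l0 x2 y2 Dt xy.
have Dl : D <= l.
  rewrite -(ler_pM2r (lt_le_trans a0 at_)) (le_trans Dt)//.
  by rewrite ler_wpM2l.
pose e := x * y - a.
have e2 : e ^+ 2 <= D * l by rewrite /e -opprB sqrrN.
have el : e <= l.
  rewrite leNgt; apply/negP => le; nra.
have w2 : (x * y) ^+ 2 = (a - D) * (t - l) by rewrite exprMn x2 y2.
have : a * (t - a) <= a * (4 * l).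
  have -> : a * (t - a) = (a - D) * (t - l) - a ^+ 2 + a * l + D * t - D * l by ring.
  rewrite -w2 (_ : x * y = a + e); last by rewrite /e; ring.
  nra.
by rewrite ler_pM2l.
Qed.

(** To the left of [a] the bound [D <= l] may fail; what survives is [t * e <= a * l]. The resulting
    estimate loses a factor [a / t], which is harmless while [t] is comparable to [a]. *)
Lemma moser_left (a t x y D l : R) : 0 < t -> t <= a -> 0 <= D -> 0 <= l ->
  x ^+ 2 = a - D -> y ^+ 2 = t - l -> D * t <= l * a ->
  (t - y * x) ^+ 2 <= l * D -> t * (a - t) <= 4 * a * l.
Proof.
move=> t0 ta D0 l0 x2 y2 Dt xy.
have a0 : 0 < a by exact: lt_le_trans ta.
pose e := y * x - t.
have e2 : e ^+ 2 <= l * D by rewrite /e -opprB sqrrN.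
have te : t * e <= a * l.
  have [/ltW e0|e0] := ltP e 0.
    by rewrite (@le_trans _ _ 0)// ?mulr_ge0 ?mulr_ge0_le0 ?(ltW t0) ?(ltW a0).
  rewrite -(@ler_pXn2r _ 2)// ?nnegrE ?mulr_ge0 ?(ltW t0) ?(ltW a0)//.
  rewrite exprMn (le_trans (ler_wpM2l (sqr_ge0 t) e2))//.
  have -> : t ^+ 2 * (l * D) = (t * l) * (D * t) by ring.
  rewrite (le_trans (ler_wpM2l _ Dt)) ?mulr_ge0 ?(ltW t0)//.
  have -> : (a * l) ^+ 2 = (a * l) * (l * a) by ring.
  by rewrite ler_wpM2r ?mulr_ge0 ?(ltW a0)// ler_wpM2r.
have w2 : (y * x) ^+ 2 = (t - l) * (a - D) by rewrite exprMn x2 y2.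
have -> : t * (a - t) = (t - l) * (a - D) - t ^+ 2 + D * t + l * a - l * D by ring.
rewrite -w2 (_ : y * x = t + e); last by rewrite /e; ring.
nra.
Qed.

(** At coefficients [1] and [-1] the form equals [|t - s|]: [G] is Hoelder continuous of exponent
    1/2. *)
Lemma form_continuous (G : R -> R) :
  (forall p q s t, 0 < s -> s <= t ->
    (p * G s + q * G t) ^+ 2 <= p ^+ 2 * s + 2 * p * q * s + q ^+ 2 * t) ->
  forall t, 0 < t -> {for t, continuous G}.
Proof.
move=> H t t0; apply/cvgrPdist_le => /= e e0; near=> s.
have s0 : 0 < s by near: s; exact: lt_nbhsr.
have ts : `|t - s| < e ^+ 2.
  by near: s; apply: cvgr_dist_lt => //; rewrite exprn_gt0.
rewrite -(@ler_pXn2r _ 2)// ?nnegrE ?(ltW e0)// real_normK ?num_real//.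
rewrite (le_trans _ (ltW ts))//.
have [st|ts'] := leP s t.
  by rewrite ger0_norm ?subr_ge0//; have := H (-1) 1 s t s0 st; nra.
rewrite ltr0_norm ?subr_lt0//; have := H 1 (-1) t s t0 (ltW ts'); nra.
Unshelve. all: by end_near. Qed.

(* [a] is a point where the deficit [t - G t ^+ 2], relative to [t], is the
   smallest. *)
Lemma moser_pointwise (G : R -> R) (e T : R) : 0 < e -> e <= T ->
  (forall p q s t, 0 < s -> s <= t ->
    (p * G s + q * G t) ^+ 2 <= p ^+ 2 * s + 2 * p * q * s + q ^+ 2 * t) ->
  exists a, forall t, e <= t -> t <= T ->
    Num.min t `|t - a| / 8 <= t - G t ^+ 2.
Proof.
move=> e0 eT H.
have cG := form_continuous H.
have pos t : e <= t -> 0 < t by exact: lt_le_trans.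
have Fge0 t : 0 < t -> 0 <= t - G t ^+ 2.
  by move=> t0; have := H 0 1 t t t0 (lexx _); rewrite subr_ge0; lra.
(* The matrix with entries [s, s, s, t] is the Gram matrix of the indicators of [[0, s]] and
   [[0, t]]. The hypothesis says that it dominates the rank one matrix of the values of [G]; this is
   the determinant of the difference. *)
have det s t : 0 < s -> s <= t ->
    (s - G s * G t) ^+ 2 <= (s - G s ^+ 2) * (t - G t ^+ 2).
  move=> s0 st; apply: psd_form_det => p q.
  by have := H p q s t s0 st; rewrite -subr_ge0; congr (_ <= _); ring.
have [a aeT amin] : exists2 a, a \in `[e, T] & forall t, t \in `[e, T] ->
    (a - G a ^+ 2) / a <= (t - G t ^+ 2) / t.
  apply: EVT_min => //.
  rewrite (_ : (fun t => _) = (fun t => (t - G t * G t) / t)); last first.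
    by apply/funext => t; rewrite expr2.
  apply: continuous_in_subspaceT => x; rewrite inE/= in_itv/= => /andP[ex _].
  have x0 := pos _ ex.
  apply: cvgM; last by apply: inv_continuous; rewrite gt_eqF.
  by apply: cvgB; [exact: cvg_id|by apply: cvgM; exact: cG].
have /andP[ea aT] : e <= a <= T by move: aeT; rewrite in_itv.
exists a => t et tT.
have t0 := pos _ et; have a0 := pos _ ea.
have Dt : (a - G a ^+ 2) * t <= (t - G t ^+ 2) * a.
  have /amin : t \in `[e, T] by rewrite in_itv/= et.
  by rewrite ler_pdivlMr// mulrAC ler_pdivrMr.
have Gx (z : R) : G z ^+ 2 = z - (z - G z ^+ 2) by ring.
rewrite ler_pdivrMr// ge_min.
have [at_|ta] := leP a t.
  have h := moser_right a0 at_ (Fge0 _ a0) (Fge0 _ t0) (Gx a) (Gx t) Dt (det _ _ a0 at_).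
  apply/orP; right; rewrite ger0_norm ?subr_ge0//.
  by have := Fge0 _ t0; lra.
have h := moser_left t0 (ltW ta) (Fge0 _ a0) (Fge0 _ t0) (Gx a) (Gx t) Dt (det _ _ t0 (ltW ta)).
rewrite ltr0_norm ?subr_lt0// opprB.
(* From [t * (a - t) <= 4 * a * l]: if [t >= a / 2] then [a - t <= 8 * l], and otherwise
   [a - t >= a / 2], so that [t <= 8 * l]. Hence the minimum and the constant 8. *)
have [t2|t2] := leP (a / 2) t; apply/orP; [right|left].
  rewrite -(ler_pM2l a0); nra.
rewrite -(ler_pM2l a0); nra.
Qed.

(** The exponential decay is weakened to a function whose antiderivative is an arctangent, bounded
    on the whole line. *)
Lemma expRN_half_le (y : R) : 0 <= y -> expR (- (y / 2)) <= 8 / (1 + y ^+ 2).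
Proof.
move=> y0; rewrite expRN ler_pdivlMr ?ltr_pwDl ?sqr_ge0//.
rewrite mulrC ler_pdivrMr ?expR_gt0//.
have := @expR_ge1Dxn R (y / 2) 1 (divr_ge0 y0 (ler0n _ 2)).
rewrite (_ : 2`!%:R = 2)// => h.
nra.
Qed.

Lemma moser_exp (t a l : R) : 0 < t -> Num.min t `|t - a| / 8 <= l ->
  expR (- (4 * l)) <= 8 / (1 + t ^+ 2) + 8 / (1 + (t - a) ^+ 2).
Proof.
move=> t0 h.
have p (x : R) : 0 <= 8 / (1 + x ^+ 2).
  by rewrite divr_ge0// addr_ge0// sqr_ge0.
have [tta|tta] := leP t `|t - a|.
  apply: le_trans (_ : expR (- (t / 2)) <= _).
    by rewrite ler_expR lerN2; move: h; rewrite (min_idPl tta); lra.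
  by rewrite (le_trans (expRN_half_le (ltW t0)))// lerDl.
apply: le_trans (_ : expR (- (`|t - a| / 2)) <= _).
  by rewrite ler_expR lerN2; move: h; rewrite (min_idPr (ltW tta)); lra.
rewrite (le_trans (expRN_half_le (normr_ge0 _)))// real_normK ?num_real//.
by rewrite lerDr.
Qed.

End Moser.

(** * The Green representation of radial functions *)

Section SquareIntegrable.
Context d (T : measurableType d) (R : realType).
Variable m : {measure set T -> \bar R}.

Lemma integrableZl_EFin (a : R) (f : T -> R) :
  m.-integrable setT (fun x => (f x)%:E) ->
  m.-integrable setT (fun x => (a * f x)%:E).
Proof.
move=> If; rewrite (_ : (fun x => _) = (fun x => a%:E * (f x)%:E)%E).
  exact: integrableZl.
by apply/funext => x; rewrite EFinM.
Qed.

Lemma integrableD_EFin (f g : T -> R) :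
  m.-integrable setT (fun x => (f x)%:E) ->
  m.-integrable setT (fun x => (g x)%:E) ->
  m.-integrable setT (fun x => (f x + g x)%:E).
Proof.
move=> If Ig; rewrite (_ : (fun x => _) =
    ((fun x => (f x)%:E) \+ (fun x => (g x)%:E))%E); first exact: integrableD.
by apply/funext => x; rewrite EFinD.
Qed.

Lemma integrable_sum_EFin (I : Type) (r : seq I) (f : I -> T -> R) :
  (forall i, m.-integrable setT (fun x => (f i x)%:E)) ->
  m.-integrable setT (fun x => (\sum_(i <- r) f i x)%:E).
Proof.
move=> If; elim: r => [|i r IH].
  by under eq_fun do rewrite big_nil; exact: integrable0.
by under eq_fun do rewrite big_cons; exact: integrableD_EFin.
Qed.

Lemma Rintegral_sum (I : Type) (r : seq I) (f : I -> T -> R) :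
  (forall i, m.-integrable setT (fun x => (f i x)%:E)) ->
  \int[m]_x (\sum_(i <- r) f i x) = \sum_(i <- r) \int[m]_x f i x.
Proof.
move=> If; elim: r => [|i r IH].
  by rewrite big_nil; under eq_Rintegral do rewrite big_nil; rewrite /Rintegral integral0.
under eq_Rintegral do rewrite big_cons.
rewrite RintegralD// ?big_cons ?IH//; first exact: If.
exact: integrable_sum_EFin.
Qed.

Definition sqint (f : T -> R) :=
  measurable_fun setT f /\ m.-integrable setT (fun x => (f x ^+ 2)%:E).

Lemma sqint_mul (f g : T -> R) : sqint f -> sqint g ->
  m.-integrable setT (fun x => (f x * g x)%:E).
Proof.
move=> [mf if2] [mg ig2].
apply: (@le_integrable _ _ _ _ _ _ _ (fun x => (f x ^+ 2)%:E + (g x ^+ 2)%:E)%E) => //.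
- by apply/measurable_EFinP; exact: measurable_funM.
- move=> x _ /=; rewrite lee_fin [leRHS]ger0_norm ?addr_ge0 ?sqr_ge0//.
  rewrite ler_norml; apply/andP; split; nra.
- exact: integrableD.
Qed.

Lemma sqint_lin (a b : R) (f g : T -> R) : sqint f -> sqint g ->
  sqint (fun x => a * f x + b * g x).
Proof.
move=> sf sg; have [mf if2] := sf; have [mg ig2] := sg; split.
  by apply: measurable_funD; exact: measurable_funM.
rewrite (_ : (fun x => _) = ((fun x => (a ^+ 2)%:E * (f x ^+ 2)%:E) \+
  ((fun x => (2 * a * b)%:E * (f x * g x)%:E) \+
   (fun x => (b ^+ 2)%:E * (g x ^+ 2)%:E)))%E).
  apply: integrableD => //; first exact: integrableZl.
  by apply: integrableD => //; apply: integrableZl => //; exact: sqint_mul.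
by apply/funext => x /=; rewrite -!EFinM -!EFinD; congr EFin; ring.
Qed.

Lemma sqintB (f g : T -> R) : sqint f -> sqint g -> sqint (fun x => f x - g x).
Proof.
move=> sf sg; have := sqint_lin 1 (-1) sf sg.
by congr sqint; apply/funext => x; ring.
Qed.

Lemma Rintegral_sqr_lin (a b : R) (f g : T -> R) : sqint f -> sqint g ->
  \int[m]_x (a * f x + b * g x) ^+ 2 =
  a ^+ 2 * \int[m]_x (f x ^+ 2) + 2 * a * b * \int[m]_x (f x * g x) +
  b ^+ 2 * \int[m]_x (g x ^+ 2).
Proof.
move=> sf sg; have [mf if2] := sf; have [mg ig2] := sg.
have ifg := sqint_mul sf sg.
rewrite -!RintegralZl// -RintegralD//; [|exact: integrableZl_EFin..].
rewrite -RintegralD//; last 2 first.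
- by apply: integrableD_EFin; exact: integrableZl_EFin.
- exact: integrableZl_EFin.
by apply: eq_Rintegral => x _; ring.
Qed.

Lemma cauchy_schwarz (f g : T -> R) : sqint f -> sqint g ->
  (\int[m]_x (f x * g x)) ^+ 2 <= \int[m]_x (f x ^+ 2) * \int[m]_x (g x ^+ 2).
Proof.
move=> sf sg; apply: psd_form_det => p q.
have <- : \int[m]_x (p * f x + q * g x) ^+ 2 = \int[m]_x (f x ^+ 2) * p ^+ 2 +
  2 * \int[m]_x (f x * g x) * p * q + \int[m]_x (g x ^+ 2) * q ^+ 2.
  by rewrite Rintegral_sqr_lin//; ring.
by apply: Rintegral_ge0 => x _; exact: sqr_ge0.
Qed.

Lemma bnd_supp_sqint (A : set T) (f : T -> R) : measurable A ->
  (m A < +oo)%E -> measurable_fun setT f -> bnd_supp A f -> sqint f.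
Proof.
move=> mA fA mf [[M fM] f0]; split => //.
apply: (bnd_supp_integrable mA fA (f := fun x => f x ^+ 2)).
  exact: measurable_funX.
split; last by move=> x Ax; rewrite f0// expr0n.
exists (M ^+ 2) => x; rewrite normrX ler_pXn2r// ?nnegrE//.
by rewrite (le_trans _ (fM x)).
Qed.

End SquareIntegrable.

Section Bridge.
Context {R : realType}.
Local Notation leb := (@lebesgue_measure R).
Local Notation leb4 := (leb \x leb \x leb \x leb)%E.
Local Notation l4 := (sf_product (sf_product (sf_product leb leb) leb) leb).
Local Notation R4 := (R * R * R * R)%type.

Lemma L2normE (f : R4 -> R) :
  L2norm f = sqrte (\int[l4]_x (((f \_ B) x) ^+ 2)%:E)%E.
Proof.
rewrite /L2norm unlock /= poweR12_sqrt; last first.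
  by apply: integral_ge0 => x _; exact: poweR_ge0.
congr sqrte; apply: eq_integral => x _.
have -> : ((EFin \o f) \_ B) x = ((f \_ B) x)%:E.
  by rewrite !patchE; case: ifP.
by rewrite abse_EFin poweR_EFin powR_mulrn// real_normK ?num_real.
Qed.

Lemma measurable_patchB (f : R4 -> R) :
  measurable_fun (@B R) f -> measurable_fun setT (f \_ B).
Proof.
by move=> mf; apply/(measurable_restrictT _ _).1 => //; exact: measurable_B.
Qed.

Lemma L2_sqint (f : R4 -> R) : measurable_fun (@B R) f ->
  (L2norm f < +oo)%E -> sqint l4 (f \_ B).
Proof.
move=> mf; rewrite L2normE => If; have mg := measurable_patchB mf.
split => //; apply/integrableP; split.
  by apply/measurable_EFinP; exact: measurable_funX.
under eq_integral do rewrite gee0_abs ?lee_fin ?sqr_ge0//.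
rewrite ltey; apply: contraTneq If => ->.
by rewrite ltxx.
Qed.

Lemma L2norm_eq1 (f : R4 -> R) : measurable_fun (@B R) f -> L2norm f = 1%E ->
  sqint l4 (f \_ B) /\ \int[l4]_x ((f \_ B) x ^+ 2) = 1.
Proof.
move=> mf N1; split; first by apply: L2_sqint => //; rewrite N1 ltry.
have I0 : (0 <= \int[l4]_x ((f \_ B) x ^+ 2)%:E)%E.
  by apply: integral_ge0 => x _; rewrite lee_fin sqr_ge0.
have : (sqrte (\int[l4]_x ((f \_ B) x ^+ 2)%:E) ^+ 2 = 1)%E.
  by rewrite -L2normE N1 expe2 mule1.
by rewrite sqr_sqrte// /Rintegral => ->.
Qed.

Lemma H2norm_lt (Dv : seq 'I_4 -> R4 -> R) (e : R) (s : seq 'I_4) : 0 < e ->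
  (H2norm Dv < e%:E)%E -> (size s <= 2)%N ->
  (\int[l4]_x (((Dv s) \_ B) x ^+ 2)%:E < (e ^+ 2)%:E)%E.
Proof.
move=> e0 He s2.
have I0 t : (0 <= \int[l4]_x (((Dv t) \_ B) x ^+ 2)%:E)%E.
  by apply: integral_ge0 => x _; rewrite lee_fin sqr_ge0.
have E t : (L2norm (Dv t) ^+ 2 = \int[l4]_x (((Dv t) \_ B) x ^+ 2)%:E)%E.
  by rewrite L2normE sqr_sqrte.
have L0 t : (0 <= L2norm (Dv t) ^+ 2)%E by rewrite E.
move: He; rewrite /H2norm poweR12_sqrt; last first.
  by apply: sume_ge0 => k _; apply: sume_ge0.
set S := (\sum_(k < 3) _)%E => He.
apply: (@le_lt_trans _ _ S).
  pose k : 'I_3 := Ordinal (s2 : (size s < 3)%N).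
  rewrite /S (bigD1 k)//= (bigD1 (in_tuple s))//= -addeA -E; apply: leeDl.
  apply: adde_ge0; apply: sume_ge0 => ? _; first exact: L0.
  by apply: sume_ge0 => ? _; exact: L0.
have S0 : (0 <= S)%E.
  by apply: sume_ge0 => *; apply: sume_ge0.
rewrite ltNge; apply/negP => eS.
move: He; rewrite ltNge => /negP; apply.
have -> : (e%:E = sqrte (e ^+ 2)%:E)%E by rewrite /= sqrtr_sqr gtr0_norm.
by rewrite lee_sqrt.
Qed.


Lemma H20_approx (u : R4 -> R) (Du : seq 'I_4 -> R4 -> R) (e : R) :
  H20 u Du -> 0 < e -> exists2 phi, test_function phi &
  forall s, (size s <= 2)%N ->
    (\int[l4]_x (((Du s \- partials s phi) \_ B) x ^+ 2)%:E < (e ^+ 2)%:E)%E.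
Proof.
move=> [_ Hu] e0; have [phi tphi Hphi] := Hu e e0; exists phi => // s s2.
exact: (H2norm_lt e0 Hphi).
Qed.
End Bridge.

Section Directional.
Context {R : realType}.

Lemma is_derive_line (V : normedModType R) (f : V -> R) (x v : V) (df : R) :
  is_derive (0 : R) (1 : R) (fun t => f (t *: v + x)) df -> is_derive x v f df.
Proof.
have E : (fun h : R => h^-1 *: (((fun t : R => f (t *: v + x)) \o shift (0 : R)) (h *: 1)
   - (fun t : R => f (t *: v + x)) 0)) =
   (fun h : R => h^-1 *: ((f \o shift x) (h *: v) - f x)).
  by apply/funext => h /=; rewrite /shift/= [h *: 1]mulr1 addr0 scale0r add0r.
move=> [d1 d2]; split; first by move: d1; rewrite /derivable E.
by rewrite -d2 /derive -E.
Qed.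

(** Only a directional derivative of [g] is assumed: the chain rule is applied in one variable, on
    the line through [x] along [v]. *)
Lemma is_derive_comp1 (V : normedModType R) (g : V -> R) (h : R -> R) (x v : V)
    (dg dh : R) :
  is_derive x v g dg -> is_derive (g x) (1 : R) h dh ->
  is_derive x v (h \o g) (dh * dg).
Proof.
move=> [dg1 dg2] hh; apply: is_derive_line.
pose p (t : R) := t *: v + x.
have p0 : p 0 = x by rewrite /p scale0r add0r.
have dp : is_derive (0 : R) (1 : R) (g \o p) dg.
  rewrite -dg2 -p0; apply: is_derive_path; last by rewrite p0.
  by move=> k; rewrite /p scalerDl scale0r add0r addr0.
have dh' : is_derive ((g \o p) 0) (1 : R) h dh by rewrite /= p0.
apply: is_derive_eq; first exact: (is_derive1_comp dh' dp).
by rewrite mulrC.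
Qed.

Local Notation R4 := (R * R * R * R)%type.

Definition coord4 (i : 'I_4) (x : R4) : R :=
  nth 0 [:: x.1.1.1; x.1.1.2; x.1.2; x.2] i.

Definition sqn (x : R4) : R :=
  x.1.1.1 ^+ 2 + x.1.1.2 ^+ 2 + x.1.2 ^+ 2 + x.2 ^+ 2.

Lemma sqn_ge0 x : 0 <= sqn x.
Proof. by rewrite !addr_ge0// sqr_ge0. Qed.

Lemma enormE x : enorm x = Num.sqrt (sqn x). Proof. by []. Qed.

Lemma sqr_enorm (x : R4) : enorm x ^+ 2 = sqn x.
Proof. by rewrite enormE sqr_sqrtr// sqn_ge0. Qed.

Lemma sqnE x : sqn x = \sum_(i < 4) coord4 i x ^+ 2.
Proof. by rewrite !big_ord_recl big_ord0 addr0 !addrA. Qed.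

Lemma is_derive_coord4 (i j : 'I_4) (x : R4) :
  is_derive x (basis4 i) (coord4 j) (i == j)%:R.
Proof.
apply: is_derive_line.
have -> : (fun t : R => coord4 j (t *: basis4 i + x)) =
    (fun t : R => t * (i == j)%:R + coord4 j x).
  apply/funext => t.
  by case: i j => [[|[|[|[|//]]]] Hi] [[|[|[|[|//]]]] Hj].
apply: is_derive_eq.
by rewrite /GRing.scale/= !mulr0 !(addr0, add0r, mul0r, mulr1).
Qed.

Lemma continuous_coord4 (i : 'I_4) : continuous (coord4 i).
Proof.
have c1 (U V : topologicalType) : continuous (fst : U * V -> U) by move=> x; exact: cvg_fst.
have c2 (U V : topologicalType) : continuous (snd : U * V -> V) by move=> x; exact: cvg_snd.
case: i => [[|[|[|[|//]]]] Hi] x; rewrite /coord4/=.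
- by apply: (@cvg_comp _ _ _ (fun x : R4 => x.1.1) fst); [apply: (@cvg_comp _ _ _ (fun x : R4 => x.1) fst); [exact: c1|exact: c1]|exact: c1].
- by apply: (@cvg_comp _ _ _ (fun x : R4 => x.1.1) snd); [apply: (@cvg_comp _ _ _ (fun x : R4 => x.1) fst); [exact: c1|exact: c1]|exact: c2].
- by apply: (@cvg_comp _ _ _ (fun x : R4 => x.1) snd); [exact: c1|exact: c2].
- exact: c2.
Qed.

Lemma continuous_sqn : continuous sqn.
Proof.
move=> x; rewrite (_ : sqn = fun y => coord4 0 y * coord4 0 y +
  coord4 1 y * coord4 1 y + coord4 2 y * coord4 2 y + coord4 3 y * coord4 3 y).
  by do 3 (apply: cvgD; last by apply: cvgM; exact: continuous_coord4);
    apply: cvgM; exact: continuous_coord4.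
by apply/funext => y; rewrite sqnE !big_ord_recl big_ord0 addr0 !addrA !expr2.
Qed.

Lemma is_derive_sqn (i : 'I_4) (x : R4) :
  is_derive x (basis4 i) sqn (2 * coord4 i x).
Proof.
rewrite (_ : sqn = \sum_(j < 4) (fun y => coord4 j y * coord4 j y)); last first.
  by apply/funext => y; rewrite sqnE fct_sumE; apply: eq_bigr => j _; rewrite expr2.
apply: is_derive_eq.
  apply: is_derive_sum => j.
  exact: (is_deriveM (is_derive_coord4 i j x) (is_derive_coord4 i j x)).
rewrite (bigD1 i)//= big1 => [|j ji].
  by rewrite eqxx /GRing.scale/=; ring.
by rewrite eq_sym (negPf ji) /GRing.scale/= !mulr0 addr0.
Qed.

Lemma is_derive_radial (h h' : R -> R) (i : 'I_4) (x : R4) :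
  (forall r : R, is_derive r (1 : R) h (h' r)) ->
  is_derive x (basis4 i) (fun x => h (sqn x)) (2 * coord4 i x * h' (sqn x)).
Proof.
move=> dh; apply: is_derive_eq.
  exact: (is_derive_comp1 (is_derive_sqn i x) (dh (sqn x))).
by rewrite mulrC.
Qed.

End Directional.

Section Green.
Context {R : realType}.
Local Notation leb := (@lebesgue_measure R).
Local Notation leb4 := (leb \x leb \x leb \x leb)%E.
Local Notation l4 := (sf_product (sf_product (sf_product leb leb) leb) leb).
Local Notation R4 := (R * R * R * R)%type.

Definition box : set R4 :=
  `[-1, 1]%classic `*` `[-1, 1]%classic `*` `[-1, 1]%classic `*` `[-1, 1]%classic.

Lemma measurable_box : measurable box.
Proof.
have mJ : measurable (`[-1, 1]%classic : set (measurableTypeR R)).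
  exact: measurable_itv.
by do 3 (apply: measurableX => //).
Qed.

Lemma box_lty : (l4 box < +oo)%E.
Proof.
pose J : set (measurableTypeR R) := `[-1, 1]%classic.
have mJ : measurable J by exact: measurable_itv.
have fJ : (leb J < +oo)%E.
  by rewrite lebesgue_measure_itv/= lte_fin; case: ifP; rewrite ?ltry.
have H2 : (sf_product leb leb (J `*` J) < +oo)%E.
  by rewrite /sf_product product_measure1E// lte_mul_pinfty// ge0_fin_numE.
have mJ2 : measurable (J `*` J) by exact: measurableX.
have H3 : (sf_product (sf_product leb leb) leb (J `*` J `*` J) < +oo)%E.
  have -> : sf_product (sf_product leb leb) leb (J `*` J `*` J) =
    (sf_product leb leb (J `*` J) * leb J)%E by exact: product_measure1E.
  by rewrite lte_mul_pinfty// ge0_fin_numE.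
have mJ3 : measurable (J `*` J `*` J) by exact: measurableX.
have -> : l4 box = (sf_product (sf_product leb leb) leb (J `*` J `*` J) * leb J)%E.
  exact: product_measure1E.
by rewrite lte_mul_pinfty// ge0_fin_numE.
Qed.

Lemma B_sub_box : @B R `<=` box.
Proof. exact: B_box. Qed.

Lemma bnd_supp_box (f : R4 -> R) (K : set R4) : compact K -> K `<=` @B R ->
  continuous f -> (forall x, ~ K x -> f x = 0) -> bnd_supp box f.
Proof. exact: compact_bnd_supp. Qed.

Lemma box_integrable (f : R4 -> R) : measurable_fun setT f -> bnd_supp box f ->
  l4.-integrable setT (fun x => (f x)%:E).
Proof. exact: (@bnd_supp_integrable _ _ _ l4 box f measurable_box box_lty). Qed.

Lemma box_sqint (f : R4 -> R) : measurable_fun setT f -> bnd_supp box f ->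
  sqint l4 f.
Proof. exact: (@bnd_supp_sqint _ _ _ l4 box f measurable_box box_lty). Qed.

Lemma continuous_radial (h : R -> R) : continuous h ->
  continuous (fun x : R4 => h (sqn x)).
Proof.
move=> ch x; apply: (@cvg_comp _ _ _ sqn h _ (nbhs (sqn x))).
  exact: continuous_sqn.
exact: ch.
Qed.

Lemma is_derive_continuous (h h' : R -> R) :
  (forall r : R, is_derive r (1 : R) h (h' r)) -> continuous h.
Proof.
move=> dh r; apply: differentiable_continuous; apply/derivable1_diffP.
by have [] := dh r.
Qed.

(** Green's second identity, without boundary term since [phi] has compact support in [B]. In
    dimension 4 the Laplacian of [h (|x|^2)] is [4 |x|^2 h'' + 8 h']. *)
Lemma green_radial (phi : R4 -> R) (h h' h'' : R -> R) :
  test_function phi ->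
  (forall r : R, is_derive r (1 : R) h (h' r)) ->
  (forall r : R, is_derive r (1 : R) h' (h'' r)) -> continuous h'' ->
  \int[l4]_x ((\sum_(i < 4) partials [:: i; i] phi x) * h (sqn x)) =
  \int[l4]_x (phi x * (4 * sqn x * h'' (sqn x) + 8 * h' (sqn x))).
Proof.
move=> [dphi [K [cK KB phi0]]] dh dh' ch''.
have ch := is_derive_continuous dh; have ch' := is_derive_continuous dh'.
have D0 s x : ~ K x -> partials s phi x = 0.
  elim: s x => [|i s IH] x Kx /=; first exact: phi0.
  exact: (derive_eq0_off _ cK IH).
have Dc s : continuous (partials s phi).
  by move=> x; exact: differentiable_continuous.
pose e1 (i : 'I_4) (x : R4) := 2 * coord4 i x * h' (sqn x).
pose e2 (i : 'I_4) (x : R4) := 2 * h' (sqn x) + 4 * coord4 i x ^+ 2 * h'' (sqn x).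
have de1 i x : is_derive x (basis4 i) (e1 i) (e2 i x).
  have d1 := is_deriveM (is_derive_coord4 i i x) (is_derive_radial i x dh').
  apply: is_derive_eq.
    rewrite (_ : e1 i = 2 \*: (coord4 i * (fun x => h' (sqn x)))); last first.
      by apply/funext => y; rewrite /e1 -mulrA.
    exact: is_deriveZ.
  by rewrite eqxx /GRing.scale/= /e2; ring.
(* Component [i] of the flux [h * grad phi - phi * grad h]; the mixed first order terms cancel in
   its derivative [P' i]. *)
pose P (i : 'I_4) (x : R4) := partials [:: i] phi x * h (sqn x) - phi x * e1 i x.
pose P' (i : 'I_4) (x : R4) := partials [:: i; i] phi x * h (sqn x) - phi x * e2 i x.
have dP i x : is_derive x (basis4 i) (P i) (P' i x).
  have dd s : is_derive x (basis4 i) (partials s phi) (partials (i :: s) phi x).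
    by apply/derivableP/diff_derivable.
  apply: is_derive_eq.
    apply: is_deriveB.
      exact: (is_deriveM (dd [:: i]) (is_derive_radial i x dh)).
    exact: (is_deriveM (dd [::]) (de1 i x)).
  by rewrite /P' /e1 /GRing.scale/=; ring.
have P'E i : 'D_(basis4 i) (P i) = P' i.
  by apply/funext => x; have [_] := dP i x.
have cP' i : continuous (P' i).
  move=> x; apply: cvgB; apply: cvgM; try exact: Dc.
  - exact: continuous_radial.
  - exact: (Dc [::]).
  rewrite /e2; apply: cvgD.
    by apply: cvgM; [exact: cvg_cst|exact: continuous_radial].
  apply: cvgM; last exact: continuous_radial.
  apply: cvgM; first exact: cvg_cst.
  rewrite (_ : (fun t => _) = (fun t => coord4 i t * coord4 i t)).
    by apply: cvgM; exact: continuous_coord4.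
  by apply/funext => y; rewrite expr2.
have P'0 i x : ~ K x -> P' i x = 0.
  by move=> Kx; rewrite /P' (D0 [:: i; i])// phi0// !mul0r subr0.
have iP' i : l4.-integrable setT (fun x => (P' i x)%:E).
  apply: box_integrable; first exact: continuous_measurable_fun4.
  by apply: (bnd_supp_box cK) => // x; exact: P'0.
have I0 i : \int[l4]_x (P' i x) = 0.
  have H : (\int[leb4]_x ('D_(basis4 i) (P i) x)%:E = 0)%E.
    apply: (@integral_partial_eq0 R i (P i) K cK KB).
    - by move=> x Kx; rewrite /P (D0 [:: i])// phi0// !mul0r subr0.
    - by move=> x; have [] := dP i x.
    - by rewrite P'E.
  rewrite /Rintegral (_ : (\int[l4]_x (P' i x)%:E = 0)%E)// -[RHS]H.
  apply: eq_integral => x _; congr EFin; apply/esym.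
  by have [_] := dP i x; apply.
pose A (x : R4) := (\sum_(i < 4) partials [:: i; i] phi x) * h (sqn x).
pose C (x : R4) := phi x * (4 * sqn x * h'' (sqn x) + 8 * h' (sqn x)).
have AC x : A x = C x + \sum_(i <- index_enum 'I_4) P' i x.
  have -> : \sum_(i <- index_enum 'I_4) P' i x = A x - phi x * \sum_(i < 4) e2 i x.
    by rewrite /A mulr_suml mulr_sumr -sumrB.
  have -> : \sum_(i < 4) e2 i x = 4 * sqn x * h'' (sqn x) + 8 * h' (sqn x).
    rewrite /e2; move: (h' _) (h'' _) => y1 y2.
    by rewrite sqnE !big_ord_recl !big_ord0; ring.
  by rewrite /C; ring.
have S0 (r : seq 'I_4) : l4.-integrable setT (fun x => (\sum_(i <- r) P' i x)%:E) /\
    \int[l4]_x (\sum_(i <- r) P' i x) = 0.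
  elim: r => [|i r [IH1 IH2]].
    under eq_fun do rewrite big_nil; split; first exact: integrable0.
    by under eq_Rintegral do rewrite big_nil; rewrite /Rintegral integral0.
  split.
    by under eq_fun do rewrite big_cons; exact: integrableD_EFin.
  under eq_Rintegral do rewrite big_cons.
  rewrite RintegralD//; last exact: iP'.
  by rewrite -[RHS]addr0; congr (_ + _); [exact: I0|exact: IH2].
have iC : l4.-integrable setT (fun x => (C x)%:E).
  have cC : continuous C.
    move=> x; apply: cvgM; first exact: (Dc [::]).
    apply: cvgD; last first.
      by apply: cvgM; [exact: cvg_cst|exact: continuous_radial].
    apply: cvgM; last exact: continuous_radial.
    by apply: cvgM; [exact: cvg_cst|exact: continuous_sqn].
  apply: box_integrable; first exact: continuous_measurable_fun4.
  by apply: (bnd_supp_box cK) => // x Kx; rewrite /C phi0// mul0r.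
have [S1 S2] := S0 (index_enum 'I_4).
transitivity (\int[l4]_x (C x + \sum_(i <- index_enum 'I_4) P' i x)).
  by apply: eq_Rintegral => x _; exact: AC.
by rewrite RintegralD// -[RHS]addr0; congr (_ + _); exact: S2.
Qed.

End Green.

Section GreenH20.
Context {R : realType}.
Local Notation leb := (@lebesgue_measure R).
Local Notation leb4 := (leb \x leb \x leb \x leb)%E.
Local Notation l4 := (sf_product (sf_product (sf_product leb leb) leb) leb).
Local Notation R4 := (R * R * R * R)%type.

Lemma patchB_eq (f : R4 -> R) (x : R4) : B x -> (f \_ B) x = f x.
Proof. by move=> Bx; rewrite patchE mem_set. Qed.

Lemma patchB_out (f : R4 -> R) (x : R4) : ~ B x -> (f \_ B) x = 0.
Proof. by move=> Bx; rewrite patchE memNset. Qed.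

Lemma bounded_patch_sqint (f : R4 -> R) (M : R) : measurable_fun (@B R) f ->
  (forall x, B x -> `|f x| <= M) -> sqint l4 (f \_ B).
Proof.
move=> mf fM; apply: box_sqint; first exact: measurable_patchB.
split; last by move=> x bx; apply: patchB_out => Bx; apply: bx; exact: B_sub_box.
exists (Num.max 0 M) => x; have [Bx|Bx] := pselect (B x).
  by rewrite patchB_eq// le_max fM// orbT.
by rewrite patchB_out// normr0 le_max lexx.
Qed.

Lemma sqn_B (x : R4) : B x -> 0 <= sqn x < 1.
Proof.
rewrite /B/= => Bx; rewrite sqn_ge0/= -sqr_enorm.
by rewrite expr_lt1// sqrtr_ge0.
Qed.

Lemma radial_patch_sqint (k : R -> R) : continuous k ->
  sqint l4 ((fun x => k (sqn x)) \_ B).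
Proof.
move=> ck.
have cI : compact (k @` `[0, 1]%classic).
  by apply: continuous_compact; [exact: continuous_subspaceT|exact: segment_compact].
have [M [_ MK]] := compact_bounded cI.
apply: (@bounded_patch_sqint _ (`|M| + 1)).
  by apply: measurable_funTS; apply: continuous_measurable_fun4; exact: continuous_radial.
move=> x /sqn_B /andP[x0 x1].
apply: (MK (`|M| + 1)); last by exists (sqn x) => //=; rewrite in_itv/= x0 ltW.
by rewrite (le_lt_trans (ler_norm M))// ltrDl.
Qed.

Lemma cauchy_schwarz_le (d g : R4 -> R) (e : R) : 0 < e -> sqint l4 d ->
  sqint l4 g -> (\int[l4]_x (d x ^+ 2)%:E < (e ^+ 2)%:E)%E ->
  `|\int[l4]_x (d x * g x)| <= e * Num.sqrt (\int[l4]_x (g x ^+ 2)).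
Proof.
move=> e0 sd sg He.
have I0 : (0 <= \int[l4]_x (d x ^+ 2)%:E)%E.
  by apply: integral_ge0 => x _; rewrite lee_fin sqr_ge0.
have He' : \int[l4]_x (d x ^+ 2) <= e ^+ 2.
  rewrite /Rintegral -lee_fin fineK ?ltW//.
  by rewrite ge0_fin_numE// (lt_trans He)// ltry.
have g0 : 0 <= \int[l4]_x (g x ^+ 2) by apply: Rintegral_ge0 => x _; exact: sqr_ge0.
rewrite -(@ler_pXn2r _ 2)// ?nnegrE ?mulr_ge0 ?sqrtr_ge0 ?(ltW e0)//.
rewrite real_normK ?num_real// exprMn sqr_sqrtr//.
by rewrite (le_trans (cauchy_schwarz sd sg))// ler_wpM2r.
Qed.

Lemma measurable_laplacian (u : R4 -> R) (Du : seq 'I_4 -> R4 -> R) :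
  H20 u Du -> measurable_fun (@B R) (laplacian Du).
Proof.
move=> [[_ H] _]; rewrite /laplacian.
apply: measurable_sum => i.
by have [] := (H [:: i; i] isT).1.
Qed.

(** For fixed [h] both sides are continuous in the H^2 norm, so the identity passes from test
    functions to their closure. This is where both Dirichlet conditions enter: nothing is required
    of [h] on the boundary of [B]. *)
Lemma green_H20 (u : R4 -> R) (Du : seq 'I_4 -> R4 -> R) (h h' h'' : R -> R) :
  H20 u Du ->
  (forall r : R, is_derive r (1 : R) h (h' r)) ->
  (forall r : R, is_derive r (1 : R) h' (h'' r)) -> continuous h'' ->
  \int[l4]_x ((laplacian Du \_ B) x * h (sqn x)) =
  \int[l4]_x ((u \_ B) x * (4 * sqn x * h'' (sqn x) + 8 * h' (sqn x))).
Proof.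
move=> Hu dh dh' ch''.
have ch := is_derive_continuous dh; have ch' := is_derive_continuous dh'.
pose k (r : R) := 4 * r * h'' r + 8 * h' r.
have ck : continuous k.
  move=> r; apply: cvgD; last by apply: cvgM; [exact: cvg_cst|exact: ch'].
  apply: cvgM; last exact: ch''.
  by apply: cvgM; [exact: cvg_cst|exact: cvg_id].
pose eta := (fun x : R4 => h (sqn x)) \_ B.
pose kap := (fun x : R4 => k (sqn x)) \_ B.
have seta : sqint l4 eta by exact: radial_patch_sqint.
have skap : sqint l4 kap by exact: radial_patch_sqint.
have patchM (f g : R4 -> R) x : (f \_ B) x * g x = (f \_ B) x * (g \_ B) x.
  have [Bx|Bx] := pselect (B x); first by rewrite !patchB_eq.
  by rewrite patchB_out// !mul0r.
have H2u := Hu.1.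
have sD s : (size s <= 2)%N -> sqint l4 (Du s \_ B).
  by move=> s2; have [[mD ID] _] := (H2u.2 s s2); exact: L2_sqint.
have Eu : Du [::] = u by have [] := H2u.
pose LHS := \int[l4]_x ((laplacian Du \_ B) x * h (sqn x)).
pose RHS := \int[l4]_x ((u \_ B) x * k (sqn x)).
rewrite -/LHS; change (LHS = RHS).
(* Cauchy-Schwarz for the four pure second derivatives, paired with [eta], and for the function
   itself, paired with [kap]; each error has L^2 norm below [e]. *)
pose C := 4 * Num.sqrt (\int[l4]_x (eta x ^+ 2)) + Num.sqrt (\int[l4]_x (kap x ^+ 2)).
have C0 : 0 <= C by rewrite addr_ge0 ?mulr_ge0 ?sqrtr_ge0.
suff H e : 0 < e -> `|LHS - RHS| <= e * C.
  apply/eqP; rewrite -subr_eq0 -normr_le0; apply/ler_addgt0Pl => e e0.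
  rewrite addr0; have := H (e / (C + 1)) (divr_gt0 e0 (ltr_wpDl C0 ltr01)).
  move/le_trans; apply; rewrite mulrAC ler_pdivrMr ?ltr_wpDl//.
  by rewrite ler_pM2l// lerDl.
move=> e0; have [phi tphi Hphi] := H20_approx Hu e0.
have [dphi [K [cK KB phi0]]] := tphi.
have G := green_radial tphi dh dh' ch''.
have D0 s x : ~ K x -> partials s phi x = 0.
  elim: s x => [|i s IH] x Kx /=; first exact: phi0.
  exact: (derive_eq0_off _ cK IH).
have Dc s : continuous (partials s phi).
  by move=> x; exact: differentiable_continuous.
have sphi s : sqint l4 (partials s phi).
  apply: box_sqint; first exact: continuous_measurable_fun4.
  by apply: (bnd_supp_box cK) => // x; exact: D0.
have phiB s x : (partials s phi \_ B) x = partials s phi x.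
  have [Bx|Bx] := pselect (B x); first by rewrite patchB_eq.
  by rewrite patchB_out// D0// => /KB.
pose d s := (Du s \- partials s phi) \_ B.
have dE s x : d s x = (Du s \_ B) x - partials s phi x.
  rewrite -phiB /d; have [Bx|Bx] := pselect (B x); first by rewrite !patchB_eq.
  by rewrite !patchB_out// subr0.
have sd s : (size s <= 2)%N -> sqint l4 (d s).
  move=> s2; rewrite (_ : d s = fun x => (Du s \_ B) x - partials s phi x).
    by apply: sqintB; [exact: sD|exact: sphi].
  by apply/funext => x; exact: dE.
have key : LHS - RHS = \sum_(i < 4) \int[l4]_x (d [:: i; i] x * eta x) -
    \int[l4]_x (d [::] x * kap x).
  have ip s : l4.-integrable setT (fun x => (partials s phi x * eta x)%:E).
    exact: sqint_mul.
  have iD s : (size s <= 2)%N -> l4.-integrable setT (fun x => ((Du s \_ B) x * eta x)%:E).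
    by move=> s2; apply: sqint_mul => //; exact: sD.
  have E1 i : \int[l4]_x (d [:: i; i] x * eta x) =
      \int[l4]_x ((Du [:: i; i] \_ B) x * eta x) -
      \int[l4]_x (partials [:: i; i] phi x * eta x).
    rewrite -RintegralB//; [|exact: iD|exact: ip].
    by apply: eq_Rintegral => x _; rewrite dE mulrBl.
  have E0 : \int[l4]_x (d [::] x * kap x) = RHS - \int[l4]_x (phi x * k (sqn x)).
    rewrite /RHS; have -> : \int[l4]_x ((u \_ B) x * k (sqn x)) =
        \int[l4]_x ((Du [::] \_ B) x * kap x).
      by apply: eq_Rintegral => x _; rewrite Eu; exact: (patchM u (fun y => k (sqn y))).
    have -> : \int[l4]_x (phi x * k (sqn x)) = \int[l4]_x (phi x * kap x).
      apply: eq_Rintegral => x _; rewrite -[phi x](phiB [::] x).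
      exact: (patchM phi (fun y => k (sqn y))).
    rewrite -RintegralB//.
    - by apply: eq_Rintegral => x _; rewrite dE mulrBl.
    - by apply: sqint_mul => //; exact: sD.
    - by apply: sqint_mul => //; exact: (sphi [::]).
  have EL : LHS = \sum_(i < 4) \int[l4]_x ((Du [:: i; i] \_ B) x * eta x).
    rewrite -Rintegral_sum; last by move=> i; exact: iD.
    apply: eq_Rintegral => x _.
    rewrite (patchM _ (fun y => h (sqn y))) -mulr_suml; congr (_ * _).
    have [Bx|Bx] := pselect (B x); last first.
      by rewrite patchB_out// big1// => i _; rewrite patchB_out.
    by rewrite patchB_eq//; apply: eq_bigr => i _; rewrite patchB_eq.
  have EP : \int[l4]_x (phi x * k (sqn x)) =
      \sum_(i < 4) \int[l4]_x (partials [:: i; i] phi x * eta x).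
    rewrite -Rintegral_sum; last by move=> i; exact: ip.
    rewrite -G; apply: eq_Rintegral => x _; rewrite mulr_suml; apply: eq_bigr => i _.
    rewrite -[partials [:: i; i] phi x](phiB [:: i; i] x).
    exact: (patchM _ (fun y => h (sqn y))).
  rewrite EL E0 EP; rewrite [in X in _ = X](eq_bigr _ (fun i _ => E1 i)).
  by rewrite sumrB; ring.
rewrite key (le_trans (ler_normB _ _))// mulrDr lerD//; last first.
  by apply: cauchy_schwarz_le => //; [exact: sd|exact: Hphi].
rewrite (le_trans (ler_norm_sum _ _ _))// (le_trans (ler_sum _ (fun i _ =>
  cauchy_schwarz_le e0 (sd [:: i; i] isT) seta (Hphi [:: i; i] isT))))//.
by rewrite sumr_const card_ord -[leLHS]mulr_natl mulrCA.
Qed.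

End GreenH20.

(** * A C^2 regularization of the truncated fundamental solution *)

Section PosPart.
Context {R : realType}.

Definition ppow (n : nat) (x : R) : R := Num.max x 0 ^+ n.

Lemma ppow_pos n (x : R) : 0 <= x -> ppow n x = x ^+ n.
Proof. by move=> x0; rewrite /ppow max_l. Qed.

Lemma ppow_neg n (x : R) : x <= 0 -> ppow n.+1 x = 0.
Proof. by move=> x0; rewrite /ppow max_r// expr0n. Qed.

Lemma is_derive_ppow n (x : R) :
  is_derive x (1 : R) (ppow n.+2) (n.+2%:R * ppow n.+1 x).
Proof.
have [x0|x0|->] := ltgtP x 0.
- rewrite ppow_neg ?mulr0 ?ltW//.
  apply: (@near_eq_is_derive _ _ _ (cst 0)) => //.
  near=> y; rewrite ppow_neg//; apply/ltW; near: y; exact: lt_nbhsl.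
- rewrite ppow_pos ?ltW//.
  have d : is_derive x (1 : R) (@id R ^+ n.+2) (n.+2%:R * x ^+ n.+1).
    by apply: is_derive_eq; rewrite /GRing.scale/= mulr1.
  apply: near_eq_is_derive d.
  near=> y; have y0 : 0 <= y by apply/ltW; near: y; exact: lt_nbhsr.
  by rewrite ppow_pos// exprfctE.
rewrite ppow_pos// expr0n mulr0.
have H : (fun h : R => h^-1 *: ((ppow n.+2 \o shift 0) (h *: 1) - ppow n.+2 0))
    @ 0^' --> (0 : R).
  apply/cvgrPdist_le => /= e e0; near=> h.
  have h0 : h != 0 by near: h; exact: nbhs_dnbhs_neq.
  have he : `|h| < e by near: h; exact: dnbhs0_lt.
  have h1 : `|h| < 1 by near: h; exact: dnbhs0_lt.
  rewrite sub0r normrN (_ : h *: 1 + 0 = h); last by rewrite [h *: _]mulr1 addr0.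
  rewrite [ppow n.+2 0]ppow_neg// subr0 /GRing.scale/= normrM normfV.
  rewrite ler_pdivrMl ?normr_gt0//.
  have hp : `|ppow n.+2 h| <= `|h| ^+ n.+2.
    rewrite /ppow normrX lerXn2r ?nnegrE//.
    by have [|] := leP h 0 => ?; rewrite ?normr0.
  rewrite (le_trans hp)// exprS ler_pM2l ?normr_gt0//.
  by rewrite exprS (le_trans _ (ltW he))// ler_piMr// exprn_ile1// ltW.
split; first by apply/cvg_ex; exists 0.
by rewrite /derive; apply/cvg_lim.
Unshelve. all: by end_near. Qed.

Lemma continuous_ppow1 : continuous (ppow 1).
Proof.
move=> x; rewrite (_ : ppow 1 = fun x => (x + `|x|) / 2).
  apply: cvgM; last exact: cvg_cst.
  by apply: cvgD; [exact: cvg_id|exact: norm_continuous].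
by apply/funext => y; rewrite /ppow expr1 maxr_absE addr0 subr0.
Qed.

(* Second differences of [ppow 3]: a C^2 approximation of [Num.max x 0], whose
   second derivative [hat] is the tent function. *)
Definition ramp (x : R) := (ppow 3 (x + 1) - 2 * ppow 3 x + ppow 3 (x - 1)) / 6.
Definition step (x : R) := (ppow 2 (x + 1) - 2 * ppow 2 x + ppow 2 (x - 1)) / 2.
Definition hat (x : R) := ppow 1 (x + 1) - 2 * ppow 1 x + ppow 1 (x - 1).

Lemma is_derive_ppow_shift n (c x : R) :
  is_derive x (1 : R) (fun x => ppow n.+2 (x + c)) (n.+2%:R * ppow n.+1 (x + c)).
Proof.
apply: is_derive_eq.
  apply: (@is_derive1_comp _ (ppow n.+2) (fun x => x + c)).
  exact: is_derive_ppow.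
by rewrite addr0 mulr1.
Qed.

Lemma is_derive_ramp (x : R) : is_derive x (1 : R) ramp (step x).
Proof.
have d0 := is_derive_ppow 1 x.
have d1 := is_derive_ppow_shift 1 1 x; have d2 := is_derive_ppow_shift 1 (-1) x.
apply: is_derive_eq.
by rewrite /step /GRing.scale/=; field.
Qed.

Lemma is_derive_step (x : R) : is_derive x (1 : R) step (hat x).
Proof.
have d0 := is_derive_ppow 0 x.
have d1 := is_derive_ppow_shift 0 1 x; have d2 := is_derive_ppow_shift 0 (-1) x.
apply: is_derive_eq.
by rewrite /hat /GRing.scale/=; field.
Qed.

Lemma ramp_step_hat_left x : x <= -1 -> [/\ ramp x = 0, step x = 0 & hat x = 0].
Proof.
move=> x1; rewrite /ramp /step /hat !ppow_neg; first by split; ring.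
all: lra.
Qed.

Lemma ramp_step_hat_right x : 1 <= x -> [/\ ramp x = x, step x = 1 & hat x = 0].
Proof.
move=> x1; rewrite /ramp /step /hat !ppow_pos; first by split; field.
all: lra.
Qed.

Lemma step_bound x : 0 <= step x <= 1.
Proof.
have [h0|h0] := leP 1 x.
  by have [_ -> _] := ramp_step_hat_right h0; rewrite ler01 lexx.
rewrite /step; have [h1|h1] := leP (x + 1) 0.
  rewrite !ppow_neg; lra.
have [h2|h2] := leP x 0.
  rewrite (ppow_pos 2 (ltW h1)) !ppow_neg; [nra|lra|lra].
rewrite (ppow_pos 2 (ltW h1)) (ppow_pos 2 (ltW h2)) !ppow_neg; [nra|lra].
Qed.

Lemma hat_bound x : 0 <= hat x <= 1.
Proof.
have [h0|h0] := leP 1 x.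
  by have [_ _ ->] := ramp_step_hat_right h0; rewrite lexx ler01.
rewrite /hat; have [h1|h1] := leP (x + 1) 0.
  rewrite !ppow_neg; lra.
have [h2|h2] := leP x 0.
  rewrite (ppow_pos 1 (ltW h1)) !ppow_neg; [nra|lra|lra].
rewrite (ppow_pos 1 (ltW h1)) (ppow_pos 1 (ltW h2)) !ppow_neg; [nra|lra].
Qed.

Lemma ramp_bound x : Num.max x 0 <= ramp x <= Num.max x 0 + 1.
Proof.
have [h0|h0] := leP 1 x.
  by have [-> _ _] := ramp_step_hat_right h0; rewrite max_l; lra.
rewrite /ramp; have [h1|h1] := leP (x + 1) 0.
  rewrite max_r ?ppow_neg; lra.
have [h2|h2] := leP x 0.
  rewrite (ppow_pos 3 (ltW h1)) !ppow_neg ?(max_r h2); [|lra..].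
  have : 0 <= (x + 1) ^+ 3 by rewrite exprn_ge0// ltW.
  have : (x + 1) ^+ 3 <= 1 by rewrite exprn_ile1//; lra.
  lra.
rewrite (ppow_pos 3 (ltW h1)) (ppow_pos 3 (ltW h2)) !ppow_neg ?(max_l (ltW h2)); [|lra].
have : 0 <= (1 - x) ^+ 3 by rewrite exprn_ge0//; lra.
have : (1 - x) ^+ 3 <= 1 by rewrite exprn_ile1//; lra.
rewrite (_ : (x + 1) ^+ 3 - 2 * x ^+ 3 + 0 = 6 * x + (1 - x) ^+ 3); last by ring.
lra.
Qed.

Lemma continuous_hat : continuous hat.
Proof.
have c (b : R) : continuous (fun x => ppow 1 (x + b)).
  move=> x; apply: (@cvg_comp _ _ _ (fun x => x + b) (ppow 1) _ (nbhs (x + b))).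
    by apply: cvgD; [exact: cvg_id|exact: cvg_cst].
  exact: continuous_ppow1.
move=> x; apply: cvgD; last exact: c.
apply: cvgB; first exact: c.
by apply: cvgM; [exact: cvg_cst|exact: continuous_ppow1].
Qed.

End PosPart.

Section Smoothing.
Context {R : realType}.
Local Notation leb := (@lebesgue_measure R).
Variables rho0 eps : R.
Hypotheses (rho0_gt0 : 0 < rho0) (eps_gt0 : 0 < eps).

(* [smax] is a C^2 approximation of [Num.max rho0 rho]. *)
Definition smax (r : R) := rho0 + eps * ramp ((r - rho0) / eps).
Definition dsmax (r : R) := step ((r - rho0) / eps).
Definition ddsmax (r : R) := hat ((r - rho0) / eps) / eps.

Definition hker (r : R) := (smax r)^-1.
Definition dhker (r : R) := - (dsmax r * (smax r) ^- 2).
Definition ddhker (r : R) :=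
  2 * dsmax r ^+ 2 * smax r ^- 3 - ddsmax r * (smax r) ^- 2.
(* [lapker (sqn x)] is the Laplacian of [hker (sqn x)]. *)
Definition lapker (r : R) := 4 * r * ddhker r + 8 * dhker r.

Lemma smax_ge r : rho0 <= smax r.
Proof.
rewrite lerDl mulr_ge0 ?(ltW eps_gt0)//.
have /andP[+ _] := ramp_bound ((r - rho0) / eps).
by apply: le_trans; rewrite le_max lexx orbT.
Qed.

Lemma smax_gt0 r : 0 < smax r.
Proof. exact: lt_le_trans (smax_ge r). Qed.

Lemma is_derive_scale (f : R -> R) (df r : R) :
  is_derive ((r - rho0) / eps) (1 : R) f df ->
  is_derive r (1 : R) (fun r => f ((r - rho0) / eps)) (df / eps).
Proof.
move=> d.
have d2 : is_derive r (1 : R) (fun r : R => (r - rho0) * eps^-1) (eps^-1).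
  by apply: is_derive_eq; rewrite /GRing.scale/=; ring.
exact: (@is_derive1_comp _ f _ r df (eps^-1) d d2).
Qed.

Lemma is_derive_smax (r : R) : is_derive r (1 : R) smax (dsmax r).
Proof.
have d := is_derive_scale (is_derive_ramp ((r - rho0) / eps)).
by apply: is_derive_eq; rewrite /GRing.scale/= /dsmax; field; rewrite gt_eqF.
Qed.

Lemma is_derive_dsmax (r : R) : is_derive r (1 : R) dsmax (ddsmax r).
Proof. exact: is_derive_scale (is_derive_step _). Qed.

Lemma is_derive_invr (f : R -> R) (df r : R) : f r != 0 ->
  is_derive r (1 : R) f df -> is_derive r (1 : R) (fun r => (f r)^-1) (- (df * (f r) ^- 2)).
Proof.
move=> f0 [d1 d2]; split; first exact: derivableV.
by rewrite deriveV// d2 /GRing.scale/= mulNr mulrC.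
Qed.

Lemma is_derive_hker (r : R) : is_derive r (1 : R) hker (dhker r).
Proof.
by apply: is_derive_invr; [rewrite gt_eqF// smax_gt0|exact: is_derive_smax].
Qed.

Lemma is_derive_dhker (r : R) : is_derive r (1 : R) dhker (ddhker r).
Proof.
have s0 := smax_gt0 r; have d1 := is_derive_dsmax r; have d2 := is_derive_hker r.
rewrite (_ : dhker = fun r => - (dsmax r * (hker r * hker r))); last first.
  by apply/funext => z; rewrite /dhker /hker expr2 invfM.
apply: is_derive_eq.
rewrite /GRing.scale/= /ddhker /dhker /hker; field.
by rewrite gt_eqF.
Qed.

Lemma continuous_ddhker : continuous ddhker.
Proof.
have ds (r : R) : {for r, continuous smax}.
  by apply: differentiable_continuous; apply/derivable1_diffP; have [] := is_derive_smax r.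
have dds (r : R) : {for r, continuous dsmax}.
  by apply: differentiable_continuous; apply/derivable1_diffP; have [] := is_derive_dsmax r.
have dh (r : R) : {for r, continuous hker}.
  by apply: differentiable_continuous; apply/derivable1_diffP; have [] := is_derive_hker r.
rewrite (_ : ddhker = fun r => 2 * (dsmax r * dsmax r) * (hker r * (hker r * hker r)) -
    ddsmax r * (hker r * hker r)); last first.
  by apply/funext => z; rewrite /ddhker /hker !exprS !expr0 !mulr1 !invfM.
move=> r; apply: cvgB.
  apply: cvgM.
    by apply: cvgM; [exact: cvg_cst|apply: cvgM; exact: dds].
  by apply: cvgM; [exact: dh|apply: cvgM; exact: dh].
apply: cvgM; last by apply: cvgM; exact: dh.
apply: cvgM; last exact: cvg_cst.
apply: (@cvg_comp _ _ _ (fun r => (r - rho0) / eps) hat _ (nbhs ((r - rho0) / eps))).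
  apply: cvgM; last exact: cvg_cst.
  by apply: cvgB; [exact: cvg_id|exact: cvg_cst].
exact: continuous_hat.
Qed.

Lemma hker_close (r : R) : `|hker r - (Num.max rho0 r)^-1| <= eps / rho0 ^+ 2.
Proof.
have M0 : rho0 <= Num.max rho0 r by rewrite le_max lexx.
have Mp := lt_le_trans rho0_gt0 M0.
have S0 := smax_ge r; have Sp := smax_gt0 r.
have EM : Num.max rho0 r = rho0 + eps * Num.max ((r - rho0) / eps) 0.
  rewrite maxr_pMr ?ltW// mulr0 mulrC divfK ?gt_eqF// addr_maxr addr0 maxC.
  by rewrite addrC subrK.
have /andP[b1 b2] := ramp_bound ((r - rho0) / eps).
have d1 : Num.max rho0 r <= smax r by rewrite EM lerD2l ler_pM2l.
have d2 : smax r <= Num.max rho0 r + eps.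
  by rewrite EM /smax -addrA lerD2l -[X in _ <= _ + X]mulr1 -mulrDr ler_pM2l.
have -> : hker r - (Num.max rho0 r)^-1 =
    - ((smax r - Num.max rho0 r) / (smax r * Num.max rho0 r)).
  by rewrite /hker; field; rewrite !gt_eqF.
rewrite normrN ger0_norm; last by rewrite divr_ge0 ?subr_ge0// mulr_ge0 ?ltW.
rewrite ler_pM ?subr_ge0 ?invr_ge0 ?mulr_ge0 ?(ltW Sp) ?(ltW Mp)//; first lra.
rewrite lef_pV2 ?posrE ?mulr_gt0 ?exprn_gt0//.
by rewrite expr2 ler_pM// ltW.
Qed.

(** Away from the transition zone [hker (sqn x)] is either constant or [|x|^-2], which is harmonic
    in R^4 off the origin. *)
Lemma lapker_out (r : R) : eps <= `|r - rho0| -> lapker r = 0.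
Proof.
rewrite /lapker /ddhker /dhker /dsmax /ddsmax; have [r0|r0] := ltP r rho0.
  rewrite ltr0_norm ?subr_lt0// => er.
  have xl : (r - rho0) / eps <= -1 by rewrite ler_pdivrMr//; lra.
  have [_ -> ->] := ramp_step_hat_left xl.
  by rewrite expr0n/= !(mulr0, mul0r, oppr0, subrr, addr0).
rewrite ger0_norm ?subr_ge0// => er.
have rp : 0 < r by exact: lt_le_trans r0.
have [E1 E2 E3] := @ramp_step_hat_right _ ((r - rho0) / eps) (ltac:(rewrite ler_pdivlMr//; lra)).
have -> : smax r = r by rewrite /smax E1 mulrC divfK ?gt_eqF// addrC subrK.
by rewrite E2 E3; field; rewrite !gt_eqF.
Qed.

(** Height of order [1 / eps] on a zone of width of order [eps], as for an approximate identity; the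
    dependence on [rho0] is harmless because [rho0] stays fixed. *)
Lemma lapker_bound (r : R) : 0 <= r <= 1 -> eps <= 1 ->
  `|lapker r| <= (12 / rho0 ^+ 2 + 8 / rho0 ^+ 3) / eps.
Proof.
move=> /andP[r0 r1] e1.
have /andP[s0 s1] := step_bound ((r - rho0) / eps); rewrite -/(dsmax r) in s0 s1.
have /andP[t0 t1] := hat_bound ((r - rho0) / eps).
have S2 : smax r ^- 2 <= rho0 ^- 2.
  by rewrite lef_pV2 ?posrE ?exprn_gt0 ?smax_gt0// ler_pXn2r ?nnegrE ?smax_ge ?(ltW (smax_gt0 _)) ?ltW.
have S3 : smax r ^- 3 <= rho0 ^- 3.
  by rewrite lef_pV2 ?posrE ?exprn_gt0 ?smax_gt0// ler_pXn2r ?nnegrE ?smax_ge ?(ltW (smax_gt0 _)) ?ltW.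
have p2 : 0 <= smax r ^- 2 by rewrite invr_ge0 exprn_ge0// ltW// smax_gt0.
have p3 : 0 <= smax r ^- 3 by rewrite invr_ge0 exprn_ge0// ltW// smax_gt0.
have ei : 1 <= eps^-1 by rewrite invf_ge1.
have u0 : 0 <= ddsmax r by rewrite divr_ge0// ltW.
have u1 : ddsmax r <= eps^-1 by rewrite /ddsmax -[leRHS]mul1r ler_wpM2r// invr_ge0 ltW.
rewrite /lapker /ddhker /dhker.
have T1 : `|4 * r * (2 * dsmax r ^+ 2 * smax r ^- 3)| <= 8 * rho0 ^- 3 * eps^-1.
  have d0 : 0 <= dsmax r ^+ 2 by exact: exprn_ge0.
  rewrite ger0_norm; last by rewrite (mulr_ge0 (mulr_ge0 _ _) (mulr_ge0 (mulr_ge0 _ _) _)).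
  rewrite (_ : 4 * r * _ = (8 * smax r ^- 3) * (r * dsmax r ^+ 2)); last by ring.
  apply: ler_pM; [exact: mulr_ge0|exact: mulr_ge0|by rewrite ler_pM2l|].
  by rewrite (le_trans _ ei)// mulr_ile1// exprn_ile1.
have T2 : `|4 * r * (ddsmax r * smax r ^- 2)| <= 4 * rho0 ^- 2 * eps^-1.
  rewrite ger0_norm; last by rewrite (mulr_ge0 (mulr_ge0 _ _) (mulr_ge0 _ _)).
  rewrite (_ : 4 * r * _ = (4 * smax r ^- 2) * (r * ddsmax r)); last by ring.
  apply: ler_pM; [exact: mulr_ge0|exact: mulr_ge0|by rewrite ler_pM2l|].
  by rewrite (le_trans _ u1)// ler_piMl.
have T3 : `|8 * (dsmax r * smax r ^- 2)| <= 8 * rho0 ^- 2 * eps^-1.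
  rewrite ger0_norm; last by rewrite (mulr_ge0 _ (mulr_ge0 _ _)).
  rewrite (_ : 8 * (_ * _) = (8 * smax r ^- 2) * dsmax r); last by ring.
  apply: ler_pM; [exact: mulr_ge0|by []|by rewrite ler_pM2l|].
  exact: le_trans s1 ei.
rewrite mulrBr mulrN.
rewrite (le_trans (ler_normB _ _))// (le_trans (lerD (ler_normB _ _) (lexx _)))//.
rewrite (le_trans (lerD (lerD T1 T2) T3))//.
by rewrite [leRHS]mulrDl; lra.
Qed.

(** The integrand is a radial divergence, whose antiderivative [Q] is [r^3] times the derivative of
    [hker (r^2)]. Near [r = 1] the kernel is [r^-2], so that [Q 1 = - 2]. *)
Lemma integral_lapker : eps <= 1 - rho0 ->
  (\int[leb]_(r in `[0%R, 1%R]) (r ^+ 3 * lapker (r ^+ 2))%:E = (- 2)%:E)%E.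
Proof.
move=> e1.
pose Q (r : R) := 2 * r ^+ 4 * dhker (r ^+ 2).
have dQ (r : R) : is_derive r (1 : R) Q (r ^+ 3 * lapker (r ^+ 2)).
  have d2 : is_derive r (1 : R) (fun r : R => r ^+ 2) (2 * r).
    by apply: is_derive_eq; rewrite /GRing.scale/=; ring.
  have d := @is_derive1_comp _ dhker (fun r => r ^+ 2) r _ _ (is_derive_dhker (r ^+ 2)) d2.
  apply: is_derive_eq.
  by rewrite /GRing.scale/= /lapker; ring.
have cQ : continuous Q.
  by move=> r; apply: differentiable_continuous; apply/derivable1_diffP; have [] := dQ r.
rewrite (@continuous_FTC2 _ _ Q) //.
- rewrite /Q !expr1n mulr1 expr0n mulr0 mul0r sube0 /dhker /dsmax.
  have [E1 E2 E3] := @ramp_step_hat_right _ ((1 - rho0) / eps) (ltac:(rewrite ler_pdivlMr//; lra)).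
  have -> : smax 1 = 1 by rewrite /smax E1 mulrC divfK ?gt_eqF// addrC subrK.
  by rewrite E2 expr1n invr1 !mulr1 mulrN1.
- apply: continuous_subspaceT => r.
  have c2 : {for r, continuous (fun r : R => r ^+ 2)} by exact: exprn_continuous.
  apply: cvgM; first exact: exprn_continuous.
  apply: cvgD.
    apply: cvgM; first by apply: cvgM; [exact: cvg_cst|exact: c2].
    by apply: (@cvg_comp _ _ _ (fun r => r ^+ 2) ddhker _ (nbhs (r ^+ 2)));
      [exact: c2|exact: continuous_ddhker].
  apply: cvgM; first exact: cvg_cst.
  apply: (@cvg_comp _ _ _ (fun r => r ^+ 2) dhker _ (nbhs (r ^+ 2))); first exact: c2.
  by apply: differentiable_continuous; apply/derivable1_diffP; have [] := is_derive_dhker (r ^+ 2).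
- split.
  + by move=> y _; have [] := dQ y.
  + apply: cvg_at_right_filter; exact: cQ.
  + apply: cvg_at_left_filter; exact: cQ.
- by move=> y _; rewrite derive1E; have [_] := dQ y.
Qed.

End Smoothing.

(** * Recovery of the profile at its Lebesgue points *)

Section SignedRadial.
Context {R : realType}.
Local Notation leb := (@lebesgue_measure R).
Local Notation leb4 := (leb \x leb \x leb \x leb)%E.
Local Notation l4 := (sf_product (sf_product (sf_product leb leb) leb) leb).
Local Notation R4 := (R * R * R * R)%type.

Lemma ge0_Rintegral_radial (f : R -> R) :
  measurable_fun [set: R] f -> (forall x, 0 <= f x) ->
  l4.-integrable setT (fun x => (f (enorm x))%:E) ->
  leb.-integrable `[0, +oo[ (fun r => (r ^+ 3 * f r)%:E) /\
  \int[l4]_x f (enorm x) = 2 * pi ^+ 2 * \int[leb]_(r in `[0, +oo[) (r ^+ 3 * f r).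
Proof.
move=> mf f0 /integrableP[_ If].
have mef : measurable_fun [set: R] (EFin \o f) by exact/measurable_EFinP.
have ef0 x : (0 <= (EFin \o f) x)%E by rewrite lee_fin.
have H := ge0_integral_radial mef ef0.
have C0 : 0 < 2 * pi ^+ 2 :> R by rewrite mulr_gt0// exprn_gt0// pi_gt0.
set I := (\int[leb]_(r in `[0%R, +oo[) ((r ^+ 3)%:E * (EFin \o f) r))%E in H.
have EI : I = (\int[leb]_(r in `[0%R, +oo[) (r ^+ 3 * f r)%:E)%E.
  by apply: eq_integral => r _; rewrite EFinM.
have I0 : (0 <= I)%E.
  apply: integral_ge0 => r /=; rewrite in_itv/= andbT => r0.
  by rewrite mule_ge0// lee_fin// exprn_ge0.
have If' : (\int[l4]_x (f (enorm x))%:E < +oo)%E.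
  move: If; congr (_ < _)%E; apply: eq_integral => x _.
  by rewrite gee0_abs// lee_fin.
have Ioo : (I < +oo)%E.
  have : ((2 * pi ^+ 2)%:E * I < +oo)%E by rewrite -H.
  apply: contraTT; rewrite -leNgt leye_eq => /eqP ->.
  by rewrite gt0_muley ?lte_fin// ltxx.
split.
  apply/integrableP; split.
    apply/measurable_EFinP; apply: measurable_funTS.
    by apply: measurable_funM => //; exact: measurable_funX.
  move: Ioo; rewrite EI; congr (_ < _)%E; apply: eq_integral => r.
  rewrite inE/= in_itv/= andbT => r0.
  by rewrite ger0_norm// mulr_ge0// exprn_ge0.
rewrite /Rintegral -EI -[in LHS]/(fine (\int[leb4]_x (EFin \o f) (enorm x)))%E H.
by rewrite fineM// ge0_fin_numE.
Qed.

Lemma Rintegral_radial (f : R -> R) :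
  measurable_fun [set: R] f ->
  l4.-integrable setT (fun x => (f (enorm x))%:E) ->
  leb.-integrable `[0, +oo[ (fun r => (r ^+ 3 * f r)%:E) /\
  \int[l4]_x f (enorm x) = 2 * pi ^+ 2 * \int[leb]_(r in `[0, +oo[) (r ^+ 3 * f r).
Proof.
move=> mf If.
pose fp (r : R) := Num.max (f r) 0; pose fn (r : R) := Num.max (- f r) 0.
have mfp : measurable_fun [set: R] fp by exact: measurable_maxr.
have mfn : measurable_fun [set: R] fn by apply: measurable_maxr => //; exact: measurableT_comp.
have fp0 r : 0 <= fp r by rewrite le_max lexx orbT.
have fn0 r : 0 <= fn r by rewrite le_max lexx orbT.
have fE r : f r = fp r - fn r.
  by rewrite /fp /fn; have [h|h] := leP (f r) 0;
    [rewrite max_l ?oppr_ge0// sub0r opprK|rewrite max_r ?subr0// oppr_le0 ltW].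
have Ip : l4.-integrable setT (fun x => (fp (enorm x))%:E).
  apply: (le_integrable _ _ _ If) => //.
    by apply/measurable_EFinP; exact: (measurableT_comp mfp measurable_enorm).
  move=> x _ /=; rewrite lee_fin (ger0_norm (fp0 _)) /fp ge_max normr_ge0 ler_norm//.
have In : l4.-integrable setT (fun x => (fn (enorm x))%:E).
  apply: (le_integrable _ _ _ If) => //.
    by apply/measurable_EFinP; exact: (measurableT_comp mfn measurable_enorm).
  move=> x _ /=; rewrite lee_fin (ger0_norm (fn0 _)) /fn ge_max normr_ge0.
  by rewrite -normrN ler_norm.
have [Jp Ep] := ge0_Rintegral_radial mfp fp0 Ip.
have [Jn En] := ge0_Rintegral_radial mfn fn0 In.
have EB : (fun r => (r ^+ 3 * f r)%:E) =
   ((fun r => (r ^+ 3 * fp r)%:E) \- (fun r => (r ^+ 3 * fn r)%:E))%E.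
  by apply/funext => r /=; rewrite -EFinB -mulrBr -fE.
split; first by rewrite EB; exact: integrableB.
transitivity (\int[l4]_x (fp (enorm x) - fn (enorm x))).
  by apply: eq_Rintegral => x _; rewrite fE.
rewrite RintegralB// Ep En -mulrBr -RintegralB//; congr (_ * _).
by apply: eq_Rintegral => r _; rewrite fE mulrBr.
Qed.

End SignedRadial.

Section LebesguePoint.
Context {R : realType}.
Local Notation leb := (@lebesgue_measure R).

(* [lapker r0^2 eps] concentrates at [r0] with [\int r^3 lapker (r^2) = - 2]. *)
Lemma lebesgue_pt_lapker (phi : R -> R) (r0 delta eta : R) :
  let w := (fun r => r ^+ 3 * phi r) \_ `[0, +oo[ in
  let rho0 := r0 ^+ 2 in let eps := delta * r0 in
  0 < r0 -> r0 < 1 -> 0 < delta -> eps <= 1 - rho0 -> 0 < eta -> delta <= eta ->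
  (forall r, 1 <= r -> phi r = 0) ->
  leb.-integrable setT (EFin \o w) ->
  (davg w r0 delta <= eta%:E)%E ->
  `|\int[leb]_(r in `[0, +oo[) (r ^+ 3 * (phi r * lapker rho0 eps (r ^+ 2)))
    + 2 * phi r0| <=
    eta * ((12 / rho0 ^+ 2 + 8 / rho0 ^+ 3) / r0 * 2 * (1 + 3 * `|phi r0|)).
Proof.
move=> w rho0 eps r00 r01 d0 e1 eta0 deta phi1 iw Hd.
have rho00 : 0 < rho0 by rewrite exprn_gt0.
have rho01 : rho0 < 1 by rewrite expr_lt1// ltW.
have eps0 : 0 < eps by rewrite mulr_gt0.
have eps1 : eps <= 1 by lra.
set C := 12 / rho0 ^+ 2 + 8 / rho0 ^+ 3.
have C0 : 0 <= C by rewrite addr_ge0// divr_ge0// exprn_ge0// ltW.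
pose kap (r : R) := lapker rho0 eps (r ^+ 2).
have ck : continuous kap.
  have dl := is_derive_continuous (is_derive_dhker rho00 eps0).
  move=> r; apply: (@cvg_comp _ _ _ (fun r => r ^+ 2) (lapker rho0 eps) _ (nbhs (r ^+ 2))).
    exact: exprn_continuous.
  apply: cvgD; last by apply: cvgM; [exact: cvg_cst|exact: dl].
  apply: cvgM; last exact: continuous_ddhker.
  by apply: cvgM; [exact: cvg_cst|exact: cvg_id].
have mk : measurable_fun [set: R] kap by exact: continuous_measurable_fun.
have mw : measurable_fun [set: R] w.
  by have /integrableP[/measurable_EFinP] := iw.
have kb (r : R) : 0 <= r <= 1 -> `|kap r| <= C / eps.
  move=> /andP[h0 h1]; apply: lapker_bound => //.
  by rewrite sqr_ge0 exprn_ile1.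
(* The choice [eps = delta * r0] is made for this: [|r^2 - r0^2| = |r - r0| * (r + r0) >= delta *
   r0] off the ball. *)
have kout (r : R) : 0 <= r -> ~ ball r0 delta r -> kap r = 0.
  rewrite -ball_normE /= => h0 /negP; rewrite -leNgt => h.
  apply: lapker_out => //.
  have -> : r ^+ 2 - rho0 = (r - r0) * (r + r0) by rewrite /rho0; ring.
  rewrite normrM /eps; apply: ler_pM; [exact: ltW|exact: ltW|by rewrite distrC|].
  by rewrite ger0_norm; lra.
(* A comparison function equal to [w] at [r0]; with the factor [r^3] instead of [r0^3], its integral
   against [kap] is exactly [- 2 * phi r0]. *)
pose p (r : R) := phi r0 * r ^+ 3.
have w0 : w r0 = p r0.
  rewrite /w patchE mem_set; first by rewrite /p mulrC.
  by rewrite /= in_itv/= (ltW r00).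
pose I01 : set R := `[0, 1]%classic.
have mI01 : measurable (I01 : set (measurableTypeR R)) by exact: measurable_itv.
have wE r : I01 r -> w r = r ^+ 3 * phi r.
  rewrite /I01/= in_itv/= => /andP[h0 h1]; rewrite /w patchE mem_set//=.
  by rewrite in_itv/= h0.
have iwI : leb.-integrable I01 (fun r => (w r)%:E).
  by apply: (integrableS _ _ _ iw) => //; exact: measurable_itv.
have kbI : [bounded kap r | r in I01].
  exists (C / eps); split; first exact: num_real.
  move=> x Mx y Iy.
  have hy : 0 <= y <= 1 by move: Iy; rewrite /I01/= in_itv.
  exact: le_trans (kb y hy) (ltW Mx).
have fI : (leb I01 < +oo)%E by rewrite lebesgue_measure_itv/= lte_fin ltr01 ltry.
have iwk : leb.-integrable I01 (fun r => (w r * kap r)%:E).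
  have := integrableMl mI01 iwI (measurable_funTS mk) kbI.
  by congr (leb.-integrable _ _); apply/funext => r /=; rewrite EFinM.
have mp : measurable_fun [set: R] p.
  by apply: measurable_funM => //; exact: measurable_funX.
have ipk : leb.-integrable I01 (fun r => (p r * kap r)%:E).
  apply: continuous_compact_integrable; first exact: segment_compact.
  apply: continuous_subspaceT => r; apply: cvgM; last exact: ck.
  by apply: cvgM; [exact: cvg_cst|exact: exprn_continuous].
have E1 : \int[leb]_(r in `[0, +oo[) (r ^+ 3 * (phi r * kap r)) =
    \int[leb]_(r in I01) (w r * kap r).
  rewrite [LHS]Rintegral_mkcond [RHS]Rintegral_mkcond.
  apply: eq_Rintegral => r _; rewrite !patchE.
  have [r0'|r0'] := ltP r 0.
    rewrite memNset; last by rewrite /= in_itv/= leNgt r0'.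
    by rewrite memNset// /I01/= in_itv/= leNgt r0'.
  rewrite mem_set; last by rewrite /= in_itv/= r0'.
  have [r1|r1] := leP r 1.
    have Ir : I01 r by rewrite /I01/= in_itv/= r0' r1.
    by rewrite mem_set// wE// mulrA.
  by rewrite memNset ?(phi1 _ (ltW r1)) ?(mul0r, mulr0)// /I01/= in_itv/= r0' leNgt r1.
have E2 : \int[leb]_(r in I01) (p r * kap r) = - 2 * phi r0.
  have := integral_lapker rho00 eps0 e1 => E.
  transitivity (phi r0 * \int[leb]_(r in I01) (r ^+ 3 * kap r)).
    rewrite -RintegralZl//.
      by apply: eq_Rintegral => r _; rewrite /p mulrA.
    apply: continuous_compact_integrable; first exact: segment_compact.
    apply: continuous_subspaceT => r; apply: cvgM; last exact: ck.
    exact: exprn_continuous.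
  by rewrite {1}/Rintegral [X in fine X]E/= mulrC.
rewrite E1 (_ : 2 * phi r0 = - (- 2 * phi r0)); last by ring.
rewrite -E2 -RintegralB//.
set D := ball r0 delta.
pose b := C / eps.
(* A bound for [|p r - p r0|] on the ball: [r^3 - r0^3] is [r - r0] times a sum of three terms in
   [[0, 1]]. *)
pose c := 3 * `|phi r0| * delta.
have b0 : 0 <= b by rewrite divr_ge0// ltW.
have c0 : 0 <= c by rewrite !mulr_ge0// ltW.
have mD : measurable (D : set (measurableTypeR R)) by exact: measurable_ball.
have lD : leb D = (2 * delta)%:E.
  by rewrite lebesgue_measure_ball ?ltW// mulr_natl.
have mwc : measurable_fun [set: R] (fun r => `|w r - w r0|).
  apply: measurableT_comp; first exact: normr_measurable.
  exact: measurable_funB.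
have Hb : (\int[leb]_(r in D) `|(w r - w r0)%:E| <= (2 * delta * eta)%:E)%E.
  move: Hd; rewrite /davg /iavg/= -/D lD.
  rewrite inver gt_eqF ?mulr_gt0//= lee_pdivrMl ?mulr_gt0//.
have iwp : leb.-integrable I01 (fun r => (w r * kap r - p r * kap r)%:E).
  have := integrableB mI01 iwk ipk.
  by congr (leb.-integrable _ _); apply/funext => r /=; rewrite EFinB.
rewrite -lee_fin EFin_normr_Rintegral//.
rewrite (le_trans (le_abse_integral _ _ _))//; first by have /integrableP[] := iwp.
pose B (r : R) := (b%:E * (`|(w r - w r0)%:E| + c%:E))%E.
have mB : measurable_fun D B.
  apply: measurable_funTS; apply: emeasurable_funM => //.
  by apply: emeasurable_funD => //; exact/measurable_EFinP.
have B0 r : (0 <= B r)%E by rewrite lee_fin mulr_ge0// addr_ge0.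
apply: (@le_trans _ _ (\int[leb]_(r in D) B r)%E).
  rewrite [leLHS]integral_mkcond [leRHS]integral_mkcond.
  apply: ge0_le_integral => //.
  - by move=> r _; apply: erestrict_ge0.
  - apply/(measurable_restrictT _ _).1 => //.
    by apply: measurableT_comp => //; have /integrableP[] := iwp.
  - by apply/(measurable_restrictT _ _).1.
  move=> r _; rewrite /patch; case: ifPn => [/set_mem Ir|_]; last by case: ifP.
  have hr : 0 <= r <= 1 by move: Ir; rewrite /I01/= in_itv.
  have /andP[h0 h1] := hr.
  case: ifPn => [/set_mem Dr|/negP Dr]; last first.
    by rewrite kout ?mulr0 ?subrr ?abse0// => Dr'; apply: Dr; rewrite inE.
  rewrite /B -mulrBl /= -EFinD -EFinM lee_fin normrM mulrC.
  apply: ler_pM => //; first exact: kb.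
  have -> : w r - p r = (w r - w r0) + phi r0 * (r0 ^+ 3 - r ^+ 3).
    by rewrite w0 /p; ring.
  rewrite (le_trans (ler_normD _ _))// lerD2l normrM /c mulrAC mulrC ler_wpM2r//.
  have -> : r0 ^+ 3 - r ^+ 3 = (r0 - r) * (r0 ^+ 2 + r0 * r + r ^+ 2) by ring.
  rewrite normrM mulrC ler_pM//.
    rewrite ger0_norm; last by rewrite !addr_ge0 ?mulr_ge0 ?sqr_ge0// ltW.
    by nra.
  by move: Dr; rewrite /D -ball_normE => /ltW.
rewrite /B ge0_integralZl//; last 2 first.
- by apply: emeasurable_funD => //; apply/measurable_EFinP; exact: measurable_funTS.
- by move=> r _; rewrite lee_fin addr_ge0.
rewrite ge0_integralD//; last first.
  by apply/measurable_EFinP; exact: measurable_funTS.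
have Ic : (\int[leb]_(r in D) c%:E = c%:E * (2 * delta)%:E)%E.
  rewrite -lD; exact: integral_cst.
rewrite Ic.
apply: (@le_trans _ _ (b%:E * ((2 * delta * eta)%:E + c%:E * (2 * delta)%:E))%E).
  by apply: lee_wpmul2l; [rewrite lee_fin|exact: leeD2r].
rewrite -!EFinM lee_fin.
(* The height [b] contains [1 / (delta * r0)], which cancels the length [2 * delta] of the ball. *)
have -> : b * (2 * delta * eta + c * (2 * delta)) =
    (C / r0 * 2) * (eta + 3 * `|phi r0| * delta).
  by rewrite /b /c /eps; field; rewrite !gt_eqF.
have -> : eta * (C / r0 * 2 * (1 + 3 * `|phi r0|)) =
    (C / r0 * 2) * (eta + 3 * `|phi r0| * eta) by ring.
apply: ler_wpM2l; first by rewrite mulr_ge0// divr_ge0// ltW.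
by rewrite lerD2l ler_wpM2l// mulr_ge0.
Qed.

End LebesguePoint.

Section Representation.
Context {R : realType}.
Local Notation leb := (@lebesgue_measure R).
Local Notation leb4 := (leb \x leb \x leb \x leb)%E.
Local Notation l4 := (sf_product (sf_product (sf_product leb leb) leb) leb).
Local Notation R4 := (R * R * R * R)%type.

(* [(4 * pi ^+ 2)^-1 * max(r^2, |x|^2)^-1] is the mean over the sphere of radius
   [r] of the fundamental solution of the Laplacian in R^4 centered at [x]. *)
Definition green_potential (f : R4 -> R) (r : R) : R :=
  - (4 * pi ^+ 2)^-1 * \int[l4]_x ((f \_ B) x * (Num.max (r ^+ 2) (sqn x))^-1).

Lemma measurable_sqn : measurable_fun setT (@sqn R).
Proof. by apply: continuous_measurable_fun4; exact: continuous_sqn. Qed.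

Lemma sqint_cstB (c : R) : sqint l4 ((fun=> c) \_ B).
Proof. exact: (@bounded_patch_sqint _ _ `|c|). Qed.

Lemma sqint_integrable (f : R4 -> R) : sqint l4 (f \_ B) ->
  l4.-integrable setT (fun x => ((f \_ B) x)%:E).
Proof.
move=> sf; have := sqint_mul sf (sqint_cstB 1).
congr (l4.-integrable _ _); apply/funext => x; congr EFin.
have [Bx|Bx] := pselect (B x); first by rewrite !patchB_eq// mulr1.
by rewrite !patchB_out// mul0r.
Qed.

Lemma patchB_mul (f g : R4 -> R) x : (f \_ B) x * g x = (f \_ B) x * (g \_ B) x.
Proof.
have [Bx|Bx] := pselect (B x); first by rewrite !patchB_eq.
by rewrite patchB_out// !mul0r.
Qed.

Lemma sqint_maxV (c : R) : 0 < c -> sqint l4 ((fun x => (Num.max c (sqn x))^-1) \_ B).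
Proof.
move=> c0; apply: (@bounded_patch_sqint _ _ c^-1).
  apply: measurable_funTS; apply: (measurableT_comp measurable_invr).
  by apply: measurable_maxr => //; exact: measurable_sqn.
move=> x _; have h : c <= Num.max c (sqn x) by rewrite le_max lexx.
have h' := lt_le_trans c0 h.
by rewrite ger0_norm ?invr_ge0 ?(ltW h')// lef_pV2.
Qed.

Lemma integral_hker_close (f : R4 -> R) (rho0 eps : R) : 0 < rho0 -> 0 < eps ->
  sqint l4 (f \_ B) ->
  `|\int[l4]_x ((f \_ B) x * hker rho0 eps (sqn x)) -
    \int[l4]_x ((f \_ B) x * (Num.max rho0 (sqn x))^-1)| <=
  eps / rho0 ^+ 2 * \int[l4]_x `|(f \_ B) x|.
Proof.
move=> r0 e0 sf.
have iF := sqint_integrable sf.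
have ch := is_derive_continuous (is_derive_hker r0 e0).
have i1 : l4.-integrable setT (fun x => ((f \_ B) x * hker rho0 eps (sqn x))%:E).
  have := sqint_mul sf (radial_patch_sqint ch).
  by congr (l4.-integrable _ _); apply/funext => x; rewrite -patchB_mul.
have i2 : l4.-integrable setT (fun x => ((f \_ B) x * (Num.max rho0 (sqn x))^-1)%:E).
  have := sqint_mul sf (sqint_maxV r0).
  by congr (l4.-integrable _ _); apply/funext => x; rewrite -patchB_mul.
have iN : l4.-integrable setT (fun x => (`|(f \_ B) x|)%:E).
  exact: (integrable_norm iF).
rewrite -RintegralB// -RintegralZl//.
have iB : l4.-integrable setT (fun x => ((f \_ B) x * hker rho0 eps (sqn x) -
    (f \_ B) x * (Num.max rho0 (sqn x))^-1)%:E).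
  have := integrableB measurableT i1 i2.
  by congr (l4.-integrable _ _); apply/funext => x; rewrite EFinB.
rewrite (le_trans (le_normr_Rintegral _ _))//.
apply: le_Rintegral => //.
- exact: (integrable_norm iB).
- exact: integrableZl_EFin.
move=> x _; rewrite -mulrBr normrM mulrC ler_wpM2r//.
exact: hker_close.
Qed.

(** Apply Green's identity to [hker] with [rho0 = r0^2] and let [eps] tend to 0. One side tends to
    the pairing of the Laplacian with [max(r0^2, |x|^2)^-1]; at a Lebesgue point the other tends to
    [2 pi^2 * (- 2 phi r0)], whence the constant [4 pi^2]. *)
Lemma H20rad_representation (u : R4 -> R) (Du : seq 'I_4 -> R4 -> R) :
  H20rad u Du -> L2norm (laplacian Du) = 1%E ->
  {ae leb4, forall x, B x -> u x = green_potential (laplacian Du) (enorm x)}.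
Proof.
move=> [Hu radu] N1.
have mu : measurable_fun (@B R) u.
  by have [[<- H] _] := Hu; have [] := (H [::] isT).1.
have su : sqint l4 (u \_ B).
  by have [[<- H] _] := Hu; have [[m n] _] := (H [::] isT); exact: L2_sqint.
have [sf _] := L2norm_eq1 (measurable_laplacian Hu) N1.
set f := laplacian Du in sf N1 *.
have [g [mg ug]] := radial_profile mu radu.
(* Cutting the profile at 1 makes [phi (enorm x)] equal to the extension of [u] by 0 almost
   everywhere on R^4. *)
pose phi (r : R) := g r * \1_`]-oo, 1[ r.
have mphi : measurable_fun [set: R] phi.
  by apply: measurable_funM => //; exact: measurable_indic.
have phi1 r : 1 <= r -> phi r = 0.
  by move=> r1; rewrite /phi indicE memNset ?mulr0//= in_itv/= ltNge r1.
have phiE r : r < 1 -> phi r = g r.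
  by move=> r1; rewrite /phi indicE mem_set ?mulr1//= in_itv/=.
have uphi : {ae leb4, forall x, (u \_ B) x = phi (enorm x)}.
  near=> x; have [Bx|Bx] := pselect (B x).
    rewrite patchB_eq// phiE//; move: Bx; near: x; exact: ug.
  by rewrite patchB_out// phi1// leNgt; apply/negP.
have mphiE : measurable_fun setT (fun x => phi (enorm x)).
  exact: (measurableT_comp mphi measurable_enorm).
have mub := measurable_patchB mu.
have ae_int (k : R -> R) : continuous k ->
    l4.-integrable setT (fun x => (phi (enorm x) * k (enorm x ^+ 2))%:E) /\
    \int[l4]_x ((u \_ B) x * k (sqn x)) = \int[l4]_x (phi (enorm x) * k (enorm x ^+ 2)).
  move=> ck.
  have i1 : l4.-integrable setT (fun x => ((u \_ B) x * k (sqn x))%:E).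
    have := sqint_mul su (radial_patch_sqint ck).
    by congr (l4.-integrable _ _); apply/funext => x; rewrite -patchB_mul.
  have m1 : measurable_fun setT (fun x => ((u \_ B) x * k (sqn x))%:E).
    by have /integrableP[] := i1.
  have m2 : measurable_fun setT (fun x : R4 => (phi (enorm x) * k (enorm x ^+ 2))%:E).
    apply/measurable_EFinP; apply: measurable_funM => //.
    apply: (measurableT_comp (continuous_measurable_fun ck)).
    by apply: measurable_funX; exact: measurable_enorm.
  have E : ae_eq l4 setT (fun x => ((u \_ B) x * k (sqn x))%:E)
     (fun x : R4 => (phi (enorm x) * k (enorm x ^+ 2))%:E).
    move: uphi; apply: (@filterS _ _ (ae_filter_ringOfSetsType l4)) => x ux _.
    by rewrite ux sqr_enorm.
  split; last first.
    by rewrite /Rintegral; congr fine; apply: ae_eq_integral.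
  apply/integrableP; split => //.
  have /integrableP[_] := i1; congr (_ < _)%E.
  apply: ae_eq_integral => //; [exact: measurableT_comp|exact: measurableT_comp|].
  exact: ae_eq_abse.
have iphi : l4.-integrable setT (fun x => (phi (enorm x))%:E).
  have [+ _] := ae_int _ (@cst_continuous R R 1).
  by congr (l4.-integrable _ _); apply/funext => x; rewrite mulr1.
have [iw _] := Rintegral_radial mphi iphi.
pose w := (fun r => r ^+ 3 * phi r) \_ `[0, +oo[.
have {}iw : leb.-integrable setT (EFin \o w).
  have := iw; move/(integrable_mkcond _ _).1 => /(_ (measurable_itv _)).
  by congr (leb.-integrable _ _); apply/funext => r; rewrite /w /= !patchE; case: ifP.
have lw : locally_integrable setT w by apply: open_integrable_locally => //; exact: openT.
have key r0 : 0 < r0 -> r0 < 1 -> lebesgue_pt w r0 -> phi r0 = green_potential f r0.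
  move=> r00 r01 Lw.
  have rho00 : 0 < r0 ^+ 2 by rewrite exprn_gt0.
  have rho01 : r0 ^+ 2 < 1 by rewrite expr_lt1// ltW.
  have pi0 : 0 < pi ^+ 2 :> R by rewrite exprn_gt0// pi_gt0.
  pose A := \int[l4]_x `|(f \_ B) x|.
  pose I := \int[l4]_x ((f \_ B) x * (Num.max (r0 ^+ 2) (sqn x))^-1).
  (* The first summand is the cost of replacing the maximum by [hker] with [eps = d * r0], the
     second the error at the Lebesgue point; both errors are proportional to [eta]. *)
  pose K := r0 / (r0 ^+ 2) ^+ 2 * A + 2 * pi ^+ 2 *
    ((12 / (r0 ^+ 2) ^+ 2 + 8 / (r0 ^+ 2) ^+ 3) / r0 * 2 * (1 + 3 * `|phi r0|)).
  have A0 : 0 <= A by apply: Rintegral_ge0.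
  have K0 : 0 <= K.
    rewrite /K addr_ge0// mulr_ge0//; first by rewrite divr_ge0 ?exprn_ge0// ltW.
      by rewrite mulr_ge0// ltW.
    rewrite mulr_ge0 ?addr_ge0// mulr_ge0// divr_ge0 ?(ltW r00)// addr_ge0//.
      by rewrite divr_ge0// exprn_ge0// ltW.
    by rewrite divr_ge0// exprn_ge0// ltW.
  have H eta : 0 < eta -> `|I + 4 * pi ^+ 2 * phi r0| <= eta * K.
    move=> eta0.
    have nb : nbhs (0%E : \bar R) [set x | (x < eta%:E)%E].
      by apply: open_nbhs_nbhs; split; [exact: open_ereal_lt_ereal|rewrite /= lte_fin].
    have LwN : \forall d \near (0 : R)^'+, (davg w r0 d < eta%:E)%E by exact: (Lw _ nb).
    near (0 : R)^'+ => d.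
    have d0 : 0 < d by near: d; exact: nbhs_right_gt.
    have de : d <= eta by near: d; exact: nbhs_right_le.
    have d1 : d <= (1 - r0 ^+ 2) / r0.
      by near: d; apply: nbhs_right_le; rewrite divr_gt0// subr_gt0.
    have Hd : (davg w r0 d <= eta%:E)%E by apply: ltW; near: d; exact: LwN.
    pose eps := d * r0.
    have eps0 : 0 < eps by rewrite mulr_gt0.
    have e1 : eps <= 1 - r0 ^+ 2 by rewrite -ler_pdivlMr.
    have P := lebesgue_pt_lapker r00 r01 d0 e1 eta0 de phi1 iw Hd.
    have Q := integral_hker_close rho00 eps0 sf.
    have G := green_H20 Hu (is_derive_hker rho00 eps0) (is_derive_dhker rho00 eps0)
      (continuous_ddhker rho00 eps0).
    have clap : continuous (lapker (r0 ^+ 2) eps).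
      have dl := is_derive_continuous (is_derive_dhker rho00 eps0).
      move=> r; apply: cvgD; last by apply: cvgM; [exact: cvg_cst|exact: dl].
      apply: cvgM; last exact: continuous_ddhker.
      by apply: cvgM; [exact: cvg_cst|exact: cvg_id].
    have [i3 E3] := ae_int _ clap.
    have mf3 : measurable_fun [set: R] (fun r => phi r * lapker (r0 ^+ 2) eps (r ^+ 2)).
      apply: measurable_funM => //.
      apply: (measurableT_comp (continuous_measurable_fun clap)).
      exact: measurable_funX.
    have [_ E4] := Rintegral_radial mf3 i3.
    have E5 : \int[l4]_x ((f \_ B) x * hker (r0 ^+ 2) eps (sqn x)) = 2 * pi ^+ 2 *
       \int[leb]_(r in `[0, +oo[) (r ^+ 3 * (phi r * lapker (r0 ^+ 2) eps (r ^+ 2))).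
      by rewrite -E4 -E3; exact: G.
    set J := \int[leb]_(r in `[0, +oo[) (r ^+ 3 * _) in P E5.
    rewrite E5 -/A -/I in Q.
    have -> : I + 4 * pi ^+ 2 * phi r0 =
      - (2 * pi ^+ 2 * J - I) + 2 * pi ^+ 2 * (J + 2 * phi r0) by ring.
    rewrite (le_trans (ler_normD _ _))// normrN /K [eta * _]mulrDr; apply: lerD.
      rewrite (le_trans Q)// /eps mulrA ler_wpM2r// mulrA ler_wpM2r//.
        by rewrite invr_ge0 exprn_ge0// ltW.
      by rewrite ler_wpM2r// ltW.
    have p0 : 0 <= 2 * pi ^+ 2 :> R by rewrite mulr_ge0// ltW.
    by rewrite normrM (ger0_norm p0) [leRHS]mulrCA ler_wpM2l.
  have : I + 4 * pi ^+ 2 * phi r0 = 0.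
    apply/eqP; rewrite -normr_le0; apply/ler_addgt0Pl => e e0.
    rewrite addr0; have := H (e / (K + 1)) (divr_gt0 e0 (ltr_wpDl K0 ltr01)).
    move/le_trans; apply; rewrite mulrAC ler_pdivrMr ?ltr_wpDl//.
    by rewrite ler_pM2l// lerDl.
  rewrite /green_potential -/I => /eqP; rewrite addr_eq0 => /eqP ->.
  by rewrite mulrN mulNr opprK mulKf// gt_eqF// mulr_gt0.
have [N [mN N0 subN]] := lebesgue_differentiation lw.
have ae0 := ae_radial mN N0.
have ae1 := ae_radial (measurable_set1 0) (lebesgue_measure_set1 (0 : R)).
near=> x => Bx.
have x0 : 0 < enorm x.
  rewrite lt_neqAle sqrtr_ge0 andbT eq_sym; apply/eqP => e0.
  by have : ~ [set 0] (enorm x) by near: x.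
have -> : u x = phi (enorm x).
  by rewrite -(patchB_eq u Bx); near: x.
apply: key => //.
have nN : ~ N (enorm x) by near: x.
by apply: contrapT => nl; apply: nN; exact: subN.
Unshelve. all: by end_near. Qed.

End Representation.

(** * The upper bound *)

Section FTCpieces.
Context {R : realType}.
Local Notation leb := (@lebesgue_measure R).

(** The degenerate case [x = y] is included because it is applied on [[b, a]] with [b <= a] only. *)
Lemma Rintegral_FTC (f F : R -> R) (x y : R) : x <= y -> continuous f ->
  {in `[x, y], forall r, {for r, continuous F}} ->
  (forall r, x < r -> r < y -> is_derive r (1 : R) F (f r)) ->
  \int[leb]_(r in `[x, y]) f r = F y - F x.
Proof.
rewrite le_eqVlt => /predU1P[->|xy] cf cF dF.
  by rewrite set_itv1 Rintegral_set1 subrr.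
rewrite /Rintegral (@continuous_FTC2 _ f F)//.
- exact: continuous_subspaceT.
- split.
  + by move=> r; rewrite in_itv/= => /andP[h1 h2]; have [] := dF r h1 h2.
  + by apply: cvg_at_right_filter; apply: cF; rewrite in_itv/= lexx ltW.
  + by apply: cvg_at_left_filter; apply: cF; rewrite in_itv/= lexx ltW.
- by move=> r; rewrite in_itv/= => /andP[h1 h2]; rewrite derive1E; have [_] := dF r h1 h2.
Qed.

Lemma Rintegral_split (f : R -> R) (x y z : R) : x <= y -> y <= z -> continuous f ->
  \int[leb]_(r in `[x, z]) f r =
  \int[leb]_(r in `[x, y]) f r + \int[leb]_(r in `[y, z]) f r.
Proof.
move=> xy yz cf.
have If (u v : R) : leb.-integrable `[u, v] (EFin \o f).
  apply: continuous_compact_integrable; first exact: segment_compact.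
  exact: continuous_subspaceT.
have := @Rintegral_itvB R f (BLeft x) (BRight z) y (If x z).
rewrite !bnd_simp => /(_ xy yz) H.
rewrite -(@Rintegral_itv_obnd_cbnd R y (BRight z) f).
  by rewrite -H; ring.
apply: (integrableS _ _ _ (If y z)) => //.
by move=> r /=; rewrite !in_itv/= => /andP[/ltW -> ->].
Qed.

End FTCpieces.

Section FormBound.
Context {R : realType}.
Local Notation leb := (@lebesgue_measure R).

(* The constant [k] is free, since it is integrated against a function of mean 0;
   this value leaves as a remainder the nonnegative [S] of the proof. *)
Lemma green_kernel_form (p q a b k : R) : 0 < b -> b <= a -> a < 1 ->
  k = p * (2 - a ^+ 2) + q * (2 - b ^+ 2) ->
  \int[leb]_(r in `[0, 1]) (r ^+ 3 *
    (p * (Num.max (a ^+ 2) (r ^+ 2))^-1 + q * (Num.max (b ^+ 2) (r ^+ 2))^-1 - k) ^+ 2)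
  <= p ^+ 2 * - ln a + 2 * p * q * - ln a + q ^+ 2 * - ln b.
Proof.
move=> b0 ba a1 kE.
have a0 : 0 < a by exact: lt_le_trans ba.
pose z (r : R) := p * (Num.max (a ^+ 2) (r ^+ 2))^-1 +
  q * (Num.max (b ^+ 2) (r ^+ 2))^-1 - k.
pose f (r : R) := r ^+ 3 * (z r * z r).
have cm (c : R) : 0 < c -> continuous (fun r : R => (Num.max (c ^+ 2) (r ^+ 2))^-1).
  move=> c0 r; apply: cvgV.
    by rewrite gt_eqF// lt_max exprn_gt0.
  have cM (d : R) : continuous (Num.max d : R -> R).
    rewrite (_ : Num.max d = (fun x => (d + x + `|d - x|) * 2^-1)); last first.
      by apply/funext => x; rewrite maxr_absE.
    move=> x; apply: cvgM; last exact: cvg_cst.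
    apply: cvgD; first by apply: cvgD; [exact: cvg_cst|exact: cvg_id].
    by apply: cvg_norm; apply: cvgB; [exact: cvg_cst|exact: cvg_id].
  exact: (continuous_comp (@exprn_continuous _ 2 r) (cM _ _)).
have cz : continuous z.
  move=> r; apply: cvgB; last exact: cvg_cst.
  by apply: cvgD; apply: cvgM; [exact: cvg_cst|exact: cm|exact: cvg_cst|exact: cm].
have cf : continuous f.
  by move=> r; apply: cvgM; [exact: exprn_continuous|apply: cvgM; exact: cz].
have sq (x y : R) : 0 <= x -> 0 <= y -> (x ^+ 2 <= y ^+ 2) = (x <= y).
  by move=> x0 y0; rewrite ler_pXn2r.
pose c1 := p / a ^+ 2 + q / b ^+ 2 - k.
pose c2 := p / a ^+ 2 - k.
(* On [[0, b]], [[b, a]] and [[a, 1]] the two maxima are explicit, and the kernel is [c1],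
   [c2 + q / r^2] and [(p + q) / r^2 - k] respectively; these are the antiderivatives. *)
pose F1 (r : R) := c1 ^+ 2 / 4 * r ^+ 4.
pose F2 (r : R) := c2 ^+ 2 / 4 * r ^+ 4 + c2 * q * r ^+ 2 + q ^+ 2 * ln r.
pose F3 (r : R) := k ^+ 2 / 4 * r ^+ 4 - (p + q) * k * r ^+ 2 + (p + q) ^+ 2 * ln r.
have d4 (r : R) : is_derive r (1 : R) (fun r : R => r ^+ 4) (4 * r ^+ 3).
  by apply: is_derive_eq; rewrite /GRing.scale/=; ring.
have d2 (r : R) : is_derive r (1 : R) (fun r : R => r ^+ 2) (2 * r).
  by apply: is_derive_eq; rewrite /GRing.scale/=; ring.
have E1 : \int[leb]_(r in `[0, b]) f r = F1 b - F1 0.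
  apply: (Rintegral_FTC (ltW b0) cf).
    move=> r _; apply: differentiable_continuous; apply/derivable1_diffP.
    by have : is_derive r (1 : R) F1 (c1 ^+ 2 / 4 *: (4 * r ^+ 3)) by exact: is_deriveZ.
  move=> r r0 rb.
  have h1 : r ^+ 2 <= b ^+ 2 by rewrite sq// ltW.
  have h2 : r ^+ 2 <= a ^+ 2 by rewrite sq ?(ltW r0) ?(ltW a0)// (le_trans (ltW rb)).
  rewrite (_ : f r = c1 ^+ 2 / 4 *: (4 * r ^+ 3)); first exact: is_deriveZ.
  by rewrite /f /z !max_l// /c1 /GRing.scale/=; field; rewrite !gt_eqF.
have E2 : \int[leb]_(r in `[b, a]) f r = F2 a - F2 b.
  have dF2 (r : R) : 0 < r -> is_derive r (1 : R) F2 (r ^+ 3 * ((c2 + q / r ^+ 2) * (c2 + q / r ^+ 2))).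
    move=> r0; have dl := is_derive1_ln r0.
    apply: is_derive_eq; rewrite /GRing.scale/=; field.
    by rewrite gt_eqF.
  apply: (Rintegral_FTC ba cf).
    move=> r; rewrite in_itv/= => /andP[br _].
    apply: differentiable_continuous; apply/derivable1_diffP.
    by have [] := dF2 r (lt_le_trans b0 br).
  move=> r br ra; have r0 := lt_trans b0 br.
  have h1 : b ^+ 2 <= r ^+ 2 by rewrite sq// ltW.
  have h2 : r ^+ 2 <= a ^+ 2 by rewrite sq ?(ltW r0) ?(ltW a0)// ltW.
  rewrite /f /z (max_l h2) (max_r h1).
  rewrite (_ : p / a ^+ 2 + q / r ^+ 2 - k = c2 + q / r ^+ 2); first exact (dF2 r r0).
  by rewrite /c2; ring.
have E3 : \int[leb]_(r in `[a, 1]) f r = F3 1 - F3 a.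
  have dF3 (r : R) : 0 < r -> is_derive r (1 : R) F3
      (r ^+ 3 * (((p + q) / r ^+ 2 - k) * ((p + q) / r ^+ 2 - k))).
    move=> r0; have dl := is_derive1_ln r0.
    apply: is_derive_eq; rewrite /GRing.scale/=; field.
    by rewrite gt_eqF.
  apply: (Rintegral_FTC (ltW a1) cf).
    move=> r; rewrite in_itv/= => /andP[br _].
    apply: differentiable_continuous; apply/derivable1_diffP.
    by have [] := dF3 r (lt_le_trans a0 br).
  move=> r br ra; have r0 := lt_trans a0 br.
  have h2 : a ^+ 2 <= r ^+ 2 by rewrite sq ?(ltW r0) ?(ltW a0)// ltW.
  have h1 : b ^+ 2 <= r ^+ 2 by rewrite (le_trans _ h2)// sq// ltW.
  rewrite /f /z (max_r h2) (max_r h1).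
  rewrite (_ : p / r ^+ 2 + q / r ^+ 2 - k = (p + q) / r ^+ 2 - k); first exact (dF3 r r0).
  by ring.
have -> : \int[leb]_(r in `[0, 1]) (r ^+ 3 *
    (p * (Num.max (a ^+ 2) (r ^+ 2))^-1 + q * (Num.max (b ^+ 2) (r ^+ 2))^-1 - k) ^+ 2)
   = \int[leb]_(r in `[0, 1]) f r.
  by apply: eq_Rintegral => r _; rewrite /f /z expr2.
rewrite (Rintegral_split (y := a))//; [|exact: ltW|exact: ltW].
rewrite (Rintegral_split (x := 0) (y := b))//; last exact: ltW.
rewrite E1 E2 E3 /F1 /F2 /F3 ln1 expr0n/= mulr0 subr0 !expr1n mulr0 addr0.
move: (ln a) (ln b) => la lb.
pose S := (p * (1 - a ^+ 2) + q * (1 - b ^+ 2)) ^+ 2 / 2 +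
  ((1 - a ^+ 4) * (p + q * (b ^+ 2 / a ^+ 2)) ^+ 2 +
   q ^+ 2 * (1 - (b ^+ 2 / a ^+ 2) ^+ 2)) / 4.
have S0 : 0 <= S.
  have h1 : 0 <= 1 - a ^+ 4 by rewrite subr_ge0 exprn_ile1// ltW.
  have h2 : 0 <= 1 - (b ^+ 2 / a ^+ 2) ^+ 2.
    have h0 : 0 <= b ^+ 2 / a ^+ 2 by rewrite divr_ge0 ?sqr_ge0.
    rewrite subr_ge0 (exprn_ile1 _ h0)// ler_pdivrMr ?exprn_gt0// mul1r sq//; exact: ltW.
  by rewrite addr_ge0 ?divr_ge0 ?sqr_ge0// addr_ge0// mulr_ge0 ?sqr_ge0.
rewrite -subr_ge0; apply: le_trans S0 _; rewrite le_eqVlt; apply/orP; left; apply/eqP.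
by rewrite /S /c1 /c2 kE; field; rewrite !gt_eqF.
Qed.

End FormBound.

Section Form.
Context {R : realType}.
Local Notation leb := (@lebesgue_measure R).
Local Notation l4 := (sf_product (sf_product (sf_product leb leb) leb) leb).
Local Notation R4 := (R * R * R * R)%type.

(** Green's identity against the constant 1. It is the trace left by the vanishing normal
    derivative. *)
Lemma integral_laplacian_eq0 (u : R4 -> R) (Du : seq 'I_4 -> R4 -> R) :
  H20 u Du -> \int[l4]_x ((laplacian Du \_ B) x) = 0.
Proof.
move=> Hu.
have := green_H20 Hu (fun r => is_derive_cst (1 : R) r 1)
  (fun r => is_derive_cst (0 : R) r 1) (@cst_continuous R R 0).
have -> : \int[l4]_x ((laplacian Du \_ B) x * cst 1 (sqn x)) =
    \int[l4]_x ((laplacian Du \_ B) x).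
  by congr fine; congr integral; apply/funext => x; rewrite mulr1.
move=> ->.
have -> : \int[l4]_x ((u \_ B) x * (4 * sqn x * cst 0 (sqn x) + 8 * cst 0 (sqn x))) =
    \int[l4]_x (cst 0 x).
  by congr fine; congr integral; apply/funext => x; rewrite !mulr0 addr0 mulr0.
by rewrite Rintegral_cst// mul0r.
Qed.

Lemma integral_sqr_radialB (w : R -> R) : measurable_fun setT w ->
  sqint l4 ((fun x => w (enorm x)) \_ B) ->
  \int[l4]_x (((fun x => w (enorm x)) \_ B) x ^+ 2) =
  2 * pi ^+ 2 * \int[leb]_(r in `[0, 1]) (r ^+ 3 * w r ^+ 2).
Proof.
move=> mw [_ iw].
pose g (r : R) := w r ^+ 2 * \1_`]-oo, 1[ r.
have E x : ((fun x => w (enorm x)) \_ B) x ^+ 2 = g (enorm x).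
  have [Bx|Bx] := pselect (B x).
    by rewrite patchB_eq// /g indicE mem_set ?mulr1//= in_itv.
  by rewrite patchB_out// /g indicE memNset ?expr0n ?mulr0//.
have mg : measurable_fun setT g.
  by apply: measurable_funM; [exact: measurable_funX|exact: measurable_indic].
have ig : l4.-integrable setT (fun x => (g (enorm x))%:E).
  by move: iw; congr (l4.-integrable _ _); apply/funext => x; rewrite E.
have [i1 ->] : leb.-integrable `[0, +oo[ (fun r => (r ^+ 3 * g r)%:E) /\
    \int[l4]_x (((fun x => w (enorm x)) \_ B) x ^+ 2) =
    2 * pi ^+ 2 * \int[leb]_(r in `[0, +oo[) (r ^+ 3 * g r).
  have [h1 h2] := Rintegral_radial mg ig; split => //; rewrite -h2.
  by congr fine; congr integral; apply/funext => x; rewrite E.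
congr *%R.
have E2 : (fun r => (r ^+ 3 * g r)%:E) \_ `[0, +oo[ =
    (fun r => (r ^+ 3 * w r ^+ 2)%:E) \_ (`[0, 1[ : set R).
  apply/funext => r; rewrite !patchE /g indicE !mem_setE !in_itv/= andbT.
  by case: (0 <= r) => //=; case: (r < 1); rewrite ?mulr1// !mulr0.
have i2 : leb.-integrable `[0, 1[ (fun r => (r ^+ 3 * w r ^+ 2)%:E).
  by apply/(integrable_mkcond _ _).2 => //; rewrite -E2; apply/(integrable_mkcond _ _).1.
transitivity (\int[leb]_(r in `[0, 1[) (r ^+ 3 * w r ^+ 2)).
  by rewrite /Rintegral integral_mkcond E2 -integral_mkcond.
exact: Rintegral_itv_bndo_bndc.
Qed.

(** As [f] has mean 0 on [B], a constant [k] may be subtracted from the combined kernel before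
    applying Cauchy-Schwarz. The normalization [8 pi^2] is the one for which
    [8 pi^2 * (4 pi^2)^-2 * 2 pi^2 = 1]. *)
Lemma green_potential_form (f : R4 -> R) (p q s t : R) :
  sqint l4 (f \_ B) -> \int[l4]_x ((f \_ B) x ^+ 2) = 1 ->
  \int[l4]_x ((f \_ B) x) = 0 -> 0 < s -> s <= t ->
  (p * (Num.sqrt (8 * pi ^+ 2) * green_potential f (expR (- s))) +
   q * (Num.sqrt (8 * pi ^+ 2) * green_potential f (expR (- t)))) ^+ 2 <=
  p ^+ 2 * s + 2 * p * q * s + q ^+ 2 * t.
Proof.
move=> sf N1 I0 s0 st.
set a := expR (- s); set b := expR (- t).
have b0 : 0 < b by exact: expR_gt0.
have ba : b <= a by rewrite ler_expR lerN2.
have a1 : a < 1 by rewrite expR_lt1 oppr_lt0.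
have a0 : 0 < a by exact: expR_gt0.
pose k := p * (2 - a ^+ 2) + q * (2 - b ^+ 2).
have := @green_kernel_form R p q a b k b0 ba a1 erefl.
rewrite !expRK !opprK; set J := Rintegral _ _ _ => HJ.
pose eta (c : R) (x : R4) := (Num.max (c ^+ 2) (sqn x))^-1.
have se (c : R) : 0 < c -> sqint l4 (eta c \_ B).
  by move=> c0; apply: sqint_maxV; rewrite exprn_gt0.
pose w (r : R) := p * (Num.max (a ^+ 2) (r ^+ 2))^-1 + q * (Num.max (b ^+ 2) (r ^+ 2))^-1 - k.
have mw : measurable_fun setT w.
  have mm (c : R) : measurable_fun setT (fun r : R => (Num.max (c ^+ 2) (r ^+ 2))^-1).
    apply: (measurableT_comp measurable_invr).
    by apply: measurable_maxr => //; exact: measurable_funX.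
  apply: measurable_funB => //.
  by apply: measurable_funD; apply: measurable_funM.
have wE x : ((fun x => w (enorm x)) \_ B) x = p * (eta a \_ B) x + q * (eta b \_ B) x - ((fun=> k) \_ B) x.
  have [Bx|Bx] := pselect (B x).
    by rewrite !patchB_eq// /w sqr_enorm.
  by rewrite !patchB_out// !mulr0 addr0 subr0.
have sw : sqint l4 ((fun x => w (enorm x)) \_ B).
  rewrite (_ : _ \_ _ = fun x => (p * (eta a \_ B) x + q * (eta b \_ B) x) - ((fun=> k) \_ B) x); last exact/funext.
  apply: sqintB; last exact: sqint_cstB.
  by apply: sqint_lin; exact: se.
have CS := cauchy_schwarz sf sw.
rewrite N1 mul1r (integral_sqr_radialB mw sw) -/J in CS.
have ie (c : R) : 0 < c -> l4.-integrable setT (fun x => ((f \_ B) x * (eta c \_ B) x)%:E).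
  by move=> c0; apply: sqint_mul => //; exact: se.
have IE : \int[l4]_x ((f \_ B) x * ((fun x => w (enorm x)) \_ B) x) =
    p * \int[l4]_x ((f \_ B) x * (eta a \_ B) x) + q * \int[l4]_x ((f \_ B) x * (eta b \_ B) x).
  have -> : \int[l4]_x ((f \_ B) x * ((fun x => w (enorm x)) \_ B) x) =
     \int[l4]_x ((p * ((f \_ B) x * (eta a \_ B) x) + q * ((f \_ B) x * (eta b \_ B) x)) - k * (f \_ B) x).
    congr fine; congr integral; apply/funext => x; congr EFin; rewrite wE.
    have [Bx|Bx] := pselect (B x); first by rewrite !patchB_eq//; ring.
    by rewrite !patchB_out//; ring.
  have i1 := integrableZl_EFin p (ie a a0).
  have i2 := integrableZl_EFin q (ie b b0).
  rewrite RintegralB//; [|exact: integrableD_EFin|exact: integrableZl_EFin (sqint_integrable sf)].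
  rewrite RintegralD// !RintegralZl//; [|exact: sqint_integrable|exact: ie|exact: ie].
  by rewrite I0 mulr0 subr0.
have gE (c : R) : green_potential f c = - (4 * pi ^+ 2)^-1 * \int[l4]_x ((f \_ B) x * (eta c \_ B) x).
  congr *%R; congr fine; congr integral; apply/funext => x; congr EFin.
  exact: patchB_mul.
rewrite !gE; move: CS; rewrite IE.
set A := Rintegral _ _ _; set D := Rintegral _ _ _ => CS.
have pi0 : 0 < (pi : R) by exact: pi_gt0.
rewrite (_ : _ ^+ 2 = Num.sqrt (8 * pi ^+ 2) ^+ 2 / (4 * pi ^+ 2) ^+ 2 * (p * A + q * D) ^+ 2); last first.
  move: (Num.sqrt _) => r; move: (pi : R) pi0 => P P0; field; exact: lt0r_neq0.
rewrite sqr_sqrtr; last by rewrite mulr_ge0// sqr_ge0.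
apply: le_trans HJ.
rewrite -ler_pdivlMl; last by rewrite divr_gt0// ?mulr_gt0 ?exprn_gt0 ?mulr_gt0 ?exprn_gt0.
apply: (le_trans CS); rewrite le_eqVlt; apply/orP; left; apply/eqP.
clear CS; move: J (pi : R) pi0 => J' P P0; field; exact: lt0r_neq0.
Qed.

End Form.

Section UpperBound.
Context {R : realType}.
Local Notation leb := (@lebesgue_measure R).
Local Notation leb4 := (leb \x leb \x leb \x leb)%E.
Local Notation l4 := (sf_product (sf_product (sf_product leb leb) leb) leb).
Local Notation R4 := (R * R * R * R)%type.

(** The bound of [moser_exp] at [t = - ln r], with the Jacobian [r^-1] of this substitution. *)
Definition atan_kernel (a r : R) : R :=
  r^-1 * (8 / (1 + ln r ^+ 2) + 8 / (1 + (ln r + a) ^+ 2)).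

(** The antiderivative is 8 times a sum of two arctangents, each of total variation at most [pi];
    hence a bound free of [a], [x] and [y]. *)
Lemma atan_kernel_integral (a x y : R) : 0 < x -> x < y ->
  (\int[leb]_(r in `[x, y]) (atan_kernel a r)%:E <= (16 * pi)%:E)%E.
Proof.
move=> x0 xy.
pose H (r : R) := 8 * atan (ln r) + 8 * atan (ln r + a).
have dH (r : R) : 0 < r -> is_derive r (1 : R) H (atan_kernel a r).
  move=> r0; have dl := is_derive1_ln r0.
  have d1 : is_derive r (1 : R) (fun r => atan (ln r)) ((1 + ln r ^+ 2)^-1 * r^-1).
    exact: (@is_derive1_comp R atan (@ln R) r _ _ (is_derive1_atan _) dl).
  have d2 : is_derive r (1 : R) (fun r => atan (ln r + a)) ((1 + (ln r + a) ^+ 2)^-1 * r^-1).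
    have dla : is_derive r (1 : R) (fun r => ln r + a) r^-1.
      by apply: is_derive_eq; rewrite addr0.
    exact: (@is_derive1_comp R atan (fun r => ln r + a) r _ _ (is_derive1_atan _) dla).
  apply: is_derive_eq; rewrite /GRing.scale/= /atan_kernel.
  by ring.
have ck : {within `[x, y], continuous (atan_kernel a)}.
  apply: continuous_in_subspaceT => r; rewrite inE/= in_itv/= => /andP[xr _].
  have r0 := lt_le_trans x0 xr.
  have cl := continuous_ln r0.
  have cV (g : R -> R) : {for r, continuous g} ->
      {for r, continuous (fun s => 8 / (1 + g s ^+ 2))}.
    move=> cg; apply: cvgM; first exact: cvg_cst.
    apply: cvgV; first by rewrite gt_eqF// ltr_pwDl ?sqr_ge0.
    apply: cvgD; first exact: cvg_cst.
    by apply: cvgM; exact: cg.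
  apply: cvgM; first by apply: cvgV; [rewrite gt_eqF|exact: cvg_id].
  apply: cvgD; apply: cV; first exact: cl.
  by apply: cvgD; [exact: cl|exact: cvg_cst].
have cH (r : R) : 0 < r -> {for r, continuous H}.
  move=> r0; apply: differentiable_continuous; apply/derivable1_diffP.
  by have [] := dH r r0.
have y0 := lt_trans x0 xy.
rewrite (@continuous_FTC2 _ (atan_kernel a) H)//.
- rewrite -EFinB lee_fin /H.
  have := @atan_ltpi2 R (ln y); have := @atan_ltpi2 R (ln y + a).
  have := @atan_gtNpi2 R (ln x); have := @atan_gtNpi2 R (ln x + a).
  by lra.
- split.
  + by move=> r; rewrite in_itv/= => /andP[h1 h2]; have [] := dH r (lt_trans x0 h1).
  + by apply: cvg_at_right_filter; exact: cH.
  + by apply: cvg_at_left_filter; exact: cH.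
- by move=> r; rewrite in_itv/= => /andP[h1 h2]; rewrite derive1E; have [_] := dH r (lt_trans x0 h1).
Qed.

Lemma measurable_atan_kernel (a : R) : measurable_fun setT (atan_kernel a).
Proof.
apply: measurable_funM; first exact: measurable_invr.
have mV (g : R -> R) : measurable_fun setT g -> measurable_fun setT (fun s => 8 / (1 + g s ^+ 2)).
  move=> mg; apply: measurable_funM => //.
  apply: (measurableT_comp measurable_invr).
  by apply: measurable_funD => //; exact: measurable_funX.
apply: measurable_funD; apply: mV; first exact: measurable_ln.
by apply: measurable_funD => //; exact: measurable_ln.
Qed.

(** With [t = - ln r], [r^(3 + alpha) = r^-1 * exp (- (4 + alpha) t)], and the hypothesis on [sigma]
    gives [sigma * g^2 <= (4 + alpha) * gt^2]. So the left-hand side is at most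
    [r^-1 * exp (- (4 + alpha) D)], and [alpha * D >= 0] is discarded. *)
Lemma adams_pointwise (alpha sigma g gt a r : R) : 0 < alpha -> 0 < sigma ->
  sigma <= 32 * pi ^+ 2 * (1 + alpha / 4) -> 0 < r -> r < 1 ->
  gt = Num.sqrt (8 * pi ^+ 2) * g ->
  Num.min (- ln r) `|- ln r - a| / 8 <= - ln r - gt ^+ 2 ->
  r ^+ 3 * (r `^ alpha * expR (sigma * g ^+ 2)) <= atan_kernel a r.
Proof.
move=> a0 s0 sa r0 r1 ->.
have t0 : 0 < - ln r by rewrite oppr_gt0 ln_lt0// r0.
rewrite exprMn sqr_sqrtr; last by rewrite mulr_ge0 ?sqr_ge0.
set D := - ln r - 8 * pi ^+ 2 * g ^+ 2 => hD.
have D0 : 0 <= D by apply: le_trans hD; rewrite divr_ge0// le_min normr_ge0 ltW.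
have := moser_exp t0 hD.
have -> : 8 / (1 + (- ln r) ^+ 2) + 8 / (1 + (- ln r - a) ^+ 2) =
    8 / (1 + ln r ^+ 2) + 8 / (1 + (ln r + a) ^+ 2).
  by rewrite sqrrN -opprD sqrrN.
move=> h; rewrite /atan_kernel.
apply: (@le_trans _ _ (r^-1 * expR (- (4 * D)))); last first.
  by rewrite ler_wpM2l// invr_ge0 ltW.
rewrite -[in r ^+ 3](lnK r0) -[in r^-1](lnK r0) -expRN -expRM_natl /powR gt_eqF//.
rewrite -!expRD ler_expR.
have g0 : 0 <= g ^+ 2 by exact: sqr_ge0.
have h1 : sigma * g ^+ 2 <= 32 * pi ^+ 2 * (1 + alpha / 4) * g ^+ 2 by rewrite ler_wpM2r.
have h2 : 0 <= alpha * D by rewrite mulr_ge0// ltW.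
have DE : D = - ln r - 8 * pi ^+ 2 * g ^+ 2 by [].
rewrite DE in h2 *.
move: (pi ^+ 2) (g ^+ 2) (ln r) h1 h2 => P G l h1 h2; nra.
Qed.

(** Serves the measurability of the integrand; continuity comes for free from the quadratic
    inequalities. *)
Lemma continuous_green_potential (f : R4 -> R) (r : R) :
  sqint l4 (f \_ B) -> \int[l4]_x ((f \_ B) x ^+ 2) = 1 ->
  \int[l4]_x ((f \_ B) x) = 0 -> 0 < r -> r < 1 -> {for r, continuous (green_potential f)}.
Proof.
move=> sf N1 I0 r0 r1.
pose c : R := Num.sqrt (8 * pi ^+ 2).
have c0 : 0 < c by rewrite sqrtr_gt0 mulr_gt0// exprn_gt0// pi_gt0.
pose G t := c * green_potential f (expR (- t)).
have cG := @form_continuous R G (fun p q s t => @green_potential_form R f p q s t sf N1 I0).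
have t0 : 0 < - ln r by rewrite oppr_gt0 ln_lt0// r0.
have E (s : R) : 0 < s -> c^-1 * G (- ln s) = green_potential f s.
  by move=> s0; rewrite /G opprK lnK// mulKf// gt_eqF.
rewrite /prop_for /continuous_at.
have cc : c^-1 * G (- ln s) @[s --> r] --> green_potential f r.
  rewrite -(E r r0); apply: cvgM; first exact: cvg_cst.
  apply: (@continuous_comp _ _ _ (fun s => - ln s) G); last exact: cG.
  by apply: cvgN; exact: continuous_ln.
apply: cvg_trans cc; apply: near_eq_cvg.
near=> s; have s0 : 0 < s by near: s; exact: lt_nbhsr.
exact: E.
Unshelve. all: by end_near. Qed.

(** The point [a] of [moser_pointwise] depends on the compact interval, but the bound on the
    integral does not: exhaust []0, 1[] and use monotone convergence. *)
Lemma adams_radial_bound (f : R4 -> R) (alpha sigma : R) :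
  sqint l4 (f \_ B) -> \int[l4]_x ((f \_ B) x ^+ 2) = 1 ->
  \int[l4]_x ((f \_ B) x) = 0 -> 0 < alpha -> 0 < sigma ->
  sigma <= 32 * pi ^+ 2 * (1 + alpha / 4) ->
  let phi r := r `^ alpha * expR (sigma * green_potential f r ^+ 2) in
  measurable_fun [set` `]0, (1:R)[] phi /\
  (\int[leb]_(r in `]0%R, 1%R[) (r ^+ 3 * phi r)%:E <= (16 * pi)%:E)%E.
Proof.
move=> sf N1 I0 a0 s0 sa phi.
have mg : measurable_fun [set` `]0, (1:R)[] (green_potential f).
  apply: open_continuous_measurable_fun; first exact: interval_open.
  move=> r; rewrite inE/= in_itv/= => /andP[r0 r1].
  exact: continuous_green_potential.
have mphi : measurable_fun [set` `]0, (1:R)[] phi.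
  apply: measurable_funM; first by apply: measurable_funTS; exact: measurable_powR.
  have m2 : measurable_fun [set` `]0, (1:R)[] (fun r => sigma * green_potential f r ^+ 2).
    by apply: measurable_funM => //; exact: measurable_funX.
  exact: (measurableT_comp (@measurable_expR R) m2).
split => //.
(* Starting at 1/3 keeps [x n < 1 - x n], so that every interval is nondegenerate. *)
pose x n : R := (n.+3%:R)^-1.
have x0 n : 0 < x n by rewrite invr_gt0.
have x1 n : x n < 1 - x n.
  have : x n <= 3^-1 by rewrite lef_pV2// ?ler_nat// posrE.
  by move: (x0 n) => h1 h2; lra.
pose I (n : nat) : set R := [set` `[x n, 1 - x n]].
have I01 n r : I n r -> 0 < r /\ r < 1.
  rewrite /I /= in_itv/= => /andP[h1 h2].
  by split; [exact: lt_le_trans h1|rewrite (le_lt_trans h2)// gtrBl].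
have UI : [set` `]0, (1:R)[] = \bigcup_n I n.
  apply/seteqP; split => [r|r [n _ /I01[h1 h2]]]; last by rewrite /= in_itv/= h1.
  rewrite /= in_itv/= => /andP[r0 r1].
  have m0 : 0 < Num.min r (1 - r) by rewrite lt_min r0 subr_gt0.
  have [N _ HN] := near_infty_natSinv_lt (PosNum m0).
  have /= := HN N.+2 (leq_trans (leqnSn _) (leqnSn _)).
  rewrite lt_min => /andP[h1 h2]; exists N => //; rewrite /I /= in_itv/=.
  by rewrite (ltW h1)/= lerBrDr -lerBrDl ltW.
have ndI : nondecreasing_seq I.
  apply/nondecreasing_seqP => n; rewrite subsetEset => r; rewrite /I /= !in_itv/= => /andP[h1 h2].
  have : x n.+1 <= x n by rewrite lef_pV2 ?posrE// ler_nat.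
  by move=> h; rewrite (le_trans h h1)/= (le_trans h2)// lerD2l lerN2.
have mI n : measurable (I n) by exact: measurable_itv.
have m3 (D : set R) : measurable D -> D `<=` [set` `]0, (1:R)[] ->
    measurable_fun D (fun r : R => (r ^+ 3 * phi r)%:E).
  move=> mD D01; apply/measurable_EFinP; apply: measurable_funM.
    by apply: measurable_funTS; exact: measurable_funX.
  exact: measurable_funS D01 mphi.
have sub n : I n `<=` [set` `]0, (1:R)[] by rewrite UI; exact: bigcup_sup.
have ge0 n r : I n r -> (0 <= (r ^+ 3 * phi r)%:E)%E.
  move=> /I01[h1 h2]; rewrite lee_fin mulr_ge0 ?exprn_ge0 ?(ltW h1)//.
  by rewrite mulr_ge0 ?powR_ge0 ?expR_ge0.
have cvg := @ge0_nondecreasing_set_cvg_integral _ (measurableTypeR R) R I (fun r : R => (r ^+ 3 * phi r)%:E)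
  leb ndI mI (fun n => m3 _ (mI n) (sub n)) ge0.
rewrite UI -(cvg_lim _ cvg)//; apply: lime_le; first by apply/cvg_ex; eexists; exact: cvg.
near=> n.
pose c : R := Num.sqrt (8 * pi ^+ 2).
have [|| a Ha] := @moser_pointwise R (fun t => c * green_potential f (expR (- t)))
  (- ln (1 - x n)) (- ln (x n)) _ _
  (fun p q s t => @green_potential_form R f p q s t sf N1 I0).
- by rewrite oppr_gt0 ln_lt0// gtrBl x0 (lt_trans (x0 n) (x1 n)).
- by rewrite lerN2 ler_ln ?posrE// ?ltW// (lt_trans (x0 n) (x1 n)).
apply: le_trans (@atan_kernel_integral a _ _ (x0 n) (x1 n)).
apply: ge0_le_integral; [exact: mI|exact: ge0|exact: (m3 _ (mI n) (sub n))| |].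
- by apply/measurable_EFinP; apply: measurable_funTS; exact: measurable_atan_kernel.
- move=> r Ir; have [r0 r1] := I01 _ _ Ir.
  rewrite lee_fin; apply: (adams_pointwise a0 s0 sa r0 r1 erefl).
  move: Ir; rewrite /I /= in_itv/= => /andP[h1 h2].
  have := Ha (- ln r); rewrite opprK lnK//; apply.
    by rewrite lerN2 ler_ln ?posrE// (lt_trans (x0 n) (x1 n)).
  by rewrite lerN2 ler_ln ?posrE.
Unshelve. all: by end_near. Qed.

Lemma F_radial_bound (alpha sigma : R) (u : R4 -> R) (Du : seq 'I_4 -> R4 -> R) :
  0 < alpha -> 0 < sigma -> sigma <= 32 * pi ^+ 2 * (1 + alpha / 4) ->
  H20rad u Du -> L2norm (laplacian Du) = 1%E ->
  (F alpha sigma u <= (2 * pi ^+ 2)%:E * (16 * pi)%:E)%E.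
Proof.
move=> a0 s0 sa Hu N1.
have mu : measurable_fun (@B R) u.
  by have [[[<- H] _] _] := Hu; have [] := (H [::] isT).1.
have [sf N1'] := L2norm_eq1 (measurable_laplacian Hu.1) N1.
have rep := H20rad_representation Hu N1.
have := adams_radial_bound sf N1' (integral_laplacian_eq0 Hu.1) a0 s0 sa.
set f := laplacian Du in rep *.
pose phi r := r `^ alpha * expR (sigma * green_potential f r ^+ 2).
move=> [mphi bphi]; rewrite -/phi in mphi bphi.
pose psi := phi \_ [set` `]0, (1:R)[].
have mpsi : measurable_fun setT psi by apply: (measurable_restrictT _ _).1 => //; exact: measurable_itv.
have psi0 r : 0 <= psi r.
  by rewrite /psi patchE; case: ifP => // _; rewrite mulr_ge0 ?powR_ge0 ?expR_ge0.
have N0 : {ae leb4, forall x : R4, enorm x <> 0}.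
  exact: (ae_radial (measurable_set1 (0 : R)) (lebesgue_measure_set1 _)).
pose e (x : R4) := enorm x `^ alpha * expR (sigma * u x ^+ 2).
have E : (\int[l4]_x ((fun x => (e x)%:E) \_ B) x = \int[l4]_x (psi (enorm x))%:E)%E.
  apply: (@ae_eq_integral _ _ _ l4 setT (fun x => (psi (enorm x))%:E)) => //.
  - apply/(measurable_restrictT _ _).1; first exact: measurable_B.
    apply/measurable_EFinP; apply: measurable_funM.
      apply: measurable_funTS; apply: (measurableT_comp (measurable_powR _)).
      exact: measurable_enorm.
    have m2 : measurable_fun (@B R) (fun x => sigma * u x ^+ 2).
      by apply: measurable_funM => //; exact: measurable_funX.
    exact: (measurableT_comp (@measurable_expR R) m2).
  - apply/measurable_EFinP; exact: (measurableT_comp mpsi measurable_enorm).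
  suff : {ae leb4, forall x, [set: R4] x -> ((fun x => (e x)%:E) \_ B) x = (psi (enorm x))%:E} by [].
  near=> x; move=> _; have [Bx|Bx] := pselect (B x).
    rewrite patchE mem_set// /psi patchE mem_set.
      by rewrite /e /phi; congr (_ * expR (_ * _ ^+ 2))%:E; move: Bx; near: x; exact: rep.
    rewrite /= in_itv/= Bx andbT lt_def sqrtr_ge0 andbT.
    by apply/eqP; near: x; exact: N0.
  rewrite patchE memNset// /psi patchE memNset// => h; apply: Bx; move: h.
  by rewrite /= in_itv/= => /andP[].
have -> : F alpha sigma u = (\int[leb4]_x ((psi (enorm x))%:E))%E.
  by rewrite /F integral_mkcond; exact: E.
rewrite (ge0_integral_radial (f := fun r => (psi r)%:E)); last 2 first.
- exact/measurable_EFinP.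
- by move=> r; rewrite lee_fin.
apply: lee_wpmul2l; first by rewrite lee_fin mulr_ge0 ?sqr_ge0.
apply: le_trans bphi.
rewrite integral_mkcond [leRHS]integral_mkcond le_eqVlt; apply/orP; left; apply/eqP.
congr integral; apply/funext => r; rewrite !patchE /psi patchE !mem_setE !in_itv/= andbT.
case: ifPn => [r0|]; first by case: ifPn => _; rewrite ?mule0// EFinM.
by rewrite -ltNge => r0; rewrite (lt_gtF r0).
Unshelve. all: by end_near. Qed.

Lemma T0rad_lty (alpha sigma : R) : 0 < alpha -> 0 < sigma ->
  sigma <= 32 * pi ^+ 2 * (1 + alpha / 4) -> (T0rad alpha sigma < +oo)%E.
Proof.
move=> a0 s0 sa; apply: (@le_lt_trans _ _ ((2 * pi ^+ 2)%:E * (16 * pi)%:E)%E).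
  apply: ge_ereal_sup => _ /= [u [Du Hu N1] <-].
  exact: F_radial_bound Hu N1.
by rewrite -EFinM ltry.
Qed.

End UpperBound.

(** * The extremal family *)

Section FlatExp.
Context {R : realType}.

(** The powers of [y^-1] make the family stable under differentiation up to linear combinations;
    [S y] is [y * flat_exp 0 y]. *)
Definition flat_exp (n : nat) (y : R) : R :=
  if 0 < y then y^-1 ^+ n * expR (- y^-1) else 0.

Lemma flat_exp_pos n (y : R) : 0 < y -> flat_exp n y = y^-1 ^+ n * expR (- y^-1).
Proof. by rewrite /flat_exp => ->. Qed.

Lemma flat_exp_neg n (y : R) : y <= 0 -> flat_exp n y = 0.
Proof. by rewrite /flat_exp ltNge => ->. Qed.

(** One term of the exponential series at [y^-1], of degree [n + 2], leaves a quadratic bound, so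
    that difference quotients at 0 tend to 0. *)
Lemma flat_exp_le n (y : R) : `|flat_exp n y| <= n.+2`!%:R * `|y| ^+ 2.
Proof.
rewrite /flat_exp; case: ltP => y0; last by rewrite normr0 mulr_ge0 ?exprn_ge0.
have yV : 0 < y^-1 by rewrite invr_gt0.
rewrite !ger0_norm ?mulr_ge0 ?exprn_ge0 ?expR_ge0 ?(ltW y0) ?(ltW yV)//.
rewrite expRN ler_pdivrMr ?expR_gt0//.
have h : 1 + y^-1 ^+ n.+2 / n.+2`!%:R <= expR y^-1 by apply: expR_ge1Dxn; exact: ltW.
have f0 : 0 < n.+2`!%:R :> R by rewrite ltr0n fact_gt0.
apply: (@le_trans _ _ (n.+2`!%:R * y ^+ 2 * (y^-1 ^+ n.+2 / n.+2`!%:R))).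
  rewrite -[in leRHS]addn2 exprD; move: (y^-1 ^+ n) => w.
  rewrite le_eqVlt; apply/orP; left; apply/eqP; field.
  by rewrite !gt_eqF.
rewrite ler_wpM2l ?mulr_ge0 ?exprn_ge0 ?(ltW y0)//.
by apply: le_trans h; rewrite lerDr.
Qed.

Lemma is_derive_flat_exp n (y : R) :
  is_derive y (1 : R) (flat_exp n) (flat_exp n.+2 y - n%:R * flat_exp n.+1 y).
Proof.
have [y0|y0|->] := ltgtP y 0.
- rewrite !flat_exp_neg ?ltW// mulr0 subr0.
  apply: (@near_eq_is_derive _ _ _ (cst 0)) => //.
  near=> z; rewrite flat_exp_neg//; apply/ltW; near: z; exact: lt_nbhsl.
- rewrite !flat_exp_pos//.
  have dV : is_derive y (1 : R) (fun z : R => z^-1) (- (y^-1 ^+ 2)).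
    apply: is_derive_eq; first exact: (is_derive_invr (lt0r_neq0 y0) (is_derive_id _ _)).
    by rewrite mul1r exprVn.
  have dE : is_derive y (1 : R) (fun z : R => expR (- z^-1)) (expR (- y^-1) * y^-1 ^+ 2).
    have dN : is_derive y (1 : R) (fun z : R => - z^-1) (y^-1 ^+ 2).
      by apply: is_derive_eq; rewrite opprK.
    exact: (is_derive1_comp (is_derive_expR _) dN).
  have d : is_derive y (1 : R) (fun z : R => z^-1 ^+ n * expR (- z^-1))
      (y^-1 ^+ n.+2 * expR (- y^-1) - n%:R * (y^-1 ^+ n.+1 * expR (- y^-1))).
    have dX : is_derive y (1 : R) (fun z : R => z^-1 ^+ n) (- n%:R * y^-1 ^+ n.+1).
      case: n => [|n].
        by rewrite oppr0 mul0r; apply: is_derive_cst.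
      have dp : is_derive (y^-1) (1 : R) (fun w : R => w ^+ n.+1) (n.+1%:R * y^-1 ^+ n).
        rewrite (_ : (fun w : R => w ^+ n.+1) = @id R ^+ n.+1); last first.
          by apply/funext => w; rewrite exprfctE.
        by apply: is_derive_eq; rewrite /GRing.scale/= mulr1.
      apply: is_derive_eq; first exact: (is_derive1_comp dp dV).
      by rewrite !exprS; ring.
    apply: is_derive_eq; rewrite /GRing.scale/= !exprS; ring.
  apply: near_eq_is_derive d; near=> z.
  by rewrite flat_exp_pos//; near: z; exact: lt_nbhsr.
rewrite !flat_exp_neg// mulr0 subr0.
have H : (fun h : R => h^-1 *: ((flat_exp n \o shift 0) (h *: 1) - flat_exp n 0))
    @ 0^' --> (0 : R).
  apply/cvgrPdist_le => /= e e0; near=> h.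
  have h0 : h != 0 by near: h; exact: nbhs_dnbhs_neq.
  have f0 : 0 < n.+2`!%:R :> R by rewrite ltr0n fact_gt0.
  have he : `|h| < e / n.+2`!%:R by near: h; apply: dnbhs0_lt; rewrite divr_gt0.
  rewrite sub0r normrN (_ : h *: 1 + 0 = h); last by rewrite [h *: _]mulr1 addr0.
  rewrite [flat_exp n 0]flat_exp_neg// subr0 /GRing.scale/= normrM normfV.
  rewrite ler_pdivrMl ?normr_gt0// (le_trans (flat_exp_le n h))//.
  rewrite expr2 mulrCA ler_pM2l ?normr_gt0// mulrC -ler_pdivlMr//.
  exact: ltW.
split; first by apply/cvg_ex; exists 0.
by rewrite /derive; apply/cvg_lim.
Unshelve. all: by end_near. Qed.

End FlatExp.

Section SmoothClass.
Context {R : realType}.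
Local Notation R4 := (R * R * R * R)%type.
Variable e : R.
Hypothesis e0 : 0 < e.

Definition reg_inv (x : R4) : R := (sqn x + e)^-1.
(** The shift by 1 makes this nonpositive as soon as [|x| >= exp (- 1)], so that its smooth
    truncation is supported well inside [B]. *)
Definition reg_log (x : R4) : R := - (ln (sqn x + e) / 2) - 1.

Lemma sqn_reg_gt0 (x : R4) : 0 < sqn x + e.
Proof. by rewrite ltr_wpDl// sqn_ge0. Qed.

Lemma is_derive_shift_inv (r : R) : 0 < r + e ->
  is_derive r (1 : R) (fun r => (r + e)^-1) (- (r + e) ^- 2).
Proof.
move=> h; have h' : r + e != 0 by rewrite gt_eqF.
have ds : is_derive r (1 : R) (fun r => r + e) 1.
  by apply: is_derive_eq; rewrite addr0.
by have := @is_derive_invr R (fun r => r + e) _ _ h' ds; rewrite mul1r.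
Qed.

Lemma is_derive_shift_ln (r : R) : 0 < r + e ->
  is_derive r (1 : R) (fun r => - (ln (r + e) / 2) - 1) (- ((r + e)^-1 / 2)).
Proof.
move=> h; have ds : is_derive r (1 : R) (fun r => r + e) 1.
  by apply: is_derive_eq; rewrite addr0.
have dl : is_derive r (1 : R) (fun r => ln (r + e)) ((r + e)^-1).
  apply: is_derive_eq.
    exact: (@is_derive1_comp R (@ln R) (fun r => r + e) r _ _ (is_derive1_ln h) ds).
  by rewrite mulr1.
by apply: is_derive_eq; rewrite /GRing.scale/=; ring.
Qed.

(** This derivative and the next two are written with sums, products and constant factors only, so
    that the constructors of [smooth_expr] apply to them. *)
Lemma is_derive_reg_inv (i : 'I_4) (x : R4) :
  is_derive x (basis4 i) reg_inv (- 2 * (coord4 i x * (reg_inv x * reg_inv x))).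
Proof.
have d := is_derive_shift_inv (sqn_reg_gt0 x).
apply: is_derive_eq; first exact: (is_derive_comp1 (is_derive_sqn i x) d).
by rewrite /reg_inv -exprVn expr2; ring.
Qed.

Lemma is_derive_reg_log (i : 'I_4) (x : R4) :
  is_derive x (basis4 i) reg_log (- 1 * (coord4 i x * reg_inv x)).
Proof.
have d := is_derive_shift_ln (sqn_reg_gt0 x).
apply: is_derive_eq; first exact: (is_derive_comp1 (is_derive_sqn i x) d).
by rewrite /reg_inv; field; rewrite gt_eqF// sqn_reg_gt0.
Qed.

Lemma is_derive_flat_log n (i : 'I_4) (x : R4) :
  is_derive x (basis4 i) (fun x => flat_exp n (reg_log x))
    ((flat_exp n.+2 (reg_log x) + - n%:R * flat_exp n.+1 (reg_log x)) *
     (- 1 * (coord4 i x * reg_inv x))).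
Proof.
apply: is_derive_eq.
  exact: (is_derive_comp1 (is_derive_reg_log i x) (is_derive_flat_exp n _)).
by ring.
Qed.

(* A class of differentiable functions which contains [moser_fun] and is stable
   under partial derivatives; hence its members are smooth. *)
Inductive smooth_expr : (R4 -> R) -> Prop :=
| Smooth_cst c : smooth_expr (fun=> c)
| Smooth_coord i : smooth_expr (coord4 i)
| Smooth_inv : smooth_expr reg_inv
| Smooth_log : smooth_expr reg_log
| Smooth_flat n : smooth_expr (fun x => flat_exp n (reg_log x))
| Smooth_add f g : smooth_expr f -> smooth_expr g ->
    smooth_expr (fun x => f x + g x)
| Smooth_mul f g : smooth_expr f -> smooth_expr g ->
    smooth_expr (fun x => f x * g x).

Lemma differentiable_coord4 (i : 'I_4) (x : R4) : differentiable (coord4 i) x.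
Proof.
have lin : linear (coord4 i : R4 -> R).
  by case: i => [[|[|[|[|//]]]] Hi] a y z.
pose L := GRing.isLinear.Build R R4 R *:%R (coord4 i) lin.
pose cl : {linear R4 -> R} := HB.pack (coord4 i : R4 -> R) L.
exact: (@linear_differentiable R _ _ cl x (@continuous_coord4 R i)).
Qed.

Lemma differentiable_sqn (x : R4) : differentiable (@sqn R) x.
Proof.
rewrite (_ : @sqn R = \sum_(j < 4) (coord4 j * coord4 j)); last first.
  by apply/funext => y; rewrite sqnE fct_sumE; apply: eq_bigr => j _; rewrite expr2.
apply: differentiable_sum => j.
by apply: differentiableM; exact: differentiable_coord4.
Qed.

Lemma differentiable_comp1 (h : R -> R) (dh : R) (f : R4 -> R) (x : R4) :
  differentiable f x -> is_derive (f x) (1 : R) h dh -> differentiable (fun x => h (f x)) x.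
Proof.
move=> df [dh1 _]; apply: (@differentiable_comp _ _ _ _ f h) => //.
exact/derivable1_diffP.
Qed.

Lemma smooth_expr_differentiable f x : smooth_expr f -> differentiable f x.
Proof.
have dlog : differentiable reg_log x.
  exact: (differentiable_comp1 (differentiable_sqn x) (is_derive_shift_ln (sqn_reg_gt0 x))).
elim=> [c|i|||n|{}f g _ df _ dg|{}f g _ df _ dg] //.
- exact: differentiable_coord4.
- exact: (differentiable_comp1 (differentiable_sqn x) (is_derive_shift_inv (sqn_reg_gt0 x))).
- exact: (differentiable_comp1 dlog (is_derive_flat_exp n _)).
- exact: differentiableD.
- exact: differentiableM.
Qed.

Lemma smooth_expr_derive f i : smooth_expr f -> smooth_expr ('D_(basis4 i) f).
Proof.
have E (g g' : R4 -> R) : smooth_expr g' ->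
    (forall x, is_derive x (basis4 i) g (g' x)) -> smooth_expr ('D_(basis4 i) g).
  move=> sg' d; rewrite (_ : 'D_(basis4 i) g = g')//.
  by apply/funext => x; have [_] := d x.
have slg : smooth_expr (fun x => - 1 * (coord4 i x * reg_inv x)).
  by do 3 constructor.
elim=> [c|j|||n|{}f g sf df sg dg|{}f g sf df sg dg].
- by apply: (E _ _ (Smooth_cst 0)) => x; exact: is_derive_cst.
- by apply: (E _ _ (Smooth_cst (i == j)%:R)) => x; exact: is_derive_coord4.
- by apply: (E _ _ _ (is_derive_reg_inv i)); do 4 constructor.
- exact: (E _ _ _ (is_derive_reg_log i)).
- by apply: (E _ _ _ (is_derive_flat_log n i)); constructor => //; do 3 constructor.
- apply: (E _ _ (Smooth_add df dg)) => x.
  have Df : derivable f x (basis4 i).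
    by apply: diff_derivable; exact: smooth_expr_differentiable.
  have Dg : derivable g x (basis4 i).
    by apply: diff_derivable; exact: smooth_expr_differentiable.
  exact: (is_deriveD (derivableP Df) (derivableP Dg)).
- apply: (E _ _ (Smooth_add (Smooth_mul sf dg) (Smooth_mul sg df))) => x.
  have Df : derivable f x (basis4 i).
    by apply: diff_derivable; exact: smooth_expr_differentiable.
  have Dg : derivable g x (basis4 i).
    by apply: diff_derivable; exact: smooth_expr_differentiable.
  exact: (is_deriveM (derivableP Df) (derivableP Dg)).
Qed.

Lemma smooth_expr_partials s f : smooth_expr f -> smooth_expr (partials s f).
Proof. by move=> sf; elim: s => //= i s IH; exact: smooth_expr_derive. Qed.

End SmoothClass.

(** * Test functions as elements of H^2_0 *)

Section TestFunctions.
Context {R : realType}.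
Local Notation leb := (@lebesgue_measure R).
Local Notation leb4 := (leb \x leb \x leb \x leb)%E.
Local Notation l4 := (sf_product (sf_product (sf_product leb leb) leb) leb).
Local Notation R4 := (R * R * R * R)%type.

Lemma test_partials (s : seq 'I_4) (phi : R4 -> R) :
  test_function phi -> test_function (partials s phi).
Proof.
move=> [sphi [K [cK KB phi0]]]; split.
  by move=> s' x; rewrite /partials -foldr_cat; exact: sphi.
exists K; split => //; elim: s => //= i s IH; exact: (derive_eq0_off _ cK IH).
Qed.

Lemma test_continuous (s : seq 'I_4) (phi : R4 -> R) :
  test_function phi -> continuous (partials s phi).
Proof. by move=> [sphi _] x; exact: differentiable_continuous. Qed.

Lemma test_outside (phi : R4 -> R) x : test_function phi -> ~ B x -> phi x = 0.
Proof. by move=> [_ [K [_ KB phi0]]] Bx; apply: phi0 => /KB. Qed.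

Lemma test_sqint (phi : R4 -> R) : test_function phi -> sqint l4 phi.
Proof.
move=> tphi; have c := test_continuous (s := [::]) tphi.
have [_ [K [cK KB phi0]]] := tphi.
apply: box_sqint; first exact: continuous_measurable_fun4.
exact: (bnd_supp_box cK).
Qed.

Lemma integral_B_setT (f : R4 -> R) : (forall x, ~ B x -> f x = 0) ->
  (\int[leb4]_(x in B) (f x)%:E = \int[l4]_x (f x)%:E)%E.
Proof.
move=> f0; rewrite integral_mkcond; congr integral; apply/funext => x.
rewrite patchE; case: ifPn => // /negP Bx.
by rewrite f0// => h; apply: Bx; rewrite inE.
Qed.

Lemma test_ibp (i : 'I_4) (psi phi : R4 -> R) :
  test_function psi -> test_function phi ->
  (\int[leb4]_(x in B) (psi x * 'D_(basis4 i) phi x)%:E =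
   - \int[leb4]_(x in B) ('D_(basis4 i) psi x * phi x)%:E)%E.
Proof.
move=> tpsi tphi.
have tdpsi := test_partials [:: i] tpsi; have tdphi := test_partials [:: i] tphi.
rewrite !integral_B_setT; last 2 first.
- by move=> x Bx; rewrite (test_outside tphi Bx) mulr0.
- by move=> x Bx; rewrite (test_outside tpsi Bx) mul0r.
have i1 := sqint_mul (test_sqint tpsi) (test_sqint tdphi).
have i2 := sqint_mul (test_sqint tdpsi) (test_sqint tphi).
have D x : is_derive x (basis4 i) (psi * phi)
    (psi x * 'D_(basis4 i) phi x + 'D_(basis4 i) psi x * phi x).
  have Dd f : test_function f -> is_derive x (basis4 i) f ('D_(basis4 i) f x).
    by move=> [sf _]; apply/derivableP/diff_derivable/(sf [::]).
  apply: is_derive_eq; first exact: (is_deriveM (Dd _ tpsi) (Dd _ tphi)).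
  by rewrite /GRing.scale/= [phi x * _]mulrC.
have DE : 'D_(basis4 i) (psi * phi) =
    (fun x => psi x * 'D_(basis4 i) phi x + 'D_(basis4 i) psi x * phi x).
  by apply/funext => x; have [_] := D x.
have [_ [K [cK KB psi0]]] := tpsi.
have H : (\int[leb4]_x ('D_(basis4 i) (psi * phi) x)%:E = 0)%E.
  apply: (integral_partial_eq0 cK KB).
  - move=> x Kx; transitivity (psi x * phi x) => //.
    by rewrite (psi0 x Kx) mul0r.
  - by move=> x; have [] := D x.
  - rewrite DE => x; apply: cvgD; apply: cvgM.
    + exact: (test_continuous (s := [::]) tpsi).
    + exact: (test_continuous (s := [:: i]) tphi).
    + exact: (test_continuous (s := [:: i]) tpsi).
    + exact: (test_continuous (s := [::]) tphi).
have : (\int[l4]_x ((psi x * 'D_(basis4 i) phi x)%:E + ('D_(basis4 i) psi x * phi x)%:E) = 0)%E.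
  rewrite -[RHS]H; congr integral; apply/funext => x.
  by have [_ ->] := D x; rewrite EFinD.
rewrite integralD// => E.
have f1 := integrable_fin_num measurableT i1.
have f2 := integrable_fin_num measurableT i2.
move: E f1 f2; set a := integral _ _ _; set b := integral _ _ _.
move: a b => [a| |] [b| |]//= E _ _.
by move: E => [] E; congr EFin; lra.
Qed.

(* Moving the derivatives one at a time onto [psi] reverses their order. *)
Lemma test_weak_partial (s : seq 'I_4) (psi phi : R4 -> R) :
  test_function psi -> test_function phi ->
  (\int[leb4]_(x in B) (psi x * partials s phi x)%:E =
   ((-1) ^+ size s)%:E * \int[leb4]_(x in B) (partials (rev s) psi x * phi x)%:E)%E.
Proof.
elim: s psi => [|i s IH] psi tpsi tphi; first by rewrite /= expr0 mul1e.
rewrite [partials (i :: s) phi]/= test_ibp//; last exact: test_partials.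
have := IH _ (test_partials [:: i] tpsi) tphi; rewrite /= => ->.
rewrite -muleN1 muleAC -EFinM mulrN1 exprS mulN1r; congr (_ * _)%E.
by apply: eq_integral => x _; rewrite rev_cons /partials foldr_rcons.
Qed.

(** Integration by parts reverses the directions, hence the symmetry assumption; for [moser_fun] it
    is read off the explicit second derivatives. *)
Lemma test_H20 (psi : R4 -> R) : test_function psi ->
  (forall i j x, partials [:: i; j] psi x = partials [:: j; i] psi x) ->
  H20 psi (fun s => partials s psi).
Proof.
move=> tpsi sym.
have patchE' s : (partials s psi \_ B) = partials s psi.
  apply/funext => x; rewrite patchE; case: ifPn => // /negP Bx.
  by rewrite (test_outside (test_partials s tpsi))// => h; apply: Bx; rewrite inE.
split.
  split => // s s2; split; first split.
  - apply: measurable_funTS; apply: continuous_measurable_fun4.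
    exact: test_continuous.
  - have [_ iq] := test_sqint (test_partials s tpsi).
    rewrite L2normE patchE'.
    have := integrable_fin_num measurableT iq.
    by set a := integral _ _ _; move: a => [a| |]//= _; rewrite ltry.
  move=> phi tphi; rewrite test_weak_partial//; congr (_ * _)%E.
  apply: eq_integral => x _; congr (_ * _)%:E.
  case: s s2 => [_|i [_|j [_|k s h]]]; [reflexivity|reflexivity|exact: (sym j i x)|by []].
move=> e e0; exists psi => //.
have Z s : L2norm (partials s psi \- partials s psi) = 0%E.
  rewrite L2normE (_ : integral _ _ _ = 0%E); first by rewrite /= sqrtr0.
  apply: integral0_eq => x _; rewrite patchE; case: ifP => _; last by rewrite expr0n.
  by rewrite /= subrr expr0n.
rewrite /H2norm big1 ?poweR0r ?lte_fin// => k _; rewrite big1// => s _.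
by rewrite Z expe2 mule0.
Qed.

End TestFunctions.

(** * The truncated logarithms and their energy *)

Section FlatBounds.
Context {R : realType}.

Lemma flat_exp_ge0 n (y : R) : 0 <= flat_exp n y.
Proof.
rewrite /flat_exp; case: ltP => // y0.
by rewrite mulr_ge0 ?expR_ge0// exprn_ge0// invr_ge0 ltW.
Qed.

(** For [S y = y * flat_exp 0 y] one has [S' = flat_exp 0 + flat_exp 1] and [S'' = flat_exp 3]. This
    bound and the next one control the Laplacian of [moser_fun]. *)
Lemma flat_exp01_le1 (y : R) : flat_exp 0 y + flat_exp 1 y <= 1.
Proof.
have [y0|y0] := ltP 0 y; last by rewrite !flat_exp_neg// addr0.
rewrite !flat_exp_pos// expr0 expr1 -mulrDl expRN ler_pdivrMr ?expR_gt0// mul1r.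
exact: expR_ge1Dx.
Qed.

Lemma flat_exp3_le2 (y : R) : flat_exp 3 y <= 2.
Proof.
have [y0|y0] := ltP 0 y; last by rewrite !flat_exp_neg.
rewrite flat_exp_pos// expRN ler_pdivrMr ?expR_gt0//.
have x0 : 0 < y^-1 by rewrite invr_gt0.
move: (y^-1) x0 => x x0.
(* [x^3 exp (- x)] has its maximum [27 exp (- 3)] at 3; this is the tangent inequality there. It
   remains to see [exp 3 >= 27 / 2], for which [(5 / 4)^12] suffices. *)
have h1 : x / 3 <= expR (x / 3 - 1).
  by have := @expR_ge1Dx R (x / 3 - 1); lra.
have h2 : (5 / 4 : R) <= expR (4^-1).
  by have := @expR_ge1Dx R 4^-1; lra.
have -> : expR x = expR (x / 3 - 1) ^+ 3 * expR (4^-1) ^+ 12.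
  by rewrite -!expRM_natl -expRD; congr expR; field.
have h3 : (x / 3) ^+ 3 <= expR (x / 3 - 1) ^+ 3.
  by rewrite lerXn2r ?nnegrE ?expR_ge0// divr_ge0// ltW.
have h4 : (5 / 4 : R) ^+ 12 <= expR (4^-1) ^+ 12.
  by rewrite lerXn2r ?nnegrE ?expR_ge0.
have h5 : (x / 3) ^+ 3 * (5 / 4 : R) ^+ 12 <= expR (x / 3 - 1) ^+ 3 * expR (4^-1) ^+ 12.
  by rewrite ler_pM// exprn_ge0// divr_ge0// ltW.
apply: (@le_trans _ _ (2 * ((x / 3) ^+ 3 * (5 / 4 : R) ^+ 12))); last by rewrite ler_wpM2l.
have -> : 2 * ((x / 3) ^+ 3 * (5 / 4 : R) ^+ 12) = x ^+ 3 * (2 / 27 * (5 / 4) ^+ 12) by field.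
rewrite ler_pMr ?exprn_gt0//.
by lra.
Qed.

Lemma flat_exp0_ge (y : R) : y - 1 <= y * flat_exp 0 y.
Proof.
have [y0|y0] := ltP 0 y; last by rewrite flat_exp_neg// mulr0; lra.
rewrite flat_exp_pos// expr0 mul1r.
apply: (@le_trans _ _ (y * (1 - y^-1))).
  by rewrite mulrBr mulr1 divff// gt_eqF.
by rewrite ler_wpM2l ?(ltW y0)//; exact: expR_ge1Dx.
Qed.

Lemma flat_exp3_le01 (y : R) : 1 <= y -> flat_exp 3 y <= flat_exp 0 y + flat_exp 1 y.
Proof.
move=> y1; have y0 : 0 < y by apply: lt_le_trans y1.
rewrite !flat_exp_pos// expr0 expr1 -mulrDl ler_wpM2r ?expR_ge0//.
have v1 : y^-1 ^+ 3 <= 1 by rewrite exprn_ile1 ?invr_ge0 ?(ltW y0)// invf_le1.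
by rewrite (le_trans v1)// lerDl invr_ge0 ltW.
Qed.

Lemma flat_exp01_ge (y : R) : 1 <= y -> expR (-1) <= flat_exp 0 y + flat_exp 1 y.
Proof.
move=> y1; have y0 : 0 < y by apply: lt_le_trans y1.
apply: (@le_trans _ _ (flat_exp 0 y)); last by rewrite lerDl flat_exp_ge0.
by rewrite flat_exp_pos// expr0 mul1r ler_expR lerN2 invf_le1.
Qed.

End FlatBounds.

Section MoserFun.
Context {R : realType}.
Local Notation R4 := (R * R * R * R)%type.
Variables (e c : R).
Hypothesis e0 : 0 < e.
Local Notation lg := (reg_log e).
Local Notation q := (reg_inv e).

Definition moser_fun (x : R4) : R := c * (lg x * flat_exp 0 (lg x)).

Let slope (x : R4) : R := - c * ((flat_exp 0 (lg x) + flat_exp 1 (lg x)) * q x).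
Let slope' (x : R4) : R :=
  c * q x ^+ 2 * (flat_exp 3 (lg x) + 2 * (flat_exp 0 (lg x) + flat_exp 1 (lg x))).

Lemma moser_fun_partial (i : 'I_4) (x : R4) :
  is_derive x (basis4 i) moser_fun (coord4 i x * slope x).
Proof.
apply: is_derive_eq.
  apply: (is_deriveZ c); exact: (is_deriveM (is_derive_reg_log e0 i x) (is_derive_flat_log e0 0 i x)).
rewrite /GRing.scale/= /slope.
have [l0|l0] := ltP 0 (lg x); last by rewrite !flat_exp_neg//; ring.
rewrite !flat_exp_pos// !exprS expr0; field.
by rewrite gt_eqF.
Qed.

Lemma moser_fun_partial2 (i j : 'I_4) (x : R4) :
  partials [:: j; i] moser_fun x =
  (j == i)%:R * slope x + coord4 i x * coord4 j x * slope' x.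
Proof.
rewrite /=; have -> : 'D_(basis4 i) moser_fun = (fun x => coord4 i x * slope x).
  by apply/funext => y; have [_] := moser_fun_partial i y.
have ds : is_derive x (basis4 j) slope (coord4 j x * slope' x).
  apply: is_derive_eq.
    apply: (is_deriveZ (- c)).
    exact: (is_deriveM (is_deriveD (is_derive_flat_log e0 0 j x) (is_derive_flat_log e0 1 j x))
      (is_derive_reg_inv e0 j x)).
  by rewrite /GRing.scale/= /slope' addrfctE; ring.
have := is_deriveM (is_derive_coord4 j i x) ds => -[_ ->].
by rewrite /GRing.scale/=; ring.
Qed.

Lemma moser_fun_laplacian (x : R4) :
  laplacian (fun s => partials s moser_fun) x =
  c * ((sqn x * flat_exp 3 (lg x) -
    (2 * sqn x + 4 * e) * (flat_exp 0 (lg x) + flat_exp 1 (lg x))) * q x ^+ 2).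
Proof.
rewrite /laplacian (eq_bigr (fun i => slope x + coord4 i x ^+ 2 * slope' x)); last first.
  by move=> i _; rewrite moser_fun_partial2 eqxx mul1r -expr2.
rewrite big_split/= sumr_const -mulr_suml -sqnE card_ord /slope /slope' /reg_inv.
have := sqn_reg_gt0 e0 x => h.
by field; rewrite gt_eqF.
Qed.

Lemma compact_sqn_le (r : R) : r <= 1 -> compact [set x : R4 | sqn x <= r].
Proof.
move=> r1; apply: (@subclosed_compact _ _ box).
- rewrite (_ : [set x | _] = sqn @^-1` [set y | y <= r])//.
  by apply: preimage_closed; [move=> y _; exact: continuous_sqn|exact: closed_le].
- by do 3 (apply: compact_setX; last exact: segment_compact); exact: segment_compact.
move=> x /= xr.
have H (a : R) : a ^+ 2 <= sqn x -> `[-1, 1]%classic a.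
  move=> ale; rewrite /= in_itv/= -ler_norml -(@ler_pXn2r _ 2)// ?nnegrE//.
  by rewrite real_normK ?num_real// expr1n (le_trans ale)// (le_trans xr).
have := sqr_ge0 x.1.1.1; have := sqr_ge0 x.1.1.2.
have := sqr_ge0 x.1.2; have := sqr_ge0 x.2.
move=> h4 h3 h2 h1; rewrite /box.
by split => /=; [split=> /=; [split=> /=|]|]; apply: H; rewrite /sqn; lra.
Qed.

Lemma moser_fun_test : test_function moser_fun.
Proof.
split.
  move=> s x; apply: (smooth_expr_differentiable e0 (f := partials s moser_fun)).
  apply: smooth_expr_partials => //.
  apply: Smooth_mul; first exact: Smooth_cst.
  by apply: Smooth_mul; [exact: Smooth_log|exact: Smooth_flat].
have k1 : expR (-2) < 1 :> R by rewrite expR_lt1 oppr_lt0.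
(* [reg_log] is nonpositive where [sqn x + e >= exp (- 2)], in particular off this ball. *)
exists [set x : R4 | sqn x <= expR (-2)]; split.
- by apply: compact_sqn_le; exact: ltW.
- move=> x /= xk; rewrite /B /= enormE -sqrtr1 ltr_sqrt//.
  exact: le_lt_trans k1.
move=> x /negP; rewrite -ltNge => xk.
rewrite /moser_fun flat_exp_neg ?mulr0//.
have : -2 <= ln (sqn x + e).
  rewrite -[X in X <= _]expRK ler_ln ?posrE ?expR_gt0//; last exact: sqn_reg_gt0.
  by rewrite (le_trans (ltW xk))// lerDl ltW.
by rewrite /reg_log; lra.
Qed.

End MoserFun.

Section MoserNorm.
Context {R : realType}.
Local Notation leb := (@lebesgue_measure R).
Local Notation leb4 := (leb \x leb \x leb \x leb)%E.
Local Notation l4 := (sf_product (sf_product (sf_product leb leb) leb) leb).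
Local Notation R4 := (R * R * R * R)%type.

(** An annulus instead of a ball, because the weight [|x|^alpha] has a positive lower bound only
    away from the origin. *)
Lemma annulus_le_integral (f : R4 -> R) (C d : R) : 0 < d -> 0 <= C ->
  measurable_fun setT f -> (forall x, 0 <= f x) ->
  (forall x, d / 2 <= enorm x -> enorm x <= d -> C <= f x) ->
  ((2 * pi ^+ 2 * ((d / 2) ^+ 4 * C))%:E <= \int[leb4]_x (f x)%:E)%E.
Proof.
move=> d0 C0 mf f0 fC.
have d20 : 0 < d / 2 by rewrite divr_gt0.
have d2d : d / 2 < d by rewrite ltr_pdivrMr// ltr_pMr// ltr1n.
pose I : set R := [set` `[d / 2, d]].
pose g (r : R) := C * \1_I r.
have g0 r : 0 <= g r by rewrite /g mulr_ge0.
have mg : measurable_fun setT g.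
  apply: measurable_funM; first exact: measurable_cst.
  by apply: measurable_indic; exact: measurable_itv.
have step : (\int[leb4]_x (g (enorm x))%:E <= \int[leb4]_x (f x)%:E)%E.
  apply: (@ge0_le_integral _ _ _ l4) => //.
  - by move=> x _; rewrite lee_fin.
  - apply/measurable_EFinP; exact: (measurableT_comp mg measurable_enorm).
  - exact/measurable_EFinP.
  move=> x _; rewrite lee_fin /g indicE; case: (boolP (_ \in _)) => xI.
    by rewrite mulr1; move: xI; rewrite inE /I /= in_itv/= => /andP[h1 h2]; exact: fC.
  by rewrite mulr0.
apply: le_trans step; rewrite (ge0_integral_radial (f := fun r => (g r)%:E)); last 2 first.
- exact/measurable_EFinP.
- by move=> r; rewrite lee_fin.
rewrite EFinM; apply: lee_wpmul2l; first by rewrite lee_fin mulr_ge0 ?sqr_ge0.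
have mI : measurable (I : set (measurableTypeR R)) by exact: measurable_itv.
have m3 : measurable_fun setT (fun r : R => ((r ^+ 3)%:E * (g r)%:E)%E).
  apply: emeasurable_funM; apply/measurable_EFinP; last exact: mg.
  exact: (measurable_funX 3 (@measurable_id _ _ setT)).
apply: (@le_trans _ _ (\int[leb]_(r in I) ((d / 2) ^+ 3 * C)%:E)%E).
  rewrite integral_cst//= lebesgue_measure_itv/= lte_fin d2d -EFinD -EFinM lee_fin.
  by rewrite le_eqVlt; apply/orP; left; apply/eqP; field.
apply: (@le_trans _ _ (\int[leb]_(r in I) ((r ^+ 3)%:E * (g r)%:E))%E).
  apply: ge0_le_integral => //.
  - by move=> r _; rewrite lee_fin mulr_ge0// exprn_ge0// ltW.
  - exact: measurable_funTS.
  move=> r Ir; rewrite -EFinM lee_fin /g indicE mem_set// mulr1 ler_wpM2r//.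
  move: Ir; rewrite /I /= in_itv/= => /andP[h _].
  by rewrite lerXn2r ?nnegrE ?(ltW d20)// (le_trans (ltW d20)).
apply: ge0_subset_integral => //.
- exact: measurable_funTS.
- move=> r; rewrite /= in_itv/= andbT => r0; rewrite -EFinM lee_fin mulr_ge0//.
  exact: exprn_ge0.
- move=> r; rewrite /I /= !in_itv/= andbT => /andP[h _].
  by rewrite (le_trans (ltW d20)).
Qed.

Variable e : R.
Hypotheses (e0 : 0 < e) (e1 : e <= 1).

Local Notation lap1 := (laplacian (fun s => partials s (moser_fun e 1))).

Lemma moser_fun_H20 (c : R) : H20 (moser_fun e c) (fun s => partials s (moser_fun e c)).
Proof.
apply: test_H20; first exact: moser_fun_test.
move=> i j x; rewrite !moser_fun_partial2// eq_sym; congr (_ + _ * _).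
exact: mulrC.
Qed.

(** Up to the denominator the Laplacian is a difference of two terms that both lie between 0 and
    [2 * sqn x + 4 * e]. Bounding it by the larger term, not by the sum, keeps the leading constant
    of the energy sharp; this is why [flat_exp 3 <= 2] is needed. *)
Lemma lap1_le (x : R4) : `|lap1 x| <= (2 * sqn x + 4 * e) / (sqn x + e) ^+ 2.
Proof.
rewrite moser_fun_laplacian// mul1r /reg_inv exprVn normrM.
have q0 : 0 < (sqn x + e) ^+ 2 by rewrite exprn_gt0// sqn_reg_gt0.
rewrite [X in _ * X]ger0_norm ?invr_ge0 ?(ltW q0)//.
rewrite ler_wpM2r ?invr_ge0 ?(ltW q0)//.
move: (reg_log e x) => y; move: (sqn_ge0 x) (flat_exp3_le2 y) (flat_exp_ge0 3 y)
  (flat_exp01_le1 y) (flat_exp_ge0 0 y) (flat_exp_ge0 1 y).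
move: (sqn x) (flat_exp 3 y) (flat_exp 0 y) (flat_exp 1 y) => r E3 E0 E1 r0 h1 h2 h3 h4 h5.
have w0 : 0 <= 2 * r + 4 * e by rewrite addr_ge0 ?mulr_ge0// ltW.
have a1 : 0 <= r * E3 by rewrite mulr_ge0.
have a2 : 0 <= r * (2 - E3) by rewrite mulr_ge0// subr_ge0.
have a3 : 0 <= (2 * r + 4 * e) * (E0 + E1) by rewrite mulr_ge0// addr_ge0.
have a4 : 0 <= (2 * r + 4 * e) * (1 - (E0 + E1)) by rewrite mulr_ge0// subr_ge0.
rewrite mulrBr in a2; rewrite mulrBr mulr1 in a4.
move: (r * E3) ((2 * r + 4 * e) * (E0 + E1)) a1 a2 a3 a4 => Y Z a1 a2 a3 a4.
by rewrite ler_norml; apply/andP; split; move: e0; lra.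
Qed.

Lemma measurable_lap1 : measurable_fun (@B R) lap1.
Proof. by apply: measurable_laplacian; exact: moser_fun_H20. Qed.

Lemma lap1_sqint : sqint l4 (lap1 \_ B).
Proof.
apply: (@bounded_patch_sqint _ _ ((2 + 4 * e) / e ^+ 2)); first exact: measurable_lap1.
move=> x Bx; have /andP[r0 r1] := sqn_B Bx.
apply: (le_trans (lap1_le x)); apply: ler_pM.
- by rewrite addr_ge0 ?mulr_ge0// ltW.
- by rewrite invr_ge0 sqr_ge0.
- by rewrite lerD2r; lra.
- rewrite lef_pV2 ?posrE ?exprn_gt0 ?sqn_reg_gt0// lerXn2r ?nnegrE ?(ltW e0) ?lerDr//.
  by rewrite addr_ge0// ltW.
Qed.

Definition moser_energy : R := \int[l4]_x ((lap1 \_ B) x ^+ 2).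

Lemma moser_energy_le : moser_energy <= 4 * pi ^+ 2 * (2 - ln e).
Proof.
pose w (r : R) := (2 * r ^+ 2 + 4 * e) / (r ^+ 2 + e) ^+ 2.
have den (r : R) : 0 < r ^+ 2 + e by rewrite ltr_wpDl// sqr_ge0.
have cw : continuous w.
  have c2 (a b : R) : continuous (fun r : R => a * r ^+ 2 + b).
    move=> r; apply: cvgD; last exact: cvg_cst.
    by apply: cvgM; [exact: cvg_cst|exact: exprn_continuous].
  have c3 : continuous (fun r : R => r ^+ 2 + e).
    move=> r; apply: cvgD; last exact: cvg_cst.
    exact: exprn_continuous.
  move=> r; apply: cvgM; first exact: c2.
  apply: cvgV; first by rewrite gt_eqF// exprn_gt0.
  rewrite (_ : (fun x => _) = (fun r => (r ^+ 2 + e) * (r ^+ 2 + e))).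
    by rewrite expr2; apply: cvgM; exact: c3.
  by apply/funext => z; rewrite expr2.
have sw : sqint l4 ((fun x => w (enorm x)) \_ B).
  apply: (@bounded_patch_sqint _ _ ((2 + 4 * e) / e ^+ 2)).
    apply: measurable_funTS.
    exact: (measurableT_comp (continuous_measurable_fun cw) measurable_enorm).
  move=> x Bx; have /andP[r0 r1] := sqn_B Bx.
  rewrite /w sqr_enorm ger0_norm; last first.
    by rewrite divr_ge0 ?sqr_ge0// addr_ge0 ?mulr_ge0// ltW.
  apply: ler_pM.
  - by rewrite addr_ge0 ?mulr_ge0// ltW.
  - by rewrite invr_ge0 sqr_ge0.
  - by rewrite lerD2r; lra.
  - rewrite lef_pV2 ?posrE ?exprn_gt0 ?sqn_reg_gt0// lerXn2r ?nnegrE ?(ltW e0) ?lerDr//.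
    by rewrite addr_ge0// ltW.
have [_ i1] := lap1_sqint; have [_ i2] := sw.
apply: (@le_trans _ _ (\int[l4]_x (((fun x => w (enorm x)) \_ B) x ^+ 2))).
  apply: le_Rintegral => // x _.
  have [Bx|Bx] := pselect (B x); last by rewrite !patchB_out.
  rewrite !patchB_eq// -real_normK ?num_real// lerXn2r ?nnegrE ?normr_ge0//.
    by rewrite /w sqr_enorm divr_ge0 ?sqr_ge0// addr_ge0 ?mulr_ge0 ?sqn_ge0// ltW.
  by rewrite /w sqr_enorm; exact: lap1_le.
(* In the variable [v = r^2 + e], [r^3 w^2 dr] becomes [2 (v - e) (v + e)^2 v^-4 dv], of which [T]
   is the antiderivative; its logarithm produces [- ln e]. *)
rewrite (integral_sqr_radialB (continuous_measurable_fun cw) sw).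
pose T (v : R) := 2 * (ln v - e * v^-1 + e ^+ 2 / 2 * (v^-1 * v^-1) +
  e ^+ 3 / 3 * (v^-1 * (v^-1 * v^-1))).
have dT (v : R) : 0 < v -> is_derive v (1 : R) T
    (2 * (v^-1 + e * v^-1 ^+ 2 - e ^+ 2 * v^-1 ^+ 3 - e ^+ 3 * v^-1 ^+ 4)).
  move=> v0; have dl := is_derive1_ln v0.
  have dV : is_derive v (1 : R) (fun v : R => v^-1) (- (v^-1 ^+ 2)).
    apply: is_derive_eq; first exact: (is_derive_invr (lt0r_neq0 v0) (is_derive_id _ _)).
    by rewrite mul1r exprVn.
  apply: is_derive_eq; rewrite /GRing.scale/=; field.
  by rewrite gt_eqF.
have dF (r : R) : is_derive r (1 : R) (fun r => T (r ^+ 2 + e)) (r ^+ 3 * w r ^+ 2).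
  have ds : is_derive r (1 : R) (fun r => r ^+ 2 + e) (2 * r).
    by apply: is_derive_eq; rewrite /GRing.scale/=; ring.
  apply: is_derive_eq.
    exact: (@is_derive1_comp R T (fun r => r ^+ 2 + e) r _ _ (dT _ (den r)) ds).
  by rewrite /w; field; rewrite gt_eqF.
have -> : \int[leb]_(r in `[0, 1]) (r ^+ 3 * w r ^+ 2) = T (1 ^+ 2 + e) - T (0 ^+ 2 + e).
  apply: (@Rintegral_FTC _ (fun r => r ^+ 3 * w r ^+ 2) (fun r => T (r ^+ 2 + e))) => //.
    move=> r; apply: cvgM; first exact: exprn_continuous.
    rewrite (_ : (fun x => _) = (fun r => w r * w r)).
      by rewrite expr2; apply: cvgM; exact: cw.
    by apply/funext => z; rewrite expr2.
  by move=> r _; exact: (is_derive_continuous dF).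
rewrite expr1n expr0n/= add0r.
have p0 : 0 <= pi ^+ 2 :> R by exact: sqr_ge0.
suff h : T (1 + e) - T e <= 2 * (2 - ln e).
  have := ler_wpM2l p0 h; lra.
have l1 : ln (1 + e) <= e by apply: le_ln1Dx; rewrite (lt_trans _ e0)// oppr_lt0.
have v0 : 0 < 1 + e by rewrite addr_gt0.
(* All the rational terms of [T (1 + e)] are powers of [t], which lies in [[0, 1]]; those of [T e]
   do not depend on [e]. *)
pose t := e / (1 + e).
have t0 : 0 < t by rewrite divr_gt0.
have t1 : t <= 1 by rewrite /t ler_pdivrMr// mul1r lerDr.
have -> : T (1 + e) - T e = 2 * (ln (1 + e) - t + t ^+ 2 / 2 + t ^+ 3 / 3 - ln e + 6^-1).
  by rewrite /T /t; field; rewrite !gt_eqF.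
have t2 : t ^+ 2 <= t by rewrite expr2 ler_piMr// ltW.
have t3 : t ^+ 3 <= t by rewrite exprS ler_piMr ?exprn_ile1// ltW.
clearbody t; move: (ln (1 + e)) (ln e) l1 (t ^+ 2) (t ^+ 3) t2 t3 => a b l1 u v t2 t3.
by move: e0 e1 t0; lra.
Qed.

End MoserNorm.

Lemma patchB_scale (R : realType) (f g : R * R * R * R -> R) (c : R) x :
  (forall x, f x = c * g x) -> (f \_ B) x = c * (g \_ B) x.
Proof.
move=> fg; have [Bx|Bx] := pselect (B x); last by rewrite !(patchB_out _ Bx) mulr0.
by rewrite !(patchB_eq _ Bx).
Qed.

(** * Concentration and divergence above the threshold *)

Section LowerBound.
Context {R : realType}.
Local Notation leb := (@lebesgue_measure R).
Local Notation leb4 := (leb \x leb \x leb \x leb)%E.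
Local Notation l4 := (sf_product (sf_product (sf_product leb leb) leb) leb).
Local Notation R4 := (R * R * R * R)%type.

Variable L : R.
Hypothesis L8 : 8 <= L.
Let e : R := expR (- L).
Let d : R := expR (- (L / 2)).

Let e0 : 0 < e. Proof. exact: expR_gt0. Qed.
Let d0 : 0 < d. Proof. exact: expR_gt0. Qed.
Let d2e : d ^+ 2 = e.
Proof. by rewrite /d /e -expRM_natl; congr expR; field. Qed.
Let d1 : d < 1.
Proof. by rewrite /d expR_lt1 oppr_lt0 divr_gt0// (lt_le_trans _ L8). Qed.
Let e1 : e <= 1.
Proof. by rewrite /e -expR0 ler_expR oppr_le0 (le_trans _ L8). Qed.

Lemma annulus_log (x : R4) : enorm x <= d -> sqn x <= e /\ L / 2 - 2 <= reg_log e x.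
Proof.
move=> xd; have x2 : sqn x <= e.
  by rewrite -sqr_enorm -d2e lerXn2r// ?nnegrE ?sqrtr_ge0// ltW.
split => //.
have h : ln (sqn x + e) <= ln (2 * e).
  by rewrite ler_ln ?posrE ?mulr_gt0 ?sqn_reg_gt0//; lra.
have h2 : ln 2 <= 1 :> R by apply: (@le_ln1Dx R 1); rewrite (lt_trans _ ltr01)// oppr_lt0.
move: h; rewrite lnM ?posrE// {2}/e expRK /reg_log; move: (ln _) (ln 2) h2 => u v h2 h.
lra.
Qed.

Lemma annulus_B (x : R4) : enorm x <= d -> B x.
Proof. by move=> xd; rewrite /B /=; exact: le_lt_trans d1. Qed.

Local Notation I1 := (moser_energy e).

(** Needed to normalize. Where [y = reg_log e x >= 1], [S'' <= S'], so the two terms of the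
    Laplacian cannot cancel: [(2 |x|^2 + 4 e) S' - |x|^2 S'' >= 4 e S' >= 4 e exp (- 1)]. *)
Lemma moser_energy_gt0 : 0 < I1.
Proof.
have [mf i1] := lap1_sqint e0.
have C0 : 0 < (expR (-1) / e) ^+ 2 by rewrite exprn_gt0// divr_gt0// expR_gt0.
have := @annulus_le_integral R
  (fun x => (laplacian (fun s => partials s (moser_fun e 1)) \_ B) x ^+ 2) _ _ d0 (ltW C0).
move=> /(_ _ _ _) H.
have pos : 0 < 2 * pi ^+ 2 * ((d / 2) ^+ 4 * (expR (-1) / e) ^+ 2).
  by rewrite !mulr_gt0// ?exprn_gt0 ?pi_gt0// ?divr_gt0 ?invr_gt0 ?expR_gt0.
rewrite -lte_fin (_ : I1%:E = (\int[leb4]_x ((laplacian (fun s => partials s (moser_fun e 1)) \_ B) x ^+ 2)%:E)%E); last first.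
  rewrite /moser_energy /Rintegral fineK; first by [].
  exact: (integrable_fin_num measurableT i1).
apply: (@lt_le_trans _ _ (2 * pi ^+ 2 * ((d / 2) ^+ 4 * (expR (-1) / e) ^+ 2))%:E).
  by rewrite lte_fin.
apply: H.
- exact: measurable_funX.
- by move=> x; exact: sqr_ge0.
move=> x _ xd; have [x2 xl] := annulus_log xd.
rewrite patchB_eq; last exact: annulus_B.
rewrite -[leRHS]real_normK ?num_real// lerXn2r ?nnegrE ?normr_ge0//.
  by rewrite divr_ge0 ?expR_ge0// ltW.
rewrite moser_fun_laplacian// mul1r -normrN (le_trans _ (ler_norm _))//.
have y1 : 1 <= reg_log e x by apply: le_trans xl; move: L8; lra.
have h1 := flat_exp3_le01 y1; have h2 := flat_exp01_ge y1.
have r0 := sqn_ge0 x.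
have q1 : (2 * e)^-1 <= reg_inv e x.
  by rewrite lef_pV2 ?posrE ?mulr_gt0 ?sqn_reg_gt0//; lra.
have q2 : (2 * e)^-1 ^+ 2 <= reg_inv e x ^+ 2.
  rewrite lerXn2r ?nnegrE//; first by rewrite invr_ge0 mulr_ge0// ltW.
  by rewrite invr_ge0 ltW// sqn_reg_gt0.
have -> : expR (-1) / e = (4 * e * expR (-1)) * (2 * e)^-1 ^+ 2.
  by field; rewrite gt_eqF.
rewrite -mulNr; apply: ler_pM => //.
- by rewrite !mulr_ge0 ?expR_ge0// ltW.
- exact: sqr_ge0.
move: (flat_exp 0 _ + flat_exp 1 _) (flat_exp 3 _) (expR _) h1 h2 (expR_ge0 (-1 : R)) => S E3 c h1 h2 c0.
have a1 : sqn x * E3 <= sqn x * S by rewrite ler_wpM2l.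
have a2 : 4 * e * c <= 4 * e * S by rewrite ler_wpM2l// mulr_ge0// ltW.
have a3 : 0 <= sqn x * S by rewrite mulr_ge0// (le_trans _ h2)//; exact: expR_ge0.
by rewrite mulrDl; lra.
Qed.

Let c : R := (Num.sqrt I1)^-1.

Let c2 : c ^+ 2 = I1^-1.
Proof. by rewrite /c exprVn sqr_sqrtr// ltW// moser_energy_gt0. Qed.

Lemma moser_fun_norm1 :
  L2norm (laplacian (fun s => partials s (moser_fun e c))) = 1%E.
Proof.
rewrite L2normE.
have [mf i1] := lap1_sqint e0.
have -> : (\int[l4]_x ((laplacian (fun s => partials s (moser_fun e c)) \_ B) x ^+ 2)%:E =
  \int[l4]_x ((c ^+ 2)%:E * ((laplacian (fun s => partials s (moser_fun e 1)) \_ B) x ^+ 2)%:E))%E.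
  congr integral; apply/funext => x; rewrite -EFinM -exprMn; congr (_ ^+ 2)%:E.
  apply: patchB_scale => y.
  by rewrite (moser_fun_laplacian c e0) (moser_fun_laplacian 1 e0) mul1r.
rewrite integralZl//.
have -> : (\int[l4]_x ((laplacian (fun s => partials s (moser_fun e 1)) \_ B) x ^+ 2)%:E = I1%:E)%E.
  rewrite /moser_energy /Rintegral fineK; first by [].
  exact: (integrable_fin_num measurableT i1).
by rewrite -EFinM c2 mulVf ?gt_eqF ?moser_energy_gt0//= sqrtr1.
Qed.

Lemma moser_fun_H20rad : H20rad (moser_fun e c) (fun s => partials s (moser_fun e c)).
Proof.
split; first exact: moser_fun_H20.
pose l (r : R) := - (ln (r ^+ 2 + e) / 2) - 1.
exists (fun r => c * (l r * flat_exp 0 (l r))).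
by apply: aeW => x _; rewrite /l sqr_enorm.
Qed.

(** On the annulus of radii [d / 2] and [d] the exponential is at least [exp (tau * (L - 14))],
    while volume and weight contribute [(d / 2)^(4 + alpha)]. The product is some [exp E] with [E]
    bounded below by an affine function of [L], and [exp E >= 1 + E] is enough for divergence. *)
Lemma moser_fun_F_ge (alpha sigma : R) : 0 < alpha -> 0 < sigma ->
  (((sigma / (16 * pi ^+ 2) - (4 + alpha) / 2) * L -
   (14 * (sigma / (16 * pi ^+ 2)) + 4 + alpha))%:E <= F alpha sigma (moser_fun e c))%E.
Proof.
move=> a0 s0.
have pi0 : 0 < pi ^+ 2 :> R by rewrite exprn_gt0// pi_gt0.
pose tau := sigma / (16 * pi ^+ 2).
have tau0 : 0 < tau by rewrite divr_gt0// mulr_gt0.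
rewrite -/tau.
have LN : ln e = - L by rewrite /e expRK.
have I0 := moser_energy_gt0.
have Ile : I1 <= 4 * pi ^+ 2 * (2 + L).
  by have := moser_energy_le e0 e1; rewrite LN opprK.
have L2 : 0 < 2 + L by move: L8; lra.
pose C := (d / 2) `^ alpha * expR (tau * (L - 14)).
have C0 : 0 <= C by rewrite mulr_ge0 ?powR_ge0 ?expR_ge0.
pose f (x : R4) := enorm x `^ alpha * expR (sigma * moser_fun e c x ^+ 2).
have mf : measurable_fun setT (f \_ B).
  apply: measurable_patchB; apply: measurable_funM.
    apply: measurable_funTS; apply: (measurableT_comp (measurable_powR _)).
    exact: measurable_enorm.
  have m2 : measurable_fun (@B R) (fun x => sigma * moser_fun e c x ^+ 2).
    apply: measurable_funM => //; apply: measurable_funX; apply: measurable_funTS.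
    apply: continuous_measurable_fun4.
    exact: (test_continuous (s := [::]) (moser_fun_test c e0)).
  exact: (measurableT_comp (@measurable_expR R) m2).
have f0 x : 0 <= (f \_ B) x.
  by rewrite patchE; case: ifP => // _; rewrite mulr_ge0 ?powR_ge0 ?expR_ge0.
have fC x : d / 2 <= enorm x -> enorm x <= d -> C <= (f \_ B) x.
  move=> dx xd; have [_ xl] := annulus_log xd.
  rewrite patchB_eq; last exact: annulus_B.
  have d20 : 0 <= d / 2 by rewrite divr_ge0// ltW.
  apply: ler_pM; rewrite ?powR_ge0 ?expR_ge0//.
    by rewrite ge0_ler_powR ?nnegrE ?(ltW a0)// sqrtr_ge0.
  rewrite ler_expR /moser_fun exprMn c2.
  have h1 : L / 2 - 3 <= reg_log e x * flat_exp 0 (reg_log e x).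
    by apply: le_trans (flat_exp0_ge _); move: xl; lra.
  have h2 : (L / 2 - 3) ^+ 2 <= (reg_log e x * flat_exp 0 (reg_log e x)) ^+ 2.
    have L3 : 0 <= L / 2 - 3 by move: L8; lra.
    by rewrite lerXn2r ?nnegrE// (le_trans L3).
  have h4 : 0 < 4 * pi ^+ 2 * (2 + L) by apply: mulr_gt0 => //; exact: mulr_gt0.
  have h3 : (4 * pi ^+ 2 * (2 + L))^-1 <= I1^-1 by rewrite lef_pV2 ?posrE.
  apply: (@le_trans _ _ (sigma * ((4 * pi ^+ 2 * (2 + L))^-1 * (L / 2 - 3) ^+ 2))).
    have -> : sigma * ((4 * pi ^+ 2 * (2 + L))^-1 * (L / 2 - 3) ^+ 2) =
        tau * ((L - 6) ^+ 2 / (2 + L)).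
      rewrite /tau; move: (pi ^+ 2) pi0 => P P0; field.
      by rewrite !gt_eqF.
    (* Origin of 14: [(L - 6)^2 = (L - 14) * (L + 2) + 64]. *)
    rewrite ler_wpM2l ?(ltW tau0)// ler_pdivlMr//.
    by move: L8; nra.
  rewrite ler_wpM2l ?(ltW s0)//; apply: ler_pM => //.
  - by rewrite invr_ge0 ltW.
  - exact: sqr_ge0.
have := annulus_le_integral d0 C0 mf f0 fC.
have -> : (\int[leb4]_x ((f \_ B) x)%:E = F alpha sigma (moser_fun e c))%E.
  rewrite /F [RHS]integral_mkcond; congr integral; apply/funext => x.
  by rewrite !patchE; case: ifP.
apply: le_trans; rewrite lee_fin /C.
have d20 : 0 < d / 2 by rewrite divr_gt0.
have -> : (d / 2) ^+ 4 * ((d / 2) `^ alpha * expR (tau * (L - 14))) =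
    expR ((4 + alpha) * ln (d / 2) + tau * (L - 14)).
  rewrite -[in (d / 2) ^+ 4](lnK d20) -expRM_natl /powR gt_eqF//.
  by rewrite -!expRD; congr expR; ring.
have ld : - (L / 2) - 1 <= ln (d / 2).
  rewrite lnM ?posrE ?invr_gt0// lnV ?posrE// /d expRK.
  have h2 : ln 2 <= 1 :> R by apply: (@le_ln1Dx R 1); rewrite (lt_trans _ ltr01)// oppr_lt0.
  by move: h2; lra.
have pi1 : 1 <= 2 * pi ^+ 2 :> R.
  by have := @pi_ge2 R => h; nra.
set E := (4 + alpha) * ln (d / 2) + tau * (L - 14).
apply: (@le_trans _ _ (expR E)); last by rewrite ler_peMl// expR_ge0.
apply: le_trans (expR_ge1Dx E).
have : (4 + alpha) * (- (L / 2) - 1) <= (4 + alpha) * ln (d / 2).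
  by rewrite ler_wpM2l// addr_ge0// ltW.
rewrite /E; move: (ln (d / 2)) => z h; lra.
Qed.

End LowerBound.

Section Final.
Context {R : realType}.

Lemma T0rad_pinfty (alpha sigma : R) : 0 < alpha -> 0 < sigma ->
  32 * pi ^+ 2 * (1 + alpha / 4) < sigma -> T0rad alpha sigma = +oo%E.
Proof.
move=> a0 s0 sa.
have pi0 : 0 < pi ^+ 2 :> R by rewrite exprn_gt0// pi_gt0.
pose k := sigma / (16 * pi ^+ 2) - (4 + alpha) / 2.
pose C := 14 * (sigma / (16 * pi ^+ 2)) + 4 + alpha.
(* [k > 0] amounts to [8 pi^2 (4 + alpha) < sigma], the same threshold as in the upper bound. *)
have k0 : 0 < k.
  have P0 : 0 < 16 * pi ^+ 2 :> R by apply: mulr_gt0.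
  rewrite /k subr_gt0 (ltr_pdivlMr _ _ P0); apply: le_lt_trans sa.
  by move: (pi ^+ 2) => P; rewrite le_eqVlt; apply/orP; left; apply/eqP; field.
apply/eqyP => A A0.
pose L := Num.max 8 ((A + C) / k).
have L8 : 8 <= L by rewrite le_max lexx.
have LA : A <= k * L - C.
  by rewrite lerBrDr -ler_pdivrMl// mulrC le_max lexx orbT.
apply: (@le_trans _ _ (k * L - C)%:E); first by rewrite lee_fin.
apply: (le_trans (moser_fun_F_ge L8 a0 s0)).
apply: ereal_sup_ubound; eexists; last reflexivity.
exists (fun s => partials s (moser_fun (expR (- L)) (Num.sqrt (moser_energy (expR (- L))))^-1)).
  exact: moser_fun_H20rad.
exact: moser_fun_norm1.
Qed.

End Final.

Theorem theorem2 (R : realType) (alpha sigma : R)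
    (alpha_gt0 : 0 < alpha) (sigma_gt0 : 0 < sigma) :
  (T0rad alpha sigma < +oo)%E
  <-> sigma <= 32 * pi ^+ 2 * (1 + alpha / 4).
Proof.
split; last exact: T0rad_lty.
by apply: contraTle => /(T0rad_pinfty alpha_gt0 sigma_gt0) ->.
Qed.
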